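(* Let $M$ be an mtt and let $m$ be the maximum rank of the states of $M$. Then, given $s\in T_\Sigma$ and $t\in T_\Delta$, whether $(s,t)\in\tau_{\mathrm{IO},M}$ can be determined in time $O(|s|\cdot|t|^{2m+2}\cdot|M|)$.
   Context: A ranked alphabet is a finite set $\Sigma$ with a rank function; $\Sigma^{(k)}$ denotes the rank-$k$ symbols; $T_\Sigma$ is the set of ranked trees over $\Sigma$; $|t|$ is the number of nodes. Fix disjoint rank-0 symbol sets $X=\{x_1,\dots\}$, $Y=\{y_1,\dots\}$, $X_k=\{x_1,\dots,x_k\}$, $Y_m=\{y_1,\dots,y_m\}$. A macro tree transducer (mtt) is $M=(Q,\Sigma,\Delta,q_0,R)$: $Q$ a ranked alphabet of states, $\Sigma,\Delta$ input/output ranked alphabets, $q_0\in Q^{(0)}$, $R$ a finite (possibly nondeterministic) set of rules $\langle q,\sigma(x_1,\dots,x_k)\rangle(y_1,\dots,y_m)\to r$ with $q\in Q^{(m)}$, $\sigma\in\Sigma^{(k)}$, $r\in T_{\Delta\cup(Q\times X_k)\cup Y_m}$ ($\langle q',x_i\rangle$ has the rank of $q'$); $R_{q,\sigma}$ is the set of such right-hand sides. The size of $M$ is $|M|=\sum_{q,\sigma}\sum_{r\in R_{q,\sigma}}|r|$. IO (call-by-value) semantics: for $u\in T_{\Delta\cup(Q\times T_\Sigma)\cup Y}$, $[\![y_i]\!]=\{y_i\}$, $[\![\delta(u_1,\dots,u_n)]\!]=\{\delta(t_1,\dots,t_n)\mid t_i\in[\![u_i]\!]\}$, $[\![\langle q,\sigma(s_1,\dots,s_k)\rangle(u_1,\dots,u_m)]\!]=\bigcup_{r\in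 R_{q,\sigma}}\{t[y_1/t_1,\dots,y_m/t_m]\mid t\in[\![r[x_1/s_1,\dots,x_k/s_k]]\!],\ t_i\in[\![u_i]\!]\}$ (every occurrence of $y_i$ is replaced by the same tree $t_i$). The IO translation is $\tau_{\mathrm{IO},M}=\{(s,t)\in T_\Sigma\times T_\Delta\mid t\in[\![\langle q_0,s\rangle]\!]\}$. *)

(* Defs.v *)
From Stdlib Require Import List Arith.
Import ListNotations.
Set Implicit Arguments.

Inductive tree : Type := Node : nat -> list tree -> tree.

(* A ranked alphabet: a finite list of (symbol, rank) pairs, each symbol once. *)
Definition ralph := list (nat * nat).
Definition ralph_ok (A : ralph) : Prop := NoDup (map fst A).

Inductive wf_tree (A : ralph) : tree -> Prop :=
| wf_node : forall a ts, In (a, length ts) A -> Forall (wf_tree A) ts ->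
    wf_tree A (Node a ts).

Fixpoint tsize (t : tree) : nat :=
  match t with Node _ ts => S (list_sum (map tsize ts)) end.

(* Right-hand sides: trees over Delta ∪ (Q × X_k) ∪ Y_m.
   RCall q i args = <q, x_i>(args), RPar j = y_j   (indices are 1-based) *)
Inductive rhs : Type :=
| ROut  : nat -> list rhs -> rhs
| RCall : nat -> nat -> list rhs -> rhs
| RPar  : nat -> rhs.

Fixpoint rsize (r : rhs) : nat :=
  match r with
  | ROut _ us => S (list_sum (map rsize us))
  | RCall _ _ us => S (list_sum (map rsize us))
  | RPar _ => 1
  end.

(* M = (Q, Sigma, Delta, q0, R); a rule (q, sigma, r) stands for
   <q, sigma(x_1..x_k)>(y_1..y_m) -> r *)
Record mtt : Type := Mtt {
  states : ralph;
  inp : ralph;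
  outp : ralph;
  q0 : nat;
  rules : list (nat * nat * rhs)
}.

Inductive wf_rhs (M : mtt) (k m : nat) : rhs -> Prop :=
| wfr_out : forall d us, In (d, length us) (outp M) ->
    Forall (wf_rhs M k m) us -> wf_rhs M k m (ROut d us)
| wfr_call : forall q i us, In (q, length us) (states M) -> 1 <= i <= k ->
    Forall (wf_rhs M k m) us -> wf_rhs M k m (RCall q i us)
| wfr_par : forall j, 1 <= j <= m -> wf_rhs M k m (RPar j).

Definition wf_mtt (M : mtt) : Prop :=
  ralph_ok (states M) /\ ralph_ok (inp M) /\ ralph_ok (outp M) /\
  In (q0 M, 0) (states M) /\
  NoDup (rules M) /\
  (forall q sg r, In (q, sg, r) (rules M) ->
     exists m k, In (q, m) (states M) /\ In (sg, k) (inp M) /\ wf_rhs M k m r).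

Definition msize (M : mtt) : nat :=
  list_sum (map (fun qr => rsize (snd qr)) (rules M)).

Definition max_state_rank (M : mtt) : nat := list_max (map snd (states M)).

(* Sentential forms: trees in T_{Delta ∪ (Q × T_Sigma) ∪ Y} *)
Inductive form : Type :=
| FOut  : nat -> list form -> form
| FCall : nat -> tree -> list form -> form
| FY    : nat -> form.

Fixpoint inst (ss : list tree) (r : rhs) : form :=
  match r with
  | ROut d us => FOut d (map (inst ss) us)
  | RCall q i us => FCall q (nth (i - 1) ss (Node 0 [])) (map (inst ss) us)
  | RPar j => FY j
  end.

Fixpoint subst (ts : list form) (u : form) : form :=
  match u with
  | FOut d us => FOut d (map (subst ts) us)
  | FCall q s us => FCall q s (map (subst ts) us)
  | FY j => nth (j - 1) ts (FY j)
  end.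

Inductive den (M : mtt) : form -> form -> Prop :=
| den_y : forall j, den M (FY j) (FY j)
| den_out : forall d us ts, Forall2 (den M) us ts -> den M (FOut d us) (FOut d ts)
| den_call : forall q sg ss us r t ts,
    In (q, sg, r) (rules M) ->
    den M (inst ss r) t ->
    Forall2 (den M) us ts ->
    den M (FCall q (Node sg ss) us) (subst ts t).

Fixpoint form_of_tree (t : tree) : form :=
  match t with Node d ts => FOut d (map form_of_tree ts) end.

Definition tau_IO (M : mtt) (s t : tree) : Prop :=
  wf_tree (inp M) s /\ wf_tree (outp M) t /\
  den M (FCall (q0 M) s []) (form_of_tree t).

(* ---------- Machine model: unit-cost RAM (add/sub, indirect addressing) ---------- *)
Inductive instr : Type :=
| IConst : nat -> nat -> instr
| IAdd   : nat -> nat -> nat -> instr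
| ISub   : nat -> nat -> nat -> instr
| ILoad  : nat -> nat -> instr
| IStore : nat -> nat -> instr
| IJz    : nat -> nat -> instr
| IHalt  : instr.

Definition config : Type := (nat * (nat -> nat))%type.

Definition upd (mem : nat -> nat) (a v : nat) : nat -> nat :=
  fun x => if Nat.eqb x a then v else mem x.

Definition step (P : list instr) (c : config) : option config :=
  let (pc, mem) := c in
  match nth_error P pc with
  | None => None
  | Some IHalt => None
  | Some (IConst r n) => Some (S pc, upd mem r n)
  | Some (IAdd r a b) => Some (S pc, upd mem r (mem a + mem b))
  | Some (ISub r a b) => Some (S pc, upd mem r (mem a - mem b))
  | Some (ILoad r a) => Some (S pc, upd mem r (mem (mem a)))
  | Some (IStore a r) => Some (S pc, upd mem (mem a) (mem r))
  | Some (IJz r l) => Some (if Nat.eqb (mem r) 0 then l else S pc, mem)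
  end.

Definition halted (P : list instr) (c : config) : Prop := step P c = None.

Fixpoint run (P : list instr) (n : nat) (c : config) : config :=
  match n with
  | 0 => c
  | S n' => match step P c with None => c | Some c' => run P n' c' end
  end.

Definition init (code : list nat) : config := (0, fun a => nth a code 0).

Fixpoint enc_tree (t : tree) : list nat :=
  match t with Node a ts => a :: length ts :: flat_map enc_tree ts end.

Fixpoint enc_rhs (r : rhs) : list nat :=
  match r with
  | ROut d us => 0 :: d :: length us :: flat_map enc_rhs us
  | RCall q i us => 1 :: q :: i :: length us :: flat_map enc_rhs us
  | RPar j => [2; j]
  end.

Definition enc_rule (x : nat * nat * rhs) : list nat :=
  match x with (q, sg, r) => q :: sg :: enc_rhs r end.

Definition enc_ralph (A : ralph) : list nat :=
  length A :: flat_map (fun p => [fst p; snd p]) A.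

(* Layout: [ptr_rules; ptr_s; ptr_t; ptr_alphabets; q0; #rules;
            rules...; s...; t...; Q; Sigma; Delta] *)
Definition enc_input (M : mtt) (s t : tree) : list nat :=
  let R := flat_map enc_rule (rules M) in
  let S := enc_tree s in
  let T := enc_tree t in
  let A := enc_ralph (states M) ++ enc_ralph (inp M) ++ enc_ralph (outp M) in
  6 :: (6 + length R) :: (6 + length R + length S)
    :: (6 + length R + length S + length T)
    :: q0 M :: length (rules M) :: R ++ S ++ T ++ A.

Definition decides_within (P : list instr) (code : list nat) (n : nat) (b : Prop) : Prop :=
  halted P (run P n (init code)) /\
  (snd (run P n (init code)) 0 <> 0 <-> b).

(* Main.v *)
(* The subtrees of s are processed bottom-up. For an input node v and a state q of rank m, a block of
   m + 1 + |t|^(m+1) bits records whether <q, v> yields anything, which parameters it can return unchanged, and for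
   which subtrees t_0, ..., t_m of t it yields, other than as a bare parameter, a tree that becomes t_0 when t_i is
   substituted for y_i. By call-by-value only subtrees of t can be values of parameters that are used, and a used
   parameter is then a proper subtree of t_0; hence t_i = t_0 can encode an arbitrary, unused y_i, and |t| values per
   parameter suffice. For given v, rule and t_0, ..., t_m, the subtrees of t that a node of the right-hand side
   generates are computed bottom-up; a call with k arguments costs O((k+1) |t|^(k+1)) steps, and the numbers k + 1
   add up to the size of the right-hand side. A structured language with a cost semantics, compiled to the machine,
   expresses this procedure. *)

Require Import Defs.
From Stdlib Require Import List Arith Lia Bool Classical.
Import ListNotations.

(** Bare parameters are recorded apart because in a fact t_i = t_0 already means that y_i is
    ignored. Under call-by-value even an ignored argument must have some value; hence the
    productivity bits, and a rule whose right-hand side contains an unproductive call is dropped at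
    that input node. The time bound has no term for the alphabets, and a rank may be huge while |t|
    = 1, when all powers collapse to 1. So of each alphabet only its length is read. Ranks are
    inferred from the call nodes of the right-hand sides, and the largest rank found is at most m
    and also at most the number of nodes. States that are never called, except q_0, get no block.
    The exponent 2m+2 arises as a product: at most |t|^(m+1) tuples to be decided per rule, times at
    most |t|^(m+1) tuples tried per call while deciding one of them. The quadratic table of equal
    subtrees fits as well. The machine cannot multiply or divide, so powers, remainders and
    quotients by |t| are tabulated. Without rules |M| = 0, only constant time is left, and the
    machine exits at once. *)

(** * A language with bounded loops and its cost semantics *)

Inductive exp : Type :=
| Cst : nat -> exp
| Var : nat -> exp
| Add : exp -> exp -> exp
| Sub : exp -> exp -> exp
| Arr : nat -> exp -> exp.

(** Bounded repetition is the only loop, so every program terminates and both [exec] and [cost] are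
    plain recursive functions. *)
Inductive cmd : Type :=
| Skip : cmd
| Asn : nat -> exp -> cmd
| Sto : nat -> exp -> exp -> cmd
| Seq : cmd -> cmd -> cmd
| If : exp -> cmd -> cmd -> cmd
| Rep : exp -> cmd -> cmd.

Record st : Type := St { V : nat -> nat; A : nat -> nat -> nat }.

Definition updA (f : nat -> nat -> nat) (a i v : nat) : nat -> nat -> nat :=
  fun b j => if Nat.eqb b a then (if Nat.eqb j i then v else f b j) else f b j.

Fixpoint ev (e : exp) (s : st) : nat :=
  match e with
  | Cst n => n
  | Var x => V s x
  | Add a b => ev a s + ev b s
  | Sub a b => ev a s - ev b s
  | Arr a i => A s a (ev i s)
  end.

Fixpoint iter (n : nat) (f : st -> st) (s : st) : st :=
  match n with 0 => s | S n => iter n f (f s) end.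

Fixpoint exec (c : cmd) (s : st) : st :=
  match c with
  | Skip => s
  | Asn x e => St (upd (V s) x (ev e s)) (A s)
  | Sto a i e => St (V s) (updA (A s) a (ev i s) (ev e s))
  | Seq c d => exec d (exec c s)
  | If e c d => if Nat.eqb (ev e s) 0 then exec d s else exec c s
  | Rep e c => iter (ev e s) (exec c) s
  end.

Fixpoint iter_cost (n : nat) (f : st -> st) (k : st -> nat) (s : st) : nat :=
  match n with 0 => 0 | S n => S (k s) + iter_cost n f k (f s) end.

Fixpoint cost (c : cmd) (s : st) : nat :=
  match c with
  | Skip => 0
  | Asn _ _ | Sto _ _ _ => 1
  | Seq c d => cost c s + cost d (exec c s)
  | If e c d => S (if Nat.eqb (ev e s) 0 then cost d s else cost c s)
  | Rep e c => S (iter_cost (ev e s) (exec c) (cost c) s)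
  end.

(** * Compilation *)

(* Memory layout: cell 0 is the answer and cell 1 holds the base B of the arrays; variable x is cell 100 + x,
   temporaries start at 200 and loop counters at 300; entry i of array a is cell B + 32 * i + a. *)

Definition comp_addr (d a : nat) : list instr :=
  [IAdd d d d; IAdd d d d; IAdd d d d; IAdd d d d; IAdd d d d; IAdd d d 1;
   IConst (S d) a; IAdd d d (S d)].

(** Stack discipline: the value ends up in cell [d], and only cells from [d] on serve as scratch.
    There is no move instruction, so a variable is copied by adding it to 0. *)
Fixpoint comp_exp (d : nat) (e : exp) : list instr :=
  match e with
  | Cst n => [IConst d n]
  | Var x => [IConst d 0; IAdd d d (100 + x)]
  | Add a b => comp_exp d a ++ comp_exp (S d) b ++ [IAdd d d (S d)]
  | Sub a b => comp_exp d a ++ comp_exp (S d) b ++ [ISub d d (S d)]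
  | Arr a i => comp_exp d i ++
      comp_addr d a ++ [ILoad d d]
  end.

(* Code starting at address [o] inside [h] enclosing loops; jump targets are absolute. *)
Fixpoint comp (o h : nat) (c : cmd) : list instr :=
  match c with
  | Skip => []
  | Asn x e => comp_exp 200 e ++ [IConst 201 0; IAdd (100 + x) 200 201]
  | Sto a i e => comp_exp 200 i ++ comp_addr 200 a ++ comp_exp 201 e ++ [IStore 200 201]
  | Seq c d => let cc := comp o h c in cc ++ comp (o + length cc) h d
  | If e c d =>
      let ce := comp_exp 200 e in
      let o1 := o + length ce + 1 in
      let cc := comp o1 h c in
      let o2 := o1 + length cc + 2 in
      let cd := comp o2 h d in
      ce ++ [IJz 200 o2] ++ cc ++ [IConst 200 0; IJz 200 (o2 + length cd)] ++ cd
  | Rep e c =>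
      let ce := comp_exp 200 e in
      let o1 := o + length ce + 2 in
      let cc := comp (S o1) (S h) c in
      ce ++ [IConst 201 0; IAdd (300 + h) 200 201; IJz (300 + h) (o1 + length cc + 5)] ++ cc ++
        [IConst 201 1; ISub (300 + h) (300 + h) 201; IConst 201 0; IJz 201 o1]
  end.

(** The bounds keep the cell ranges of the layout apart: variables stay below the temporaries,
    temporaries below the loop counters, and array numbers below the stride 32. *)
Fixpoint wf_exp (d : nat) (e : exp) : bool :=
  match e with
  | Cst _ => true
  | Var x => Nat.ltb x 100
  | Add a b | Sub a b => wf_exp d a && wf_exp (S d) b
  | Arr a i => Nat.ltb a 32 && wf_exp d i
  end && Nat.ltb (S d) 300.

Fixpoint wf_cmd (h : nat) (c : cmd) : bool :=
  match c with
  | Skip => true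
  | Asn x e => Nat.ltb x 100 && wf_exp 200 e
  | Sto a i e => Nat.ltb a 32 && wf_exp 200 i && wf_exp 201 e
  | Seq c d => wf_cmd h c && wf_cmd h d
  | If e c d => wf_exp 200 e && wf_cmd h c && wf_cmd h d
  | Rep e c => wf_exp 200 e && wf_cmd (S h) c && Nat.ltb h 100
  end.

Lemma run_add (P : list instr) (n k : nat) (c : config) :
  run P (n + k) c = run P k (run P n c).
Proof.
  revert c; induction n as [|n IH]; intros c; simpl; auto.
  destruct (step P c) as [c'|] eqn:E; auto.
  destruct k; simpl; auto. rewrite E; auto.
Qed.

Definition code_at (P : list instr) (o : nat) (l : list instr) : Prop :=
  forall i x, nth_error l i = Some x -> nth_error P (o + i) = Some x.

Lemma code_at_app (P : list instr) (o : nat) (l l' : list instr) :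
  code_at P o (l ++ l') -> code_at P o l /\ code_at P (o + length l) l'.
Proof.
  intros H; split; intros i x E.
  - apply H. rewrite nth_error_app1; auto. apply nth_error_Some; congruence.
  - rewrite <- Nat.add_assoc. apply H. rewrite nth_error_app2 by lia.
    replace (length l + i - length l) with i by lia; auto.
Qed.

Lemma code_at_cons (P : list instr) (o : nat) (x : instr) (l : list instr) :
  code_at P o (x :: l) -> nth_error P o = Some x /\ code_at P (S o) l.
Proof.
  intros H; split.
  - rewrite <- (Nat.add_0_r o). apply (H 0 x); auto.
  - intros i y E. replace (S o + i) with (o + S i) by lia. apply (H (S i) y); auto.
Qed.

(** At most 100 nested loops use cells 300 to 399, so a base of at least 400 puts the arrays beyond
    every register. Temporaries and counters are left unconstrained. *)
Definition sim (s : st) (mem : nat -> nat) : Prop :=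
  400 <= mem 1 /\ (forall x, x < 100 -> mem (100 + x) = V s x) /\
  (forall a i, a < 32 -> mem (mem 1 + (32 * i + a)) = A s a i).

(** Code inside [h] loops must preserve the counters of those loops; [sim] does not mention them. *)
Definition loops_kept (h : nat) (mem mem' : nat -> nat) : Prop :=
  forall x, x < h -> mem' (300 + x) = mem (300 + x).

(* The memory differs from [mem] only in temporaries numbered at least [d]. *)
Definition tmp_only (d : nat) (mem mem' : nat -> nat) : Prop :=
  forall x, x < d \/ 300 <= x -> mem' x = mem x.

Lemma upd_eq (m : nat -> nat) (a v : nat) : upd m a v a = v.
Proof. unfold upd; now rewrite Nat.eqb_refl. Qed.

Lemma upd_neq (m : nat -> nat) (a v x : nat) : x <> a -> upd m a v x = m x.
Proof. intros H; unfold upd; apply Nat.eqb_neq in H; now rewrite H. Qed.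

Ltac usolve := repeat (first [rewrite upd_eq | rewrite upd_neq by lia]).

Lemma tmp_only_sim (d : nat) (s : st) (mem mem' : nat -> nat) :
  200 <= d -> tmp_only d mem mem' -> sim s mem -> sim s mem'.
Proof.
  intros Hd H (H1 & H2 & H3). rewrite <- (H 1) in * by lia.
  repeat split; auto.
  - intros x Hx. rewrite H by lia; auto.
  - intros a i Ha. rewrite H by lia; auto.
Qed.

Lemma step_run (P : list instr) (pc n : nat) (mem : nat -> nat) (c : config) :
  step P (pc, mem) = Some c -> run P (S n) (pc, mem) = run P n c.
Proof. intros H; cbn [run]. now rewrite H. Qed.

Ltac stepone H :=
  erewrite step_run; [| unfold step; rewrite H; reflexivity].

(** Five doublings multiply the index by 32, the only multiplication that addressing needs.
    Interleaving the arrays with this stride lets each of them be unbounded. *)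
Lemma comp_addr_ok (P : list instr) (a d o : nat) (mem : nat -> nat) :
  200 <= d -> S d < 300 -> code_at P o (comp_addr d a) ->
  exists mem', run P 8 (o, mem) = (o + 8, mem') /\
    tmp_only d mem mem' /\ mem' d = mem 1 + (32 * mem d + a).
Proof.
  intros Hd Hd' Hc. unfold comp_addr in Hc. repeat (apply code_at_cons in Hc as [? Hc]).
  eexists; split; [|split].
  - repeat match goal with H : nth_error P ?o = _ |- run P (S _) (?o, _) = _ => stepone H; clear H end.
    simpl; f_equal; lia.
  - intros y Hy. rewrite !(upd_neq _ _ _ y) by lia. auto.
  - rewrite !(upd_neq _ _ _ 1) by lia. repeat (rewrite upd_eq || rewrite (upd_neq _ (S d) _ d) by lia). lia.
Qed.

Lemma comp_exp_ok (P : list instr) (s : st) (e : exp) : forall d o mem,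
  wf_exp d e = true -> 200 <= d -> code_at P o (comp_exp d e) -> sim s mem ->
  exists mem', run P (length (comp_exp d e)) (o, mem) = (o + length (comp_exp d e), mem') /\
    tmp_only d mem mem' /\ mem' d = ev e s.
Proof.
  induction e as [n|x|a IHa b IHb|a IHa b IHb|a i IH]; intros d o mem Hwf Hd Hc Hs;
    simpl in Hwf; rewrite ?andb_true_iff, ?Nat.ltb_lt in Hwf.
  - cbn [comp_exp] in *. apply code_at_cons in Hc as [H1 _]. simpl length. stepone H1.
    eexists; split; [simpl; f_equal; lia|]. split; [intros y Hy|]; usolve; auto.
  - cbn [comp_exp] in *. apply code_at_cons in Hc as [H1 Hc]. apply code_at_cons in Hc as [H2 _].
    simpl length. stepone H1. stepone H2.
    eexists; split; [simpl; f_equal; lia|]. split.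
    + intros y Hy; usolve; auto.
    + usolve. destruct Hs as (_ & Hs & _). simpl. apply Hs; lia.
  - simpl comp_exp in *. rewrite !length_app. simpl length.
    apply code_at_app in Hc as [Ha Hc]. apply code_at_app in Hc as [Hb Hc].
    apply code_at_cons in Hc as [H1 _]. rewrite !run_add.
    destruct (IHa d o mem) as (m1 & R1 & T1 & E1); auto; try tauto.
    destruct (IHb (S d) (o + length (comp_exp d a)) m1) as (m2 & R2 & T2 & E2); auto; try tauto; try lia.
    { apply (tmp_only_sim d) with mem; auto. }
    rewrite R1, R2. stepone H1. eexists; split; [simpl; f_equal; lia|]. split.
    + intros y Hy; usolve. rewrite T2, T1 by lia; auto.
    + usolve. simpl. rewrite E2, T2, E1; auto; lia.
  - simpl comp_exp in *. rewrite !length_app. simpl length.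
    apply code_at_app in Hc as [Ha Hc]. apply code_at_app in Hc as [Hb Hc].
    apply code_at_cons in Hc as [H1 _]. rewrite !run_add.
    destruct (IHa d o mem) as (m1 & R1 & T1 & E1); auto; try tauto.
    destruct (IHb (S d) (o + length (comp_exp d a)) m1) as (m2 & R2 & T2 & E2); auto; try tauto; try lia.
    { apply (tmp_only_sim d) with mem; auto. }
    rewrite R1, R2. stepone H1. eexists; split; [simpl; f_equal; lia|]. split.
    + intros y Hy; usolve. rewrite T2, T1 by lia; auto.
    + usolve. simpl. rewrite E2, T2, E1; auto; lia.
  - cbn [comp_exp ev] in *. rewrite !length_app in *. cbn [length].
    apply code_at_app in Hc as [Hi Hc]. apply code_at_app in Hc as [Hc Hc'].
    apply code_at_cons in Hc' as [J _].
    destruct (IH d o mem) as (m1 & R1 & T1 & E1); auto; try tauto.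
    destruct (comp_addr_ok P a d _ m1 Hd (proj2 Hwf) Hc) as (m2 & R2 & T2 & E2).
    exists (upd m2 d (m2 (m2 d))). split; [|split].
    + replace (length (comp_exp d i) + (length (comp_addr d a) + 1)) with (length (comp_exp d i) + (8 + 1)) by reflexivity.
      rewrite run_add, R1, run_add, R2. cbn [length comp_addr] in J. stepone J. simpl. f_equal; lia.
    + intros y Hy. rewrite upd_neq, T2, T1 by lia; auto.
    + rewrite upd_eq. destruct Hs as (H1 & _ & H3). rewrite <- (H3 a (ev i s)) by tauto.
      rewrite E2, E1, (T1 1) by lia. rewrite T2, T1 by lia. auto.
Qed.

Lemma sim_upd_var (s : st) (mem : nat -> nat) (x v : nat) :
  x < 100 -> sim s mem -> sim (St (upd (V s) x v) (A s)) (upd mem (100 + x) v).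
Proof.
  intros Hx (H1 & H2 & H3). repeat split.
  - usolve; auto.
  - intros y Hy. destruct (Nat.eq_dec y x) as [->|N]; simpl V; usolve; auto.
  - intros a i Ha. rewrite (upd_neq _ _ _ 1) by lia. usolve. apply H3; auto.
Qed.

Lemma sim_upd_arr (s : st) (mem : nat -> nat) (a i v : nat) :
  a < 32 -> sim s mem -> sim (St (V s) (updA (A s) a i v)) (upd mem (mem 1 + (32 * i + a)) v).
Proof.
  intros Hx (H1 & H2 & H3). repeat split.
  - usolve; auto.
  - intros y Hy. usolve; auto.
  - intros b j Hb. rewrite (upd_neq _ _ _ 1) by lia. simpl A. unfold updA.
    destruct (Nat.eqb_spec b a) as [->|N].
    + destruct (Nat.eqb_spec j i) as [->|N]; usolve; auto.
    + usolve; auto.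
Qed.

(** Not the exact code length but the slowdown factor: each unit of [cost] is simulated by at most
    [csize c] machine steps. It depends on the program alone, which makes it a constant of the final
    bound. *)
Fixpoint csize (c : cmd) : nat :=
  match c with
  | Skip => 0
  | Asn x e => length (comp_exp 200 e) + 2
  | Sto a i e => length (comp_exp 200 i) + length (comp_exp 201 e) + 9
  | Seq c d => csize c + csize d
  | If e c d => length (comp_exp 200 e) + csize c + csize d + 3
  | Rep e c => length (comp_exp 200 e) + csize c + 8
  end.

Lemma tmp_only_loops (h d : nat) (mem mem' : nat -> nat) : tmp_only d mem mem' -> loops_kept h mem mem'.
Proof. intros H x Hx. apply H; lia. Qed.

(** A round runs the test, the body and four closing instructions. The unit that [iter_cost] charges
    per round pays for these five, and the outer successor pays for the last, failing test; hence
    the factor [K + 5]. *)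
Lemma rep_ok (P : list instr) (c : cmd) (o1 h n : nat) (K : nat) :
  code_at P o1 (IJz (300 + h) (o1 + length (comp (S o1) (S h) c) + 5) :: comp (S o1) (S h) c ++
        [IConst 201 1; ISub (300 + h) (300 + h) 201; IConst 201 0; IJz 201 o1]) ->
  (forall s mem, sim s mem -> exists (k : nat) (mem' : nat -> nat), k <= K * cost c s /\
      run P k (S o1, mem) = (S o1 + length (comp (S o1) (S h) c), mem') /\
      sim (exec c s) mem' /\ loops_kept (S h) mem mem') ->
  h < 100 ->
  forall s mem, sim s mem -> mem (300 + h) = n ->
    exists (k : nat) (mem' : nat -> nat), k <= (K + 5) * S (iter_cost n (exec c) (cost c) s) /\
      run P k (o1, mem) = (o1 + length (comp (S o1) (S h) c) + 5, mem') /\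
      sim (iter n (exec c) s) mem' /\ loops_kept h mem mem'.
Proof.
  intros Hc Hb Hh.
  apply code_at_cons in Hc as [J Hc]. apply code_at_app in Hc as [_ Hc].
  remember (length (comp (S o1) (S h) c)) as len eqn:Elen.
  repeat (apply code_at_cons in Hc as [? Hc]).
  induction n as [|n IH]; intros s mem Hs En.
  - exists 1, mem. split; [simpl; lia|]. stepone J. rewrite En. simpl.
    repeat split; auto; apply Hs.
  - destruct (Hb s mem Hs) as (k1 & m1 & Hk1 & R1 & S1 & L1).
    destruct (IH (exec c s) (upd (upd (upd m1 201 1) (300 + h) n) 201 0)) as (k2 & m2 & Hk2 & R2 & S2 & L2).
    + destruct S1 as (G1 & G2 & G3). split; [|split].
      * usolve; auto.
      * intros x Hx; usolve; auto.
      * intros a i Ha. rewrite !(upd_neq _ _ _ 1) by lia. usolve. auto.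
    + usolve; auto.
    + exists (S (k1 + S (S (S (S k2))))), m2. split.
      { cbn [iter_cost]. nia. }
      stepone J. rewrite En. cbn [Nat.eqb]. rewrite run_add, R1.
      repeat match goal with
      | H : nth_error P ?o = _ |- run P (S _) (?o, _) = _ /\ _ => stepone H; clear H
      end.
      repeat (rewrite upd_eq || rewrite upd_neq by lia). cbn [Nat.eqb].
      rewrite (L1 h) by lia. rewrite En. replace (S n - 1) with n by lia. rewrite R2. split; auto. split; auto.
      intros x Hx. rewrite L2 by auto. usolve. apply L1; lia.
Qed.

Lemma comp_ok (P : list instr) (c : cmd) : forall o h s mem,
  h <= 100 -> wf_cmd h c = true -> code_at P o (comp o h c) -> sim s mem ->
  exists (k : nat) (mem' : nat -> nat), k <= csize c * cost c s /\
    run P k (o, mem) = (o + length (comp o h c), mem') /\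
    sim (exec c s) mem' /\ loops_kept h mem mem'.
Proof.
  induction c as [|x e|a i e|c IHc d IHd|e c IHc d IHd|e c IHc]; intros o h s mem Hh Hwf Hc Hs;
    cbn [wf_cmd] in Hwf; rewrite ?andb_true_iff, ?Nat.ltb_lt in Hwf.
  - exists 0, mem. split; auto. simpl. rewrite Nat.add_0_r. unfold loops_kept; auto.
  - cbn [comp csize cost] in *. rewrite length_app. simpl length.
    apply code_at_app in Hc as [He Hc].
    destruct (comp_exp_ok P s e 200 o mem) as (m1 & R1 & T1 & E1); auto; try tauto.
    repeat (apply code_at_cons in Hc as [? Hc]).
    eexists (_ + 2), _. split; [|split].
    2:{ rewrite run_add, R1.
      repeat match goal with H : nth_error P ?o = _ |- run P (S _) (?o, _) = _ => stepone H; clear H end.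
      simpl; f_equal; lia. }
    + lia.
    + usolve. rewrite E1, Nat.add_0_r. split.
      * simpl exec. apply sim_upd_var; [tauto|].
        apply (tmp_only_sim 200) with mem; auto. intros y Hy. usolve. auto.
      * intros y Hy. usolve. apply T1; lia.
  - cbn [comp csize cost] in *. rewrite !length_app. cbn [length].
    apply code_at_app in Hc as [Hi Hc]. apply code_at_app in Hc as [Hc Hc'].
    apply code_at_app in Hc' as [He Hc'].
    destruct (comp_exp_ok P s i 200 o mem) as (m1 & R1 & T1 & E1); auto; try tauto.
    apply code_at_cons in Hc' as [J _]. cbn [length comp_addr] in *.
    destruct (comp_addr_ok P a 200 (o + length (comp_exp 200 i)) m1) as (m2 & R2 & T2 & E2); auto; try lia.
    rewrite E1, (T1 1) in E2 by lia.
    assert (S2 : sim s m2).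
    { apply (tmp_only_sim 200) with m1; auto. apply (tmp_only_sim 200) with mem; auto. }
    destruct (comp_exp_ok P s e 201 (o + length (comp_exp 200 i) + 8) m2) as (m3 & R3 & T3 & E3); auto; try tauto.
    assert (E4 : m3 200 = m3 1 + (32 * ev i s + a)).
    { rewrite T3, (T3 1), E2, (T2 1), (T1 1) by lia. auto. }
    eexists (_ + (8 + (_ + 1))), _. split; [|split].
    2:{ rewrite run_add, R1, run_add, R2, run_add, R3. stepone J. simpl; f_equal; lia. }
    + lia.
    + rewrite E4, E3. split.
      * simpl exec. apply sim_upd_arr; [tauto|]. apply (tmp_only_sim 201) with m2; auto.
      * intros y Hy. assert (400 <= m3 1) by (rewrite T3, T2, T1 by lia; apply Hs). usolve.
        rewrite T3, T2, T1 by lia. auto.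
  - cbn [comp csize cost] in *. rewrite length_app.
    apply code_at_app in Hc as [Hc Hd].
    destruct (IHc o h s mem) as (k1 & m1 & K1 & R1 & S1 & L1); auto; try tauto.
    destruct (IHd _ h _ m1 Hh (proj2 Hwf) Hd S1) as (k2 & m2 & K2 & R2 & S2 & L2).
    exists (k1 + k2), m2. split; [nia|]. rewrite run_add, R1, R2.
    split; [f_equal; lia|]. split; auto. intros y Hy. rewrite L2, L1; auto.
  - cbn [comp csize cost exec] in *. rewrite !length_app. cbn [length app] in *. rewrite ?length_app. cbn [length] in *.
    apply code_at_app in Hc as [He Hc]. cbn [app] in Hc.
    apply code_at_cons in Hc as [J Hc]. apply code_at_app in Hc as [Hc Hd].
    repeat (apply code_at_cons in Hd as [? Hd]).
    destruct (comp_exp_ok P s e 200 o mem) as (m1 & R1 & T1 & E1); auto; try tauto.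
    assert (S1 : sim s m1) by (apply (tmp_only_sim 200) with mem; auto).
    assert (L1 : loops_kept h mem m1) by (eapply tmp_only_loops; eauto).
    remember (comp_exp 200 e) as ce. cbn [length].
    remember (comp (o + length ce + 1) h c) as cc eqn:Ecc.
    remember (comp (o + length ce + 1 + length cc + 2) h d) as cd eqn:Ecd.
    destruct (Nat.eqb_spec (ev e s) 0) as [Z|Z].
    + destruct (IHd (o + length ce + 1 + length cc + 2) h s m1) as (k2 & m2 & K2 & R2 & S2 & L2); auto; try tauto.
      { rewrite <- Ecd. intros i x Hi. rewrite <- (Hd i x Hi). f_equal; lia. }
      exists (length ce + S k2), m2. split; [nia|].
      rewrite run_add, R1. stepone J. rewrite E1, Z. cbn [Nat.eqb]. rewrite R2, <- Ecd.
      split; [f_equal; lia|]. split; auto. intros y Hy. rewrite L2, L1; auto.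
    + destruct (IHc (o + length ce + 1) h s m1) as (k2 & m2 & K2 & R2 & S2 & L2); auto; try tauto.
      { rewrite <- Ecc. intros i x Hi. rewrite <- (Hc i x Hi). f_equal; lia. }
      exists (length ce + S (k2 + 2)), (upd m2 200 0). split; [nia|].
      rewrite run_add, R1. stepone J. rewrite E1. apply Nat.eqb_neq in Z. rewrite Z.
      replace (S (o + length ce)) with (o + length ce + 1) by lia. rewrite run_add, R2, <- Ecc.
      replace (S (o + length ce) + length cc) with (o + length ce + 1 + length cc) in H, H0 by lia.
      stepone H. stepone H0. usolve. cbn [Nat.eqb run]. split; [f_equal; lia|]. split.
      * apply (tmp_only_sim 200) with m2; auto. intros y Hy; usolve; auto.
      * intros y Hy. usolve. rewrite L2, L1; auto.
  - cbn [comp csize cost exec] in *. rewrite !length_app. cbn [length app] in *. rewrite ?length_app. cbn [length] in *.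
    apply code_at_app in Hc as [He Hc]. cbn [app length] in *.
    destruct (comp_exp_ok P s e 200 o mem) as (m1 & R1 & T1 & E1); auto; try tauto.
    apply code_at_cons in Hc as [J1 Hc]. apply code_at_cons in Hc as [J2 Hc].
    remember (comp_exp 200 e) as ce.
    replace (S (S (o + length ce))) with (o + length ce + 2) in Hc by lia.
    assert (T2 : tmp_only 200 mem (upd m1 201 0)).
    { intros y Hy; usolve; auto. }
    destruct (rep_ok P c (o + length ce + 2) h (ev e s) (csize c)) with (s := s) (mem := upd (upd m1 201 0) (300 + h) (ev e s))
      as (k2 & m2 & K2 & R2 & S2 & L2); auto; try tauto.
    + intros s' mem' Hs'. destruct (IHc (S (o + length ce + 2)) (S h) s' mem') as (k & m & K & R & S & L); auto; try tauto; try lia.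
      { apply code_at_cons in Hc as [_ Hc]. apply code_at_app in Hc as [Hc _]. auto. }
      exists k, m; auto.
    + assert (S1 : sim s (upd m1 201 0)) by (apply (tmp_only_sim 200) with mem; auto).
      destruct S1 as (G1 & G2 & G3). split; [|split].
      * usolve; auto.
      * intros x Hx. rewrite upd_neq by lia. auto.
      * intros a i Ha. rewrite (upd_neq _ (300 + h) _ 1) by lia. rewrite upd_neq by lia. auto.
    + usolve; auto.
    + exists (length ce + S (S k2)), m2. split; [nia|].
      rewrite run_add, R1. stepone J1. stepone J2. usolve. rewrite E1, Nat.add_0_r.
      replace (S (S (o + length ce))) with (o + length ce + 2) by lia. rewrite R2. split; [f_equal; lia|]. split; auto.
      intros y Hy. rewrite L2 by auto. usolve. apply T1; lia.
Qed.

(** * The machine program around the compiled code *)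

(** The registers overlap the input, so the input is first moved into array 0. The base is found by
    skipping the three alphabets by their lengths; everything beyond it is zero, so no array ever
    has to be initialised. Cell 5, the number of rules, is tested at the start and then reused as
    scratch. The constants 32, 64, 96, 128 and 192 are the offsets of entries 1 to 4 and 6 of array
    0. *)
Definition prelude (z : nat) : list instr :=
  [IJz 5 z; IConst 0 0; IAdd 0 3 0;
   ILoad 5 0; IAdd 0 0 5; IAdd 0 0 5; IConst 5 1; IAdd 0 0 5;
   ILoad 5 0; IAdd 0 0 5; IAdd 0 0 5; IConst 5 1; IAdd 0 0 5;
   ILoad 5 0; IAdd 0 0 5; IAdd 0 0 5; IConst 5 1; IAdd 0 0 5;
   IConst 5 400; IAdd 0 0 5;
   IConst 5 32; IAdd 5 5 0; IStore 5 1;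
   IConst 5 64; IAdd 5 5 0; IStore 5 2;
   IConst 5 96; IAdd 5 5 0; IStore 5 3;
   IConst 5 128; IAdd 5 5 0; IStore 5 4;
   IConst 1 6; IConst 2 192; IAdd 2 2 0;
   ISub 4 3 1; IJz 4 45; ILoad 4 1; IStore 2 4; IConst 5 1; IAdd 1 1 5;
   IConst 5 32; IAdd 2 2 5; IConst 4 0; IJz 4 35;
   IConst 5 0; IAdd 1 0 5].

(* [B]: the first address beyond the input and the registers. *)
Definition arrays_base (mem : nat -> nat) : nat :=
  let skip a := a + mem a + mem a + 1 in skip (skip (skip (mem 3))) + 400.

(* The part of the input that precedes the alphabets, without its cells 0 and 5. *)
Definition input_upto (code : list nat) (b a i : nat) : nat :=
  if Nat.eqb a 0 && (Nat.leb 1 i && Nat.leb i 4 || Nat.leb 6 i && Nat.ltb i b) then nth i code 0 else 0.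

Ltac steps := repeat match goal with H : nth_error ?P ?o = _ |- run ?P (S _) (?o, _) = _ => stepone H; clear H end.

Lemma code_at_skipn (P : list instr) (o : nat) (l : list instr) (k : nat) :
  code_at P o l -> code_at P (o + k) (skipn k l).
Proof.
  intros H i x E. rewrite nth_error_skipn in E. rewrite <- Nat.add_assoc. now apply H.
Qed.

Definition mem_of (code : list nat) : nat -> nat := fun a => nth a code 0.

Lemma prelude_stage1 (P : list instr) (z : nat) (code : list nat) :
  code_at P 0 (prelude z) -> nth 5 code 0 <> 0 -> 6 <= nth 3 code 0 ->
  exists m, run P 20 (0, mem_of code) = (20, m) /\ m 0 = arrays_base (mem_of code) /\
    (forall x, x <> 0 -> x <> 5 -> m x = mem_of code x).
Proof.
  intros Hc H5 H3. pose proof (code_at_skipn _ _ _ 20 Hc) as _.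
  change (nth 5 code 0) with (mem_of code 5) in H5. change (nth 3 code 0) with (mem_of code 3) in H3.
  remember (mem_of code) as m0 eqn:Em. clear Em.
  unfold prelude in Hc. do 20 (apply code_at_cons in Hc as [? Hc]). clear Hc.
  stepone H. apply Nat.eqb_neq in H5. rewrite H5. clear H.
  assert (B1 : run P 2 (1, m0) = (3, upd (upd m0 0 0) 0 (m0 3))).
  { steps. simpl. do 2 f_equal. usolve. lia. }
  (* One alphabet is a length cell followed by that many pairs, so five instructions advance the
     pointer by twice the length plus one. Only cells 0 and 5 change. *)
  assert (Skip : forall o a m, nth_error P o = Some (ILoad 5 0) -> nth_error P (S o) = Some (IAdd 0 0 5) ->
     nth_error P (S (S o)) = Some (IAdd 0 0 5) -> nth_error P (S (S (S o))) = Some (IConst 5 1) ->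
     nth_error P (S (S (S (S o)))) = Some (IAdd 0 0 5) ->
     6 <= a -> m 0 = a -> (forall x, x <> 0 -> x <> 5 -> m x = m0 x) ->
     exists m', run P 5 (o, m) = (5 + o, m') /\ m' 0 = a + m0 a + m0 a + 1 /\
        (forall x, x <> 0 -> x <> 5 -> m' x = m0 x)).
  { intros o a m G1 G2 G3 G4 G5 Ha Hm Hx. eexists; split; [|split].
    - steps. cbn [run]. reflexivity.
    - usolve. rewrite Hm. rewrite Hx by lia. lia.
    - intros x N0 N5. usolve. auto. }
  change 19 with (2 + (5 + (5 + (5 + 2)))). rewrite run_add, B1.
  destruct (Skip 3 (m0 3) (upd (upd m0 0 0) 0 (m0 3))) as (m1 & R1 & E1 & X1); auto.
  { intros x N0 N5. usolve; auto. }
  rewrite run_add, R1.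
  edestruct (Skip 8) as (m2 & R2 & E2 & X2); [eassumption..| |exact E1|exact X1|]; [lia|].
  change (5 + 3) with 8. rewrite run_add, R2.
  edestruct (Skip 13) as (m3 & R3 & E3 & X3); [eassumption..| |exact E2|exact X2|]; [lia|].
  change (5 + 8) with 13. rewrite run_add, R3. change (5 + 13) with 18.
  eexists; split; [|split].
  - steps. cbn [run]. reflexivity.
  - usolve. rewrite E3. reflexivity.
  - intros x N0 N5. usolve. auto.
Qed.

(** The hypothesis on the length of [code] says that all cells from the base on are still zero. This
    is where the zero entries of [input_upto] come from. *)
Lemma prelude_ok (P : list instr) (z : nat) (code : list nat) (b : nat) :
  code_at P 0 (prelude z) -> nth 5 code 0 <> 0 -> nth 3 code 0 = b -> 6 <= b ->
  length code <= arrays_base (mem_of code) ->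
  exists (k : nat) (mem : nat -> nat), k <= 10 * b + 60 /\ run P k (init code) = (47, mem) /\
    exists s, sim s mem /\ forall a i, A s a i = input_upto code b a i.
Proof.
  intros Hc H5 H3 Hb HB.
  destruct (prelude_stage1 P z code) as (m1 & R1 & E1 & X1); auto; try lia.
  assert (B4 : 400 <= arrays_base (mem_of code)) by (unfold arrays_base; lia).
  assert (Hb' : b + 400 <= arrays_base (mem_of code)).
  { assert (mem_of code 3 = b) by exact H3. unfold arrays_base. lia. }
  remember (arrays_base (mem_of code)) as B eqn:EB. clear EB.
  assert (Z : forall x, B <= x -> nth x code 0 = 0) by (intros; apply nth_overflow; lia).
  assert (exists m, run P 15 (20, m1) = (35, m) /\ m 0 = B /\ m 1 = 6 /\ m 2 = B + 192 /\
     (forall x, 6 <= x -> x < B -> m x = nth x code 0) /\ m 3 = b /\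
     (forall a i, a < 32 -> m (B + (32 * i + a)) = input_upto code 6 a i)) as (m2 & R2 & G0 & G1 & G2 & GL & G3 & GA).
  { pose proof (code_at_skipn _ _ _ 20 Hc) as Hs. cbn [skipn prelude Nat.add] in Hs.
    do 15 (apply code_at_cons in Hs as [? Hs]). clear Hs Hc.
    assert (Save : forall o i m, 1 <= i <= 4 -> nth_error P o = Some (IConst 5 (32 * i)) -> nth_error P (S o) = Some (IAdd 5 5 0) ->
       nth_error P (S (S o)) = Some (IStore 5 i) -> m 0 = B ->
       exists m', run P 3 (o, m) = (3 + o, m') /\ m' (B + 32 * i) = m i /\
         (forall x, x <> 5 -> x <> B + 32 * i -> m' x = m x)).
    { intros o i m Hi K1 K2 K3 Hm. eexists; split; [|split].
      - steps. cbn [run]. reflexivity.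
      - rewrite upd_eq. rewrite (upd_neq _ 5 _ 0) by lia. rewrite Hm. rewrite Nat.add_comm. usolve. auto.
      - intros x N5 Nx. rewrite upd_eq. rewrite (upd_neq _ 5 _ 0) by lia. rewrite Hm. usolve. auto. }
    destruct (Save 20 1 m1) as (n1 & Q1 & F1 & O1); auto; try lia.
    destruct (Save 23 2 n1) as (n2 & Q2 & F2 & O2); auto; try lia.
    { rewrite O1 by lia; auto. }
    destruct (Save 26 3 n2) as (n3 & Q3 & F3 & O3); auto; try lia.
    { rewrite O2, O1 by lia; auto. }
    destruct (Save 29 4 n3) as (n4 & Q4 & F4 & O4); auto; try lia.
    { rewrite O3, O2, O1 by lia; auto. }
    eexists. split; [|split; [|split; [|split; [|split; [|split]]]]].
    - change (run P 15 (20, m1)) with (run P (3 + (3 + (3 + (3 + 3)))) (20, m1)). rewrite run_add, Q1. change (3 + 20) with 23. rewrite run_add, Q2. change (3 + 23) with 26.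
      rewrite run_add, Q3. change (3 + 26) with 29. rewrite run_add, Q4. change (3 + 29) with 32.
      steps. cbn [run]. reflexivity.
    - usolve. rewrite O4, O3, O2, O1 by lia; auto.
    - usolve; auto.
    - usolve. rewrite O4, O3, O2, O1 by lia; lia.
    - intros x Hx Hx'. usolve. rewrite O4, O3, O2, O1, X1 by lia; auto.
    - usolve. rewrite O4, O3, O2, O1, X1 by lia; auto.
    - intros a i Ha. usolve. unfold input_upto.
      destruct (Nat.eqb_spec a 0) as [->|Na]; cbn [andb].
      2:{ rewrite O4, O3, O2, O1, X1 by lia. apply Z; lia. }
      rewrite Nat.add_0_r.
      destruct (Nat.eq_dec i 1) as [->|N1]; [rewrite O4, O3, O2, F1, X1 by lia; auto|].
      destruct (Nat.eq_dec i 2) as [->|N2]; [rewrite O4, O3, F2, O1, X1 by lia; auto|].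
      destruct (Nat.eq_dec i 3) as [->|N3]; [rewrite O4, F3, O2, O1, X1 by lia; auto|].
      destruct (Nat.eq_dec i 4) as [->|N4]; [rewrite F4, O3, O2, O1, X1 by lia; auto|].
      rewrite O4, O3, O2, O1, X1 by lia.
      replace (Nat.leb 1 i && Nat.leb i 4 || Nat.leb 6 i && Nat.ltb i 6) with false.
      + apply Z; lia.
      + symmetry. destruct (Nat.leb_spec 1 i), (Nat.leb_spec i 4), (Nat.leb_spec 6 i), (Nat.ltb_spec i 6); auto; lia. }
  (* With [j] words copied and [r] left, cell 1 is the source pointer and cell 2 the target pointer.
     A round takes ten instructions, leaving the loop two. *)
  assert (Loop : forall r j m, 6 + j + r = b -> m 0 = B -> m 1 = 6 + j -> m 2 = B + 192 + 32 * j ->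
     (forall x, 6 <= x -> x < B -> m x = nth x code 0) -> m 3 = b ->
     (forall a i, a < 32 -> m (B + (32 * i + a)) = input_upto code (6 + j) a i) ->
     exists (k : nat) (m' : nat -> nat), k <= 10 * r + 2 /\ run P k (35, m) = (45, m') /\ m' 0 = B /\
       forall a i, a < 32 -> m' (B + (32 * i + a)) = input_upto code b a i).
  { pose proof (code_at_skipn _ _ _ 35 Hc) as Hs. cbn [skipn prelude Nat.add] in Hs.
    do 10 (apply code_at_cons in Hs as [? Hs]). clear Hs Hc R2 R1.
    induction r as [|r IH]; intros j m Ej K0 K1 K2 KL K3 KA.
    - exists 2, (upd m 4 0). split; [lia|]. split; [|split].
      + stepone H. stepone H0. usolve. replace (m 3 - m 1) with 0 by lia. reflexivity.
      + usolve; auto.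
      + intros a i Ha. usolve. rewrite KA by auto. f_equal; lia.
    - set (v := m (6 + j)).
      assert (Hv : v = nth (6 + j) code 0) by (apply KL; lia).
      assert (exists m', run P 10 (35, m) = (35, m') /\ m' 0 = B /\ m' 1 = 7 + j /\ m' 2 = B + 224 + 32 * j /\
         m' 3 = b /\ m' (B + 192 + 32 * j) = v /\
         (forall x, 6 <= x -> x <> B + 192 + 32 * j -> m' x = m x)) as (m' & R & M0 & M1 & M2 & M3 & Mv & MO).
      { eexists. split; [|split; [|split; [|split; [|split; [|split]]]]].
        { steps. usolve.
          replace (Nat.eqb (m 3 - m 1) 0) with false by (symmetry; apply Nat.eqb_neq; lia).
          steps. rewrite ?upd_eq. rewrite !(upd_neq _ 4 _ 1), !(upd_neq _ 4 _ 2) by lia. rewrite K1, K2.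
          usolve. cbn [run Nat.eqb]. reflexivity. }
        all: intros; usolve; rewrite ?K1, ?K2; try reflexivity; try lia. }
      destruct (IH (S j) m') as (k & m3 & Hk & R' & E0 & EA); auto; try lia.
      { intros x Hx Hx'. rewrite MO by lia. auto. }
      { intros a i Ha. unfold input_upto. destruct (Nat.eqb_spec a 0) as [->|Na]; cbn [andb].
        - destruct (Nat.eq_dec i (6 + j)) as [->|Ni].
          + rewrite Nat.add_0_r. replace (B + 32 * (6 + j)) with (B + 192 + 32 * j) by lia. rewrite Mv, Hv.
            replace (Nat.leb 6 (6 + j) && Nat.ltb (6 + j) (6 + S j)) with true by
              (symmetry; apply andb_true_intro; split; [apply Nat.leb_le|apply Nat.ltb_lt]; lia).
            rewrite orb_true_r. auto.
          + rewrite MO by lia. rewrite KA by lia. unfold input_upto. cbn [Nat.eqb andb].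
            replace (Nat.ltb i (6 + S j)) with (Nat.ltb i (6 + j)); auto.
            destruct (Nat.ltb_spec i (6 + j)), (Nat.ltb_spec i (6 + S j)); auto; lia.
        - rewrite MO by lia. rewrite KA by lia. unfold input_upto. apply Nat.eqb_neq in Na. rewrite Na. auto. }
      exists (10 + k), m3. split; [lia|]. rewrite run_add, R. auto. }
  destruct (Loop (b - 6) 0 m2) as (k & m3 & Hk & R & E0 & EA); auto; try lia.
  pose proof (code_at_skipn _ _ _ 45 Hc) as Hs. cbn [skipn prelude Nat.add] in Hs.
  do 2 (apply code_at_cons in Hs as [? Hs]).
  exists (20 + (15 + (k + 2))), (upd (upd m3 5 0) 1 B). split; [lia|]. split.
  { unfold init. fold (mem_of code). rewrite run_add, R1, run_add, R2, run_add, R. steps. cbn [run]. usolve.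
    rewrite E0, Nat.add_0_r. auto. }
  exists (St (fun x => m3 (100 + x)) (fun a i => input_upto code b a i)). split.
  - split; [|split].
    + usolve; auto.
    + intros x Hx. usolve. auto.
    + intros a i Ha. usolve. rewrite EA by auto. reflexivity.
  - reflexivity.
Qed.

(** The length of [prelude] is 47. Variable 0 lives in cell 100 and is copied to the answer cell.
    The instruction after [IHalt] is the target of the early exit: it answers 0, and the machine
    halts by running off the end of the program. *)
Definition machine (c : cmd) : list instr :=
  let l := length (comp 47 0 c) in
  prelude (47 + l + 3) ++ comp 47 0 c ++ [IConst 0 0; IAdd 0 0 100; IHalt; IConst 0 0].

(** * Length of the encoded input, and correctness of the whole machine *)

Definition rules_code (M : mtt) : list nat := flat_map enc_rule (rules M).

Definition ptr_alph (M : mtt) (s t : tree) : nat :=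
  6 + length (rules_code M) + length (enc_tree s) + length (enc_tree t).

Lemma length_enc_ralph (B : ralph) : length (enc_ralph B) = 1 + (length B + length B).
Proof.
  unfold enc_ralph. cbn [length]. f_equal. induction B as [|[a k] B IH]; simpl; lia.
Qed.

Lemma mem_of_skip (l1 : list nat) (x : nat) (l2 : list nat) : mem_of (l1 ++ x :: l2) (length l1) = x.
Proof. unfold mem_of. rewrite app_nth2, Nat.sub_diag by lia. auto. Qed.

(** The three hops in [arrays_base] follow the layout of the three alphabets, so they land exactly
    at the end of the input before 400 is added. *)
Lemma enc_input_length (M : mtt) (s t : tree) :
  length (enc_input M s t) <= arrays_base (mem_of (enc_input M s t)).
Proof.
  remember (mem_of (enc_input M s t)) as m eqn:Em.
  assert (E3 : m 3 = ptr_alph M s t) by (subst; reflexivity).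
  assert (E : exists l, length l = ptr_alph M s t /\
     enc_input M s t = l ++ enc_ralph (states M) ++ enc_ralph (inp M) ++ enc_ralph (outp M)).
  { unfold enc_input. fold (rules_code M).
    eexists (_ :: _ :: _ :: _ :: _ :: _ :: rules_code M ++ enc_tree s ++ enc_tree t). split.
    - cbn [length]. rewrite !length_app. unfold ptr_alph. lia.
    - cbn [app]. do 6 f_equal. now rewrite <- !app_assoc. }
  destruct E as (l & El & E).
  assert (F1 : m (length l) = length (states M)).
  { rewrite Em, E. unfold enc_ralph at 1. cbn [app]. apply mem_of_skip. }
  assert (F2 : m (length l + (1 + (length (states M) + length (states M)))) = length (inp M)).
  { rewrite Em, E, <- length_enc_ralph, <- length_app, app_assoc. unfold enc_ralph at 2. cbn [app]. apply mem_of_skip. }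
  assert (F3 : m (length l + (1 + (length (states M) + length (states M))) + (1 + (length (inp M) + length (inp M)))) = length (outp M)).
  { rewrite Em, E, <- !length_enc_ralph, <- !length_app, !app_assoc. unfold enc_ralph at 3. cbn [app]. apply mem_of_skip. }
  rewrite E, !length_app, !length_enc_ralph.
  unfold arrays_base. rewrite E3, <- El, F1.
  replace (length l + length (states M) + length (states M) + 1)
    with (length l + (1 + (length (states M) + length (states M)))) by lia.
  rewrite F2.
  replace (length l + (1 + (length (states M) + length (states M))) + length (inp M) + length (inp M) + 1)
    with (length l + (1 + (length (states M) + length (states M))) + (1 + (length (inp M) + length (inp M)))) by lia.
  rewrite F3. lia.
Qed.

(** Here [msize M] is 0 and even reading [s] or [t] would exceed the bound; one jump and one
    assignment suffice. *)
Lemma machine_no_rules (c : cmd) (M : mtt) (s t : tree) (b : Prop) :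
  rules M = [] -> ~ b -> decides_within (machine c) (enc_input M s t) 2 b.
Proof.
  intros HR Hb. unfold decides_within, init.
  assert (E : run (machine c) 2 (0, fun a => nth a (enc_input M s t) 0) =
     (47 + length (comp 47 0 c) + 4, upd (fun a => nth a (enc_input M s t) 0) 0 0)).
  { assert (H : code_at (machine c) 0 (machine c)) by (intros i x Hx; exact Hx).
    unfold machine at 2 in H. apply code_at_app in H as [H0 H]. apply code_at_app in H as [_ H].
    apply code_at_cons in H0 as [J _].
    do 3 (apply code_at_cons in H as [_ H]). apply code_at_cons in H as [K _].
    stepone J. unfold enc_input at 1. cbn [nth]. rewrite HR. cbn [length Nat.eqb].
    change (length (prelude (47 + length (comp 47 0 c) + 3))) with 47 in K.
    replace (S (S (S (0 + 47 + length (comp 47 0 c))))) with (47 + length (comp 47 0 c) + 3) in K by lia.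
    stepone K. cbn [run]. f_equal. lia. }
  rewrite E. split.
  - unfold halted, step.
    replace (nth_error (machine c) (47 + length (comp 47 0 c) + 4)) with (@None instr); auto.
    symmetry. apply nth_error_None. unfold machine. rewrite !length_app. cbn [length prelude]. lia.
  - cbn [snd]. rewrite upd_eq. tauto.
Qed.

Lemma machine_ok (c : cmd) (M : mtt) (s t : tree) (b : Prop) (T : nat) :
  wf_cmd 0 c = true -> rules M <> [] ->
  (forall s0, (forall a i, A s0 a i = input_upto (enc_input M s t) (ptr_alph M s t) a i) ->
     cost c s0 <= T /\ (V (exec c s0) 0 <> 0 <-> b)) ->
  exists n, n <= csize c * T + 10 * ptr_alph M s t + 63 /\
    decides_within (machine c) (enc_input M s t) n b.
Proof.
  intros Hwf HR Hspec.
  assert (H : code_at (machine c) 0 (machine c)) by (intros i x Hx; exact Hx).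
  unfold machine at 2 in H. apply code_at_app in H as [H0 H]. apply code_at_app in H as [H1 H].
  change (length (prelude (47 + length (comp 47 0 c) + 3))) with 47 in *. cbn [Nat.add] in H1.
  destruct (prelude_ok _ _ (enc_input M s t) (ptr_alph M s t) H0) as (k & m & Hk & R & s0 & S0 & I0).
  - cbn. destruct (rules M); [congruence|discriminate].
  - reflexivity.
  - unfold ptr_alph; lia.
  - apply enc_input_length.
  - destruct (Hspec s0 I0) as [HT HV].
    destruct (comp_ok (machine c) c 47 0 s0 m) as (k2 & m2 & Hk2 & R2 & S2 & _); auto; try lia.
    apply code_at_cons in H as [J1 H]. apply code_at_cons in H as [J2 H]. apply code_at_cons in H as [J3 _].
    exists (k + (k2 + 2)). split; [nia|].
    unfold decides_within.
    assert (E : run (machine c) (k + (k2 + 2)) (init (enc_input M s t)) =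
      (S (S (0 + 47 + length (comp 47 0 c))), upd (upd m2 0 0) 0 (m2 100))).
    { rewrite run_add, R, run_add, R2. change (47 + length (comp 47 0 c)) with (0 + 47 + length (comp 47 0 c)).
      stepone J1. stepone J2. cbn [run]. usolve. auto. }
    rewrite E. split.
    + unfold halted, step. now rewrite J3.
    + cbn [snd]. usolve. destruct S2 as (_ & S2 & _). specialize (S2 0 ltac:(lia)). cbn [Nat.add] in *. rewrite S2. auto.
Qed.

(** * Call-by-value semantics *)

Lemma tree_ind_list (P : tree -> Prop) :
  (forall a ts, Forall P ts -> P (Node a ts)) -> forall t, P t.
Proof.
  intros H. fix IH 1. intros [a ts]. apply H.
  induction ts as [|t ts IHts]; constructor; auto.
Qed.

Lemma rhs_ind_list (P : rhs -> Prop) :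
  (forall d us, Forall P us -> P (ROut d us)) ->
  (forall q i us, Forall P us -> P (RCall q i us)) ->
  (forall j, P (RPar j)) -> forall r, P r.
Proof.
  intros H1 H2 H3. fix IH 1. intros [d us|q i us|j]; [apply H1|apply H2|apply H3];
  induction us as [|u us IHus]; constructor; auto.
Qed.

Lemma form_ind_list (P : form -> Prop) :
  (forall d us, Forall P us -> P (FOut d us)) ->
  (forall q s us, Forall P us -> P (FCall q s us)) ->
  (forall j, P (FY j)) -> forall f, P f.
Proof.
  intros H1 H2 H3. fix IH 1. intros [d us|q i us|j]; [apply H1|apply H2|apply H3];
  induction us as [|u us IHus]; constructor; auto.
Qed.

Lemma den_ind_list (M : mtt) (P : form -> form -> Prop) :
  (forall j, P (FY j) (FY j)) ->
  (forall d us ts, Forall2 (den M) us ts -> Forall2 P us ts -> P (FOut d us) (FOut d ts)) ->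
  (forall q sg ss us r t ts, In (q, sg, r) (rules M) -> den M (inst ss r) t -> P (inst ss r) t ->
     Forall2 (den M) us ts -> Forall2 P us ts -> P (FCall q (Node sg ss) us) (subst ts t)) ->
  forall u f, den M u f -> P u f.
Proof.
  intros H1 H2 H3. fix IH 3. intros u f [j|d us ts H|q sg ss us r t ts Hr Ht H].
  - apply H1.
  - apply H2; auto. induction H; constructor; auto.
  - apply (H3 q sg ss us r t ts); auto. induction H; constructor; auto.
Qed.

Definition tree_eq_dec : forall a b : tree, {a = b} + {a <> b}.
Proof.
  fix IH 1. intros [a ts] [b us].
  destruct (Nat.eq_dec a b) as [->|N]; [|right; congruence].
  destruct (list_eq_dec IH ts us) as [->|N]; [left; auto|right; congruence].
Defined.

Fixpoint subs (t : tree) : list tree :=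
  match t with Node _ ts => t :: flat_map subs ts end.

Lemma subs_self (t : tree) : In t (subs t).
Proof. destruct t; simpl; auto. Qed.

Lemma subs_child (a : nat) (ts : list tree) (t' t : tree) :
  In t' ts -> In t (subs t') -> In t (subs (Node a ts)).
Proof. intros H1 H2. simpl. right. apply in_flat_map. eauto. Qed.

Lemma subs_trans (t' t : tree) : In t' (subs t) -> forall t'', In t'' (subs t') -> In t'' (subs t).
Proof.
  induction t as [a ts IH] using tree_ind_list. rewrite Forall_forall in IH.
  intros [<-|H] t'' H''; auto. apply in_flat_map in H as (c & Hc & H). eapply subs_child; eauto.
Qed.

Lemma list_sum_In (l : list nat) (x : nat) : In x l -> x <= list_sum l.
Proof. induction l as [|y l IH]; simpl; [tauto|]. intros [->|H]; [lia|]. apply IH in H. lia. Qed.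

Lemma tsize_child (a : nat) (ts : list tree) (t : tree) : In t ts -> tsize t < tsize (Node a ts).
Proof. intros H. simpl. apply Nat.lt_succ_r, list_sum_In, in_map, H. Qed.

Lemma tsize_subs (t t' : tree) : In t' (subs t) -> tsize t' <= tsize t.
Proof.
  induction t as [a ts IH] using tree_ind_list. rewrite Forall_forall in IH.
  intros [<-|H]; auto. apply in_flat_map in H as (c & Hc & H).
  pose proof (tsize_child a ts c Hc). specialize (IH c Hc H). lia.
Qed.

Lemma length_subs (t : tree) : length (subs t) = tsize t.
Proof.
  induction t as [a ts IH] using tree_ind_list. simpl. f_equal.
  induction IH as [|t ts Ht _ IH]; simpl; auto. rewrite length_app. lia.
Qed.

Lemma tsize_pos (t : tree) : 1 <= tsize t.
Proof. destruct t; simpl; lia. Qed.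

Lemma subs_wf (B : ralph) (t t' : tree) : wf_tree B t -> In t' (subs t) -> wf_tree B t'.
Proof.
  induction t as [a ts IH] using tree_ind_list. rewrite Forall_forall in IH.
  intros Hw [<-|H]; auto. apply in_flat_map in H as (c & Hc & H).
  inversion Hw as [? ? _ Hf]; subst. rewrite Forall_forall in Hf. eauto.
Qed.

Lemma ralph_rank_unique (B : ralph) (a k k' : nat) : ralph_ok B -> In (a, k) B -> In (a, k') B -> k = k'.
Proof.
  unfold ralph_ok. induction B as [|[b j] B IH]; simpl; [tauto|].
  intros Hn H H'. apply NoDup_cons_iff in Hn as [N Hn].
  assert (N' : forall i, ~ In (b, i) B) by (intros i Hi; apply N; now apply (in_map fst) in Hi).
  destruct H as [E|H], H' as [E'|H']; auto; try congruence; exfalso.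
  - injection E as -> ->. eapply N'; eauto.
  - injection E' as -> ->. eapply N'; eauto.
Qed.

(* [FY 0] is excluded: it serves as a junk value. *)
Inductive wf_form (M : mtt) (m : nat) : form -> Prop :=
| wff_out : forall d us, Forall (wf_form M m) us -> wf_form M m (FOut d us)
| wff_call : forall q s us, In (q, length us) (states M) -> wf_tree (inp M) s ->
    Forall (wf_form M m) us -> wf_form M m (FCall q s us)
| wff_y : forall j, 1 <= j <= m -> wf_form M m (FY j).

(** The shape of values: all calls have been evaluated, and only parameters with an index from 1 to
    [m] remain. Then no substitution of [m] forms ever falls back on the default of [nth]. *)
Inductive result (m : nat) : form -> Prop :=
| res_out : forall d us, Forall (result m) us -> result m (FOut d us)
| res_y : forall j, 1 <= j <= m -> result m (FY j).

Lemma inst_wf (M : mtt) (m : nat) (ss : list tree) (r : rhs) :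
  wf_rhs M (length ss) m r -> Forall (wf_tree (inp M)) ss -> wf_form M m (inst ss r).
Proof.
  intros Hr Hs. induction r as [d us IH|q i us IH|j] using rhs_ind_list; inversion Hr; subst; simpl; constructor; auto.
  - apply Forall_map. rewrite Forall_forall in *. auto.
  - rewrite length_map; auto.
  - rewrite Forall_forall in Hs. apply Hs, nth_In. lia.
  - apply Forall_map. rewrite Forall_forall in *. auto.
Qed.

Lemma nth_result (m k j : nat) (ts : list form) (d : form) :
  Forall (result m) ts -> length ts = k -> 1 <= j <= k -> result m (nth (j - 1) ts d).
Proof. intros H <- Hj. rewrite Forall_forall in H. apply H, nth_In. lia. Qed.

Lemma subst_result (m : nat) (ts : list form) (g : form) :
  result (length ts) g -> Forall (result m) ts -> result m (subst ts g).
Proof.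
  intros Hg Ht. induction g as [d us IH|q s us IH|j] using form_ind_list; inversion Hg; subst; simpl.
  - constructor. apply Forall_map. rewrite Forall_forall in *. auto.
  - eapply nth_result; eauto.
Qed.

Lemma rule_wf (M : mtt) (q sg m : nat) (ss : list tree) (r : rhs) :
  wf_mtt M -> In (q, sg, r) (rules M) -> In (q, m) (states M) -> In (sg, length ss) (inp M) ->
  wf_rhs M (length ss) m r.
Proof.
  intros (H1 & H2 & _ & _ & _ & H) Hr Hq Hs. destruct (H _ _ _ Hr) as (m' & k & Hm & Hk & Hw).
  rewrite (ralph_rank_unique _ _ _ _ H1 Hq Hm), (ralph_rank_unique _ _ _ _ H2 Hs Hk). auto.
Qed.

(** Ranks are unique, so the number of arguments of a call equals the rank for which the chosen rule
    is well formed. Hence the arguments cover all parameters of the value of its right-hand side. *)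
Lemma den_result (M : mtt) (m : nat) (u f : form) :
  wf_mtt M -> wf_form M m u -> den M u f -> result m f.
Proof.
  intros HM Hu Hd. revert m Hu.
  induction Hd as [j|d us ts _ IH|q sg ss us r t ts Hr _ IHt Hl IH] using den_ind_list; intros m Hu.
  - inversion Hu; subst; constructor; auto.
  - inversion Hu as [? ? Hf| |]; subst. constructor. clear Hu.
    induction IH; constructor; inversion Hf; subst; auto.
  - inversion Hu as [|? ? ? Hq Hs Hf|]; subst. inversion Hs; subst.
    pose proof (Forall2_length Hl) as L.
    apply subst_result.
    + apply IHt. rewrite <- L. apply inst_wf; auto. eapply rule_wf; eauto.
    + clear - IH Hf. induction IH; constructor; inversion Hf; subst; auto.
Qed.

Lemma nth_map_gen {X Y : Type} (f : X -> Y) (l : list X) (j : nat) (d : X) (d' : Y) :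
  j < length l -> nth j (map f l) d' = f (nth j l d).
Proof. intros H. rewrite nth_indep with (d' := f d) by (now rewrite length_map). apply map_nth. Qed.

(** Composition needs the hypothesis on [g]: a parameter beyond [ts] would be hit by [E] on the left
    but not on the right. *)
Lemma subst_subst (E ts : list form) (g : form) :
  result (length ts) g -> subst E (subst ts g) = subst (map (subst E) ts) g.
Proof.
  intros Hg. induction g as [d us IH|q s us IH|j] using form_ind_list; inversion Hg; subst; simpl.
  - f_equal. rewrite map_map. apply map_ext_in. rewrite Forall_forall in *. auto.
  - symmetry. apply nth_map_gen. lia.
Qed.

(* Only the parameters that occur in [g], whose values are subtrees of [t], matter. *)
Lemma subst_agree (k : nat) (X Y : list form) (g : form) : forall t,
  result k g -> subst X g = form_of_tree t ->
  (forall j t', 1 <= j <= k -> In t' (subs t) -> nth (j - 1) X (FY j) = form_of_tree t' ->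
     nth (j - 1) Y (FY j) = form_of_tree t') ->
  subst Y g = form_of_tree t.
Proof.
  induction g as [d us IH|q s us IH|j] using form_ind_list; intros t Hg HX HY; inversion Hg as [? ? Hr|]; subst.
  - destruct t as [a ts]. simpl in *. injection HX as -> HX. f_equal.
    assert (HY' : forall c, In c ts -> forall j t', 1 <= j <= k -> In t' (subs c) ->
       nth (j - 1) X (FY j) = form_of_tree t' -> nth (j - 1) Y (FY j) = form_of_tree t').
    { intros c Hc j t' Hj Ht. apply HY; auto. right. apply in_flat_map; eauto. }
    clear HY Hg. revert ts HX HY'. induction us as [|u us IHus]; intros [|c ts] HX HY; simpl in *; try discriminate; auto.
    injection HX as HX1 HX2. apply Forall_cons_iff in IH as [IHu IH]. apply Forall_cons_iff in Hr as [Hru Hr]. f_equal.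
    + apply IHu; auto. apply (HY c (or_introl eq_refl)).
    + apply IHus; auto. intros c' Hc'. apply (HY c' (or_intror Hc')).
  - simpl in *. apply HY; auto. apply subs_self.
Qed.

(** * What right-hand sides generate, and the facts about calls *)

(** The environment consists of forms rather than trees so that it can hold the junk value [FY 0].
    No tree contains [FY 0], so a value that uses such a parameter generates nothing. *)
Definition gen (M : mtt) (ss : list tree) (E : list form) (u : rhs) (t : tree) : Prop :=
  exists f, den M (inst ss u) f /\ subst E f = form_of_tree t.

Definition productive (M : mtt) (ss : list tree) (u : rhs) : Prop :=
  exists f, den M (inst ss u) f.

Definition rule_of (M : mtt) (q : nat) (v : tree) (r : rhs) (ss : list tree) : Prop :=
  exists sg, v = Node sg ss /\ In (q, sg, r) (rules M).

Definition call_productive (M : mtt) (v : tree) (q : nat) : Prop :=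
  exists r ss, rule_of M q v r ss /\ productive M ss r.

Definition call_proj (M : mtt) (v : tree) (q j : nat) : Prop :=
  exists r ss, rule_of M q v r ss /\ den M (inst ss r) (FY j).

Definition call_fact (M : mtt) (v : tree) (q : nat) (t0 : tree) (ts : list tree) : Prop :=
  exists r ss f, rule_of M q v r ss /\ den M (inst ss r) f /\ (forall j, f <> FY j) /\
    subst (map form_of_tree ts) f = form_of_tree t0.

(* A parameter equal to the target of a fact cannot have been used: it stands for an arbitrary value. *)
Definition erase (t0 : tree) (ts : list tree) : list form :=
  map (fun t => if tree_eq_dec t t0 then FY 0 else form_of_tree t) ts.

Lemma form_of_tree_inj (t t' : tree) : form_of_tree t = form_of_tree t' -> t = t'.
Proof.
  revert t'. induction t as [a ts IH] using tree_ind_list. intros [b us] H. simpl in H.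
  injection H as -> H. f_equal. revert us H.
  induction IH as [|t ts Ht _ IH]; intros [|u us] H; simpl in H; try discriminate; auto.
  injection H as H1 H2. f_equal; auto.
Qed.

Lemma form_of_tree_y (t : tree) (j : nat) : form_of_tree t <> FY j.
Proof. destruct t; discriminate. Qed.

Lemma gen_out (M : mtt) (ss : list tree) (E : list form) (d : nat) (us : list rhs) (t : tree) :
  gen M ss E (ROut d us) t <-> exists ts, t = Node d ts /\ Forall2 (gen M ss E) us ts.
Proof.
  split.
  - intros (f & Hd & Hs). simpl in Hd. inversion Hd as [|? ? fs Hf|]; subst.
    destruct t as [a ts]. simpl in Hs. injection Hs as -> Hs. exists ts. split; auto.
    clear Hd. revert fs ts Hf Hs. induction us as [|u us IH]; intros fs ts Hf Hs; simpl in Hf; inversion Hf; subst.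
    + destruct ts; try discriminate. constructor.
    + destruct ts; try discriminate. simpl in Hs. injection Hs as Hs1 Hs2. constructor; eauto.
      eexists; eauto.
  - intros (ts & -> & H).
    assert (exists fs, Forall2 (den M) (map (inst ss) us) fs /\ map (subst E) fs = map form_of_tree ts) as (fs & H1 & H2).
    { induction H as [|u t us ts (f & Hf & Ht) _ (fs & H1 & H2)].
      - exists []; auto.
      - exists (f :: fs). simpl. split; [constructor; auto|congruence]. }
    exists (FOut d fs). split; [constructor; auto|simpl; congruence].
Qed.

Lemma gen_par (M : mtt) (ss : list tree) (E : list form) (j : nat) (t : tree) :
  gen M ss E (RPar j) t <-> nth (j - 1) E (FY j) = form_of_tree t.
Proof.
  split.
  - intros (f & Hd & Hs). inversion Hd; subst. auto.
  - intros H. exists (FY j). split; [constructor|auto].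
Qed.

Lemma Forall2_nth {X Y : Type} (R : X -> Y -> Prop) (l : list X) (l' : list Y) (x : X) (y : Y) :
  length l = length l' -> (forall j, j < length l -> R (nth j l x) (nth j l' y)) -> Forall2 R l l'.
Proof.
  revert l'; induction l as [|a l IH]; intros [|b l'] L H; simpl in L; try discriminate; constructor.
  - apply (H 0). simpl; lia.
  - apply IH; [lia|]. intros j Hj. apply (H (S j)). simpl; lia.
Qed.

Lemma Forall2_nth_inv {X Y : Type} (R : X -> Y -> Prop) (l : list X) (l' : list Y) (x : X) (y : Y) :
  Forall2 R l l' -> forall j, j < length l -> R (nth j l x) (nth j l' y).
Proof.
  induction 1; intros [|j] Hj; simpl in *; try lia; auto. apply IHForall2. lia.
Qed.

(** Splits on whether the callee returns a bare parameter. If not, its value determines a tuple of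
    subtrees of [t0]. An argument whose value is not a subtree of [t0] cannot have been used and is
    coded by [t0] itself, which is why the last condition has a disjunction. *)
Lemma gen_call_inv (M : mtt) (ss : list tree) (E : list form) (q i m : nat) (us : list rhs) (t0 : tree) :
  wf_mtt M -> wf_rhs M (length ss) m (RCall q i us) -> Forall (wf_tree (inp M)) ss ->
  gen M ss E (RCall q i us) t0 ->
  (exists ts, length ts = length us /\ call_fact M (nth (i - 1) ss (Node 0 [])) q t0 ts /\ Forall (fun t => In t (subs t0)) ts /\
     forall j, j < length us -> nth j ts t0 = t0 \/ gen M ss E (nth j us (RPar 0)) (nth j ts t0)) \/
  (exists j, 1 <= j <= length us /\ call_proj M (nth (i - 1) ss (Node 0 [])) q j /\ gen M ss E (nth (j - 1) us (RPar 0)) t0).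
Proof.
  intros HM Hw Hss (f & Hd & Hs).
  inversion Hw as [|? ? ? Hq Hi Hus|]; subst.
  assert (Hv : wf_tree (inp M) (nth (i - 1) ss (Node 0 []))) by (rewrite Forall_forall in Hss; apply Hss, nth_In; lia).
  simpl in Hd. remember (nth (i - 1) ss (Node 0 [])) as v eqn:Ev. clear Ev. inversion Hd as [| |? sg ss' ? r g fs Hr Hg Hfs]; subst.
  pose proof (Forall2_length Hfs) as L. rewrite length_map in L.
  assert (Hg' : result (length fs) g).
  { rewrite <- L. eapply den_result; [eauto| |eauto]. inversion Hv; subst. apply inst_wf; auto. eapply rule_wf; eauto. }
  assert (Hgen : forall j t, j < length us -> subst E (nth j fs (FY 0)) = form_of_tree t -> gen M ss E (nth j us (RPar 0)) t).
  { intros j t Hj Ht. exists (nth j fs (FY 0)). split; auto.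
    apply (Forall2_nth_inv _ _ _ (inst ss (RPar 0)) (FY 0)) with (j := j) in Hfs; [|now rewrite length_map].
    rewrite map_nth in Hfs. auto. }
  destruct (classic (exists j, g = FY j)) as [(j & ->)|NY].
  - right. exists j. inversion Hg'; subst. split; [lia|]. split.
    + exists r, ss'. split; auto. eexists; split; eauto.
    + apply Hgen; [lia|]. simpl in Hs. rewrite <- Hs. f_equal. apply nth_indep. lia.
  - left.
    (* The choice of a component of the tuple: the tree that the argument becomes if this is a
       subtree of [t0], and otherwise the filler [t0]. *)
    assert (Pick : forall f, exists t, In t (subs t0) /\
      (subst E f = form_of_tree t \/ t = t0 /\ forall t', In t' (subs t0) -> subst E f <> form_of_tree t')).
    { intros f. destruct (classic (exists t, In t (subs t0) /\ subst E f = form_of_tree t)) as [(t & H1 & H2)|N].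
      - exists t; auto.
      - exists t0. split; [apply subs_self|]. right. split; auto. intros t' H1 H2. apply N; eauto. }
    assert (exists ts, Forall2 (fun f t => In t (subs t0) /\
      (subst E f = form_of_tree t \/ t = t0 /\ forall t', In t' (subs t0) -> subst E f <> form_of_tree t')) fs ts) as (ts & Hts).
    { clear - Pick. induction fs as [|f fs (ts & IH)]; [exists []; auto|]. destruct (Pick f) as (t & Ht). exists (t :: ts); auto. }
    pose proof (Forall2_length Hts) as L2.
    exists ts. split; [lia|]. split; [|split].
    + exists r, ss', g. split; [eexists; eauto|]. split; auto. split; [intros j ->; apply NY; eauto|].
      rewrite subst_subst in Hs by auto.
      eapply subst_agree; [eauto|eauto|]. intros j t' Hj Ht' Hn.
      rewrite (nth_map_gen _ _ _ (FY 0)) in Hn by lia.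
      apply (Forall2_nth_inv _ _ _ (FY 0) t0) with (j := j - 1) in Hts; [|lia].
      rewrite (nth_map_gen _ _ _ t0) by lia. destruct Hts as [_ [H|[_ H]]].
      * congruence.
      * exfalso. eapply H; eauto.
    + clear - Hts. induction Hts; constructor; tauto.
    + intros j Hj. apply (Forall2_nth_inv _ _ _ (FY 0) t0) with (j := j) in Hts; [|lia].
      destruct Hts as [_ [H|[H _]]]; auto.
Qed.

(** The root of [g] is an output symbol, so every parameter that occurs sits strictly below the root
    and its value is smaller than [t]. This is what frees the value [t] itself to act as a code for
    an ignored parameter. *)
Lemma result_nonvar (k : nat) (g : form) (X : list form) (t : tree) :
  result k g -> (forall j, g <> FY j) -> subst X g = form_of_tree t ->
  forall Y, (forall j t', 1 <= j <= k -> tsize t' < tsize t -> nth (j - 1) X (FY j) = form_of_tree t' ->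
     nth (j - 1) Y (FY j) = form_of_tree t') ->
  subst Y g = form_of_tree t.
Proof.
  intros Hg Hn HX Y HY. inversion Hg as [d us Hr|j]; subst; [|exfalso; eapply Hn; eauto].
  destruct t as [a ts]. simpl in *. injection HX as -> HX. f_equal.
  assert (HY' : forall c, In c ts -> forall j t', 1 <= j <= k -> In t' (subs c) ->
     nth (j - 1) X (FY j) = form_of_tree t' -> nth (j - 1) Y (FY j) = form_of_tree t').
  { intros c Hc j t' Hj Ht. apply HY; auto. apply tsize_subs in Ht. apply (tsize_child a) in Hc. simpl in Hc. lia. }
  clear - Hr HX HY'. revert ts HX HY'.
  induction us as [|u us IHus]; intros [|c ts] HX HY; simpl in *; try discriminate; auto.
  injection HX as HX1 HX2. inversion Hr; subst. f_equal.
  - apply (subst_agree k X); auto. apply (HY c (or_introl eq_refl)).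
  - apply IHus; auto. intros c0 Hc0. apply (HY c0 (or_intror Hc0)).
Qed.

(** Converse of the first case of [gen_call_inv]. Productivity supplies some value for every
    argument coded by [t0], and by [result_nonvar] it does not matter which. *)
Lemma gen_call (M : mtt) (ss : list tree) (E : list form) (q i m : nat) (us : list rhs) (t0 : tree) (ts : list tree) :
  wf_mtt M -> wf_rhs M (length ss) m (RCall q i us) -> Forall (wf_tree (inp M)) ss ->
  Forall (productive M ss) us -> length ts = length us ->
  call_fact M (nth (i - 1) ss (Node 0 [])) q t0 ts ->
  (forall j, j < length us -> nth j ts t0 = t0 \/ gen M ss E (nth j us (RPar 0)) (nth j ts t0)) ->
  gen M ss E (RCall q i us) t0.
Proof.
  intros HM Hw Hss Hp L (r & ss' & g & (sg & Ev & Hr) & Hg & Hn & Hs) Ht.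
  inversion Hw as [|? ? ? Hq Hi Hus|]; subst.
  assert (Hv : wf_tree (inp M) (nth (i - 1) ss (Node 0 []))) by (rewrite Forall_forall in Hss; apply Hss, nth_In; lia).
  assert (Hg' : result (length us) g).
  { eapply den_result; [eauto| |eauto]. rewrite Ev in Hv. inversion Hv; subst. apply inst_wf; auto. eapply rule_wf; eauto. }
  (* One value per argument: the witness of [gen] where the tuple prescribes a tree, and otherwise
     any value that productivity offers. *)
  assert (exists fs, Forall2 (fun u f => den M (inst ss u) f) us fs /\
     forall j, j < length us -> nth j ts t0 = t0 \/ subst E (nth j fs (FY 0)) = form_of_tree (nth j ts t0)) as (fs & Hfs & Hj).
  { clear - Hp L Ht. revert ts L Ht. induction Hp as [|u us [f Hf] _ IH]; intros [|t ts] L Ht; simpl in L; try discriminate.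
    - exists []. split; auto. simpl; intros; lia.
    - destruct (IH ts) as (fs & H1 & H2); [lia| |].
      { intros j Hj. apply (Ht (S j)). simpl; lia. }
      destruct (Ht 0) as [H|(f' & H & H')]; [simpl; lia| |].
      + exists (f :: fs). split; [constructor; auto|]. intros [|j] Hj; simpl in *; auto. apply H2; lia.
      + exists (f' :: fs). split; [constructor; auto|]. intros [|j] Hj; simpl in *; auto. apply H2; lia. }
  pose proof (Forall2_length Hfs) as L2.
  exists (subst fs g). split.
  - simpl. rewrite Ev. econstructor; eauto. clear - Hfs. induction Hfs; simpl; constructor; auto.
  - rewrite L2 in *. rewrite subst_subst by auto.
    eapply result_nonvar; eauto. intros j t' Hjk Hsz Hn'.
    rewrite (nth_map_gen _ _ _ t0) in Hn' by lia. rewrite (nth_map_gen _ _ _ (FY 0)) by lia.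
    (* If the component were [t0], the tree read at this parameter would be [t0], against its
       strictly smaller size. *)
    destruct (Hj (j - 1)) as [H|H]; [lia| |congruence].
    rewrite H in Hn'. apply form_of_tree_inj in Hn'. subst. lia.
Qed.

(** The returned argument determines the result; all other arguments take arbitrary values. *)
Lemma gen_call_proj (M : mtt) (ss : list tree) (E : list form) (q i j : nat) (us : list rhs) (t0 : tree) :
  Forall (productive M ss) us -> 1 <= j <= length us ->
  call_proj M (nth (i - 1) ss (Node 0 [])) q j -> gen M ss E (nth (j - 1) us (RPar 0)) t0 ->
  gen M ss E (RCall q i us) t0.
Proof.
  intros Hp Hj (r & ss' & (sg & Ev & Hr) & Hd) (f & Hf & Ht).
  assert (exists fs, Forall2 (fun u f => den M (inst ss u) f) us fs /\ nth (j - 1) fs (FY j) = f) as (fs & Hfs & Hjf).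
  { remember (j - 1) as k. assert (Hk : k < length us) by lia. clear - Hp Hk Hf. revert k Hk Hf.
    induction Hp as [|u us [f' Hf'] Hp IH]; intros k Hk Hf; simpl in Hk; [lia|].
    destruct k as [|k].
    - assert (exists fs, Forall2 (fun u f => den M (inst ss u) f) us fs) as (fs & Hfs).
      { clear - Hp. induction Hp as [|u us [f Hf] _ (fs & IH)]; [exists []; auto|exists (f :: fs); auto]. }
      exists (f :: fs). auto.
    - destruct (IH k) as (fs & H1 & H2); auto; [lia|]. exists (f' :: fs); auto. }
  exists (subst fs (FY j)). split.
  - cbn [inst]. rewrite Ev. econstructor; eauto. clear - Hfs. induction Hfs; simpl; constructor; auto.
  - simpl. rewrite Hjf. auto.
Qed.

(** The form in which facts are computed. With erased parameters a bare parameter can never become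
    [t0]: it is junk if its tree is [t0], and a different tree otherwise. So the clause of
    [call_fact] that excludes bare parameters needs no test. In the other direction, erasing is
    harmless because a used parameter is smaller than [t0]. *)
Lemma call_fact_erase (M : mtt) (v : tree) (q : nat) (t0 : tree) (ts : list tree) :
  wf_mtt M -> wf_tree (inp M) v -> In (q, length ts) (states M) ->
  call_fact M v q t0 ts <-> exists r ss, rule_of M q v r ss /\ gen M ss (erase t0 ts) r t0.
Proof.
  intros HM Hv Hq. split.
  - intros (r & ss & f & (sg & -> & Hr) & Hd & Hn & Hs). exists r, ss. split; [eexists; eauto|].
    exists f. split; auto. inversion Hv; subst.
    eapply result_nonvar with (k := length ts); eauto.
    + eapply den_result; eauto. apply inst_wf; auto. eapply rule_wf; eauto.
    + intros j t' Hj Hsz Hn'. unfold erase. rewrite (nth_map_gen _ _ _ t0) by lia. rewrite (nth_map_gen form_of_tree ts (j - 1) t0) in Hn' by lia.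
      apply form_of_tree_inj in Hn'. destruct (tree_eq_dec _ _) as [e|]; [|congruence].
      rewrite <- Hn', e in Hsz. lia.
  - intros (r & ss & (sg & -> & Hr) & (f & Hd & Hs)). inversion Hv; subst.
    assert (Hf : result (length ts) f).
    { eapply den_result; eauto. apply inst_wf; auto. eapply rule_wf; eauto. }
    exists r, ss, f. split; [eexists; eauto|]. split; auto. split.
    + intros j ->. inversion Hf; subst. simpl in Hs. unfold erase in Hs.
      rewrite (nth_map_gen _ _ _ t0) in Hs by lia. destruct (tree_eq_dec _ _).
      * symmetry in Hs. eapply form_of_tree_y; eauto.
      * apply form_of_tree_inj in Hs. auto.
    + eapply subst_agree; eauto. intros j t' Hj Ht' Hn.
      unfold erase in Hn. rewrite (nth_map_gen _ _ _ t0) by lia. rewrite (nth_map_gen _ ts (j - 1) t0) in Hn by lia. destruct (tree_eq_dec _ _); auto.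
      symmetry in Hn. exfalso. eapply form_of_tree_y; eauto.
Qed.

(** The initial state has rank 0, so its values are never bare parameters and the empty tuple covers
    the translation. *)
Lemma tau_IO_fact (M : mtt) (s t : tree) :
  wf_mtt M -> wf_tree (inp M) s -> wf_tree (outp M) t -> tau_IO M s t <-> call_fact M s (q0 M) t [].
Proof.
  intros HM Hs Ht. assert (Hq : In (q0 M, 0) (states M)) by apply HM.
  split.
  - intros (_ & _ & Hd). inversion Hd as [| |q sg ss us r g fs Hr Hg Hf E1 E2]; subst. inversion Hf; subst.
    inversion Hs; subst.
    assert (result 0 g) by (eapply den_result; eauto; apply inst_wf; auto; eapply rule_wf; eauto).
    exists r, ss, g. split; [eexists; eauto|]. split; auto. split; auto.
    intros j ->. inversion H; lia.
  - intros (r & ss & f & (sg & -> & Hr) & Hd & _ & Hf). split; [auto|]. split; auto.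
    simpl in Hf. rewrite <- Hf. econstructor; eauto.
Qed.

Lemma productive_call (M : mtt) (ss : list tree) (q i : nat) (us : list rhs) :
  productive M ss (RCall q i us) <-> call_productive M (nth (i - 1) ss (Node 0 [])) q /\ Forall (productive M ss) us.
Proof.
  split.
  - intros (f & Hd). simpl in Hd. remember (nth (i - 1) ss (Node 0 [])) as v eqn:Ev.
    inversion Hd as [| |? sg ss' ? r g fs Hr Hg Hfs]; subst. split.
    + exists r, ss'. split; [eexists; eauto|]. eexists; eauto.
    + clear - Hfs. remember (map (inst ss) us) as l eqn:E. revert us E.
      induction Hfs; intros [|u us] E; simpl in E; try discriminate; constructor; injection E as -> ->; auto.
      eexists; eauto.
  - intros ((r & ss' & (sg & Ev & Hr) & (g & Hg)) & Hp).
    assert (exists fs, Forall2 (den M) (map (inst ss) us) fs) as (fs & Hfs).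
    { clear - Hp. induction Hp as [|u us [f Hf] _ (fs & IH)]; [exists []; constructor|exists (f :: fs); simpl; constructor; auto]. }
    eexists. simpl. rewrite Ev. econstructor; eauto.
Qed.

Lemma productive_out (M : mtt) (ss : list tree) (d : nat) (us : list rhs) :
  productive M ss (ROut d us) <-> Forall (productive M ss) us.
Proof.
  split.
  - intros (f & Hd). simpl in Hd. inversion Hd as [|? ? fs Hfs|]; subst. clear Hd.
    remember (map (inst ss) us) as l eqn:E. revert us E.
    induction Hfs; intros [|u us] E; simpl in E; try discriminate; constructor; injection E as -> ->; auto.
    eexists; eauto.
  - intros Hp.
    assert (exists fs, Forall2 (den M) (map (inst ss) us) fs) as (fs & Hfs).
    { clear - Hp. induction Hp as [|u us [f Hf] _ (fs & IH)]; [exists []; constructor|exists (f :: fs); simpl; constructor; auto]. }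
    eexists. constructor. eauto.
Qed.

Lemma productive_par (M : mtt) (ss : list tree) (j : nat) : productive M ss (RPar j).
Proof. exists (FY j). constructor. Qed.

Lemma proj_out (M : mtt) (ss : list tree) (d j : nat) (us : list rhs) : ~ den M (inst ss (ROut d us)) (FY j).
Proof. intros H. inversion H. Qed.

Lemma proj_par (M : mtt) (ss : list tree) (i j : nat) : den M (inst ss (RPar i)) (FY j) <-> i = j.
Proof. split; [intros H; inversion H; auto|intros ->; constructor]. Qed.

(** A bare parameter comes out of a call only if the callee passes on an argument that itself
    evaluates to this parameter. The remaining arguments need only some value, hence the
    productivity hypothesis. *)
Lemma proj_call (M : mtt) (ss : list tree) (q i m j : nat) (us : list rhs) :
  wf_mtt M -> wf_rhs M (length ss) m (RCall q i us) -> Forall (wf_tree (inp M)) ss -> Forall (productive M ss) us ->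
  den M (inst ss (RCall q i us)) (FY j) <->
  exists l, 1 <= l <= length us /\ call_proj M (nth (i - 1) ss (Node 0 [])) q l /\ den M (inst ss (nth (l - 1) us (RPar 0))) (FY j).
Proof.
  intros HM Hw Hss Hp. inversion Hw as [|? ? ? Hq Hi Hus|]; subst.
  assert (Hv : wf_tree (inp M) (nth (i - 1) ss (Node 0 []))) by (rewrite Forall_forall in Hss; apply Hss, nth_In; lia).
  split.
  - intros Hd. simpl in Hd. remember (nth (i - 1) ss (Node 0 [])) as v eqn:Ev.
    inversion Hd as [| |? sg ss' ? r g fs Hr Hg Hfs E1 E2]; subst.
    pose proof (Forall2_length Hfs) as L. rewrite length_map in L.
    assert (Hg' : result (length us) g).
    { eapply den_result; [eauto| |eauto]. match goal with E : Node sg ss' = _ |- _ => rewrite <- E in Hv end. inversion Hv; subst. apply inst_wf; auto. eapply rule_wf; eauto. }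
    inversion Hg' as [|l Hl]; subst; [discriminate|]. exists l. split; auto. split.
    + exists r, ss'. split; auto. eexists; eauto.
    + simpl in E2. apply (Forall2_nth_inv _ _ _ (inst ss (RPar 0)) (FY l)) with (j := l - 1) in Hfs; [|rewrite length_map; lia].
      rewrite map_nth, E2 in Hfs. simpl; rewrite ?E2; auto.
  - intros (l & Hl & (r & ss' & (sg & Ev & Hr) & Hd) & Hd').
    assert (exists fs, Forall2 (den M) (map (inst ss) us) fs /\ nth (l - 1) fs (FY l) = FY j) as (fs & Hfs & Hjf).
    { remember (l - 1) as k. assert (Hk : k < length us) by lia. clear - Hp Hk Hd'. revert k Hk Hd'.
      induction Hp as [|u us [f' Hf'] Hp IH]; intros k Hk Hf; simpl in Hk; [lia|].
      destruct k as [|k].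
      - assert (exists fs, Forall2 (den M) (map (inst ss) us) fs) as (fs & Hfs).
        { clear - Hp. induction Hp as [|u us [f Hf] _ (fs & IH)]; [exists []; constructor|exists (f :: fs); simpl; constructor; auto]. }
        exists (FY j :: fs). simpl; auto.
      - destruct (IH k) as (fs & H1 & H2); auto; [lia|]. exists (f' :: fs). simpl; auto. }
    simpl. rewrite Ev. rewrite <- Hjf. change (nth (l - 1) fs (FY l)) with (subst fs (FY l)). econstructor; eauto.
Qed.

(** * Reasoning about commands and their cost *)

(** A boolean, so that side conditions about written variables and arrays of concrete programs hold
    by [eq_refl]. *)
Fixpoint memb (x : nat) (l : list nat) : bool :=
  match l with [] => false | y :: l => Nat.eqb x y || memb x l end.

Fixpoint wvars (c : cmd) : list nat :=
  match c with
  | Skip | Sto _ _ _ => []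
  | Asn x _ => [x]
  | Seq c d | If _ c d => wvars c ++ wvars d
  | Rep _ c => wvars c
  end.

Fixpoint warrs (c : cmd) : list nat :=
  match c with
  | Skip | Asn _ _ => []
  | Sto a _ _ => [a]
  | Seq c d | If _ c d => warrs c ++ warrs d
  | Rep _ c => warrs c
  end.

Definition frame (vs bs : list nat) (s s' : st) : Prop :=
  (forall x, memb x vs = false -> V s' x = V s x) /\
  (forall a, memb a bs = false -> forall i, A s' a i = A s a i).

Lemma memb_app (x : nat) (l l' : list nat) : memb x (l ++ l') = memb x l || memb x l'.
Proof. induction l as [|y l IH]; simpl; auto. now rewrite IH, orb_assoc. Qed.

Lemma frame_refl (vs bs : list nat) (s : st) : frame vs bs s s.
Proof. split; auto. Qed.

Lemma frame_trans (vs bs : list nat) (s s' s'' : st) :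
  frame vs bs s s' -> frame vs bs s' s'' -> frame vs bs s s''.
Proof. intros [H1 H2] [H3 H4]. split; intros; [rewrite H3, H1|rewrite H4, H2]; auto. Qed.

Definition incl_b (l l' : list nat) : bool := forallb (fun x => memb x l') l.

Lemma incl_b_memb (l l' : list nat) (x : nat) : incl_b l l' = true -> memb x l' = false -> memb x l = false.
Proof.
  induction l as [|y l IH]; simpl; auto. rewrite andb_true_iff. intros [H1 H2] H.
  destruct (Nat.eqb_spec x y) as [->|N]; simpl; auto. congruence.
Qed.

Lemma frame_weaken (vs bs vs' bs' : list nat) (s s' : st) :
  frame vs bs s s' -> incl_b vs vs' = true -> incl_b bs bs' = true -> frame vs' bs' s s'.
Proof. intros [H1 H2] I1 I2. split; intros; [apply H1|apply H2]; eapply incl_b_memb; eauto. Qed.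

Lemma iter_frame (vs bs : list nat) (f : st -> st) (n : nat) : forall s,
  (forall s, frame vs bs s (f s)) -> frame vs bs s (iter n f s).
Proof.
  induction n as [|n IH]; intros s H; simpl; [apply frame_refl|]. eapply frame_trans; [apply H|apply IH, H].
Qed.

Lemma exec_frame (c : cmd) (s : st) : frame (wvars c) (warrs c) s (exec c s).
Proof.
  revert s; induction c as [|x e|a i e|c IHc d IHd|e c IHc d IHd|e c IHc]; intros s; simpl.
  - apply frame_refl.
  - split; auto. intros y. simpl. unfold upd. destruct (Nat.eqb y x); simpl; auto; discriminate.
  - split; auto. intros b. simpl. unfold updA. intros H j. destruct (Nat.eqb b a); simpl in H; auto; discriminate.
  - split; intros y H; rewrite memb_app, orb_false_iff in H; destruct H as [H1 H2]; intros.
    + now rewrite (proj1 (IHd _)), (proj1 (IHc s)).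
    + now rewrite (proj2 (IHd _)), (proj2 (IHc s)).
  - split; intros y H; rewrite memb_app, orb_false_iff in H; destruct H as [H1 H2]; intros; destruct (Nat.eqb _ 0).
    + now rewrite (proj1 (IHd s)).
    + now rewrite (proj1 (IHc s)).
    + now rewrite (proj2 (IHd s)).
    + now rewrite (proj2 (IHc s)).
  - apply iter_frame, IHc.
Qed.

(** Total correctness from one given start state, with a cost bound. Fixing the state instead of a
    precondition allows the bound and the postcondition to mention it. *)
Definition tri (c : cmd) (s : st) (k : nat) (Q : st -> Prop) : Prop := Q (exec c s) /\ cost c s <= k.

(** The frame comes for free in this rule and in those for sequences and loops, so invariants need
    not repeat what a command leaves alone. *)
Lemma tri_conseq (c : cmd) (s : st) (k k' : nat) (Q Q' : st -> Prop) :
  tri c s k Q -> k <= k' -> (forall s', frame (wvars c) (warrs c) s s' -> Q s' -> Q' s') -> tri c s k' Q'.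
Proof. intros [H1 H2] Hk H. split; [|lia]. apply H; auto. apply exec_frame. Qed.

Lemma tri_skip (s : st) (k : nat) (Q : st -> Prop) : Q s -> tri Skip s k Q.
Proof. split; simpl; auto. lia. Qed.

Lemma tri_asn (x : nat) (e : exp) (s : st) (k : nat) (Q : st -> Prop) :
  Q (St (upd (V s) x (ev e s)) (A s)) -> 1 <= k -> tri (Asn x e) s k Q.
Proof. split; simpl; auto. Qed.

Lemma tri_sto (a : nat) (i e : exp) (s : st) (k : nat) (Q : st -> Prop) :
  Q (St (V s) (updA (A s) a (ev i s) (ev e s))) -> 1 <= k -> tri (Sto a i e) s k Q.
Proof. split; simpl; auto. Qed.

Lemma tri_seq (c d : cmd) (s : st) (k1 k2 k : nat) (Q1 Q : st -> Prop) :
  tri c s k1 Q1 -> (forall s1, frame (wvars c) (warrs c) s s1 -> Q1 s1 -> tri d s1 k2 Q) -> k1 + k2 <= k ->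
  tri (Seq c d) s k Q.
Proof.
  intros [H1 H2] H Hk. destruct (H _ (exec_frame c s) H1) as [H3 H4]. split; simpl; auto. lia.
Qed.

Lemma tri_asn_seq (x : nat) (e : exp) (d : cmd) (s : st) (k : nat) (Q : st -> Prop) :
  tri d (St (upd (V s) x (ev e s)) (A s)) k Q -> tri (Seq (Asn x e) d) s (S k) Q.
Proof. intros [H1 H2]. split; simpl; auto. lia. Qed.

Lemma tri_sto_seq (a : nat) (i e : exp) (d : cmd) (s : st) (k : nat) (Q : st -> Prop) :
  tri d (St (V s) (updA (A s) a (ev i s) (ev e s))) k Q -> tri (Seq (Sto a i e) d) s (S k) Q.
Proof. intros [H1 H2]. split; simpl; auto. lia. Qed.

Lemma tri_if (e : exp) (c d : cmd) (s : st) (k : nat) (Q : st -> Prop) :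
  (ev e s <> 0 -> tri c s k Q) -> (ev e s = 0 -> tri d s k Q) -> tri (If e c d) s (S k) Q.
Proof.
  intros H1 H2. unfold tri. simpl. destruct (Nat.eqb_spec (ev e s) 0) as [E|E].
  - destruct (H2 E). split; auto. lia.
  - destruct (H1 E). split; auto. lia.
Qed.

Fixpoint sumf (n : nat) (f : nat -> nat) : nat :=
  match n with 0 => 0 | S n => sumf n f + f n end.

Lemma sumf_shift (n : nat) (f : nat -> nat) : sumf (S n) f = f 0 + sumf n (fun i => f (S i)).
Proof. induction n as [|n IH]; simpl in *; [lia|]. rewrite IH. lia. Qed.

Lemma sumf_ext (n : nat) (f g : nat -> nat) : (forall i, i < n -> f i = g i) -> sumf n f = sumf n g.
Proof. induction n as [|n IH]; intros H; simpl; auto. rewrite IH, H; auto. Qed.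

Lemma sumf_add (n : nat) (f g : nat -> nat) : sumf n (fun i => f i + g i) = sumf n f + sumf n g.
Proof. induction n as [|n IH]; simpl; auto. rewrite IH. lia. Qed.

Lemma sumf_mul (n c : nat) (f : nat -> nat) : sumf n (fun i => c * f i) = c * sumf n f.
Proof. induction n as [|n IH]; simpl; [lia|]. rewrite IH. lia. Qed.

Lemma sumf_const (n c : nat) : sumf n (fun _ => c) = n * c.
Proof. induction n as [|n IH]; simpl; [lia|]. rewrite IH. lia. Qed.

Lemma sumf_rev (n : nat) (f : nat -> nat) : sumf n (fun i => f (n - 1 - i)) = sumf n f.
Proof.
  induction n as [|n IH]; auto. rewrite sumf_shift. simpl. rewrite <- IH. rewrite !Nat.sub_0_r.
  rewrite Nat.add_comm. f_equal. apply sumf_ext. intros i Hi. f_equal. lia.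
Qed.

Lemma tri_rep (Inv : nat -> st -> Prop) (f : nat -> nat) (n : nat) (e : exp) (c : cmd) (s : st) (k : nat) (Q : st -> Prop) :
  ev e s = n -> Inv 0 s ->
  (forall i s', i < n -> frame (wvars c) (warrs c) s s' -> Inv i s' -> tri c s' (f i) (Inv (S i))) ->
  S (n + sumf n f) <= k ->
  (forall s', frame (wvars c) (warrs c) s s' -> Inv n s' -> Q s') ->
  tri (Rep e c) s k Q.
Proof.
  intros <- H0 Hb Hk HQ. unfold tri. simpl.
  (* Generalised to a loop that has completed [j] rounds and has [m] left; the frame is always
     relative to the state before the loop. *)
  assert (G : forall m j s', j + m = ev e s -> frame (wvars c) (warrs c) s s' -> Inv j s' ->
     frame (wvars c) (warrs c) s (iter m (exec c) s') /\ Inv (ev e s) (iter m (exec c) s') /\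
     iter_cost m (exec c) (cost c) s' <= m + sumf m (fun i => f (j + i))).
  { induction m as [|m IH]; intros j s' Ej Hf Hi.
    - simpl. replace (ev e s) with j by lia. auto.
    - destruct (Hb j s') as [H1 H2]; auto; [lia|].
      destruct (IH (S j) (exec c s')) as (G1 & G2 & G3); auto; [lia|eapply frame_trans; [eauto|apply exec_frame]|].
      cbn [iter iter_cost]. split; auto. split; auto. rewrite sumf_shift, Nat.add_0_r.
      assert (sumf m (fun i => f (S j + i)) = sumf m (fun i => f (j + S i))).
      { apply sumf_ext. intros i _. f_equal. lia. }
      lia. }
  destruct (G (ev e s) 0 s) as (G1 & G2 & G3); auto; [apply frame_refl|]. simpl in G3. split; auto.
  change (fun i => f i) with f in G3. lia.
Qed.

Definition setv (s : st) (x v : nat) : st := St (upd (V s) x v) (A s).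

(* [For] counts up and [Down] counts down; the bound is evaluated once. *)
Definition For (x : nat) (e : exp) (c : cmd) : cmd :=
  Seq (Asn x (Cst 0)) (Rep e (Seq c (Asn x (Add (Var x) (Cst 1))))).

Definition Down (x : nat) (e : exp) (c : cmd) : cmd :=
  Seq (Asn x e) (Rep (Var x) (Seq (Asn x (Sub (Var x) (Cst 1))) c)).

(** Each round pays one unit for the repetition and one for the increment; the leading 2 pays for
    the initial assignment and the loop entry. The body must establish the next invariant with the
    counter already advanced. *)
Lemma tri_for (Inv : nat -> st -> Prop) (f : nat -> nat) (n x : nat) (e : exp) (c : cmd) (s : st) (k : nat) (Q : st -> Prop) :
  memb x (wvars c) = false -> ev e (setv s x 0) = n -> Inv 0 (setv s x 0) ->
  (forall i s', i < n -> frame (x :: wvars c) (warrs c) s s' -> V s' x = i -> Inv i s' ->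
     tri c s' (f i) (fun s2 => Inv (S i) (setv s2 x (S i)))) ->
  2 + (2 * n + sumf n f) <= k ->
  (forall s', frame (x :: wvars c) (warrs c) s s' -> Inv n s' -> Q s') ->
  tri (For x e c) s k Q.
Proof.
  intros Hx He H0 Hb Hk HQ.
  assert (HF : forall s1 s2, frame (wvars (Seq c (Asn x (Add (Var x) (Cst 1))))) (warrs (Seq c (Asn x (Add (Var x) (Cst 1))))) s1 s2 ->
     frame (x :: wvars c) (warrs c) s1 s2).
  { intros s1 s2 [F1 F2]. simpl in F1, F2. split; intros y Hy.
    - cbn [memb] in Hy. apply orb_false_iff in Hy as [E1 E2]. apply F1. rewrite memb_app, E2. simpl. rewrite E1. auto.
    - apply F2. rewrite memb_app, Hy. auto. }
  assert (H00 : frame (x :: wvars c) (warrs c) s (setv s x 0)).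
  { split; auto. intros y Hy. simpl in *. unfold upd. destruct (Nat.eqb y x); auto; discriminate. }
  apply tri_seq with (k1 := 1) (k2 := S (n + sumf n (fun i => f i + 1))) (Q1 := fun s1 => s1 = setv s x 0).
  - apply tri_asn; auto.
  - intros s1 _ ->. eapply tri_rep with (Inv := fun i s' => V s' x = i /\ Inv i s') (f := fun i => f i + 1); eauto.
    + split; auto. simpl. apply upd_eq.
    + intros i s' Hi Hf [Hv HI]. eapply tri_seq with (k1 := f i) (k2 := 1); [apply Hb; auto| |lia].
      * eapply frame_trans; [exact H00|]. auto.
      * intros s1 [F1 _] HI'. apply tri_asn; auto. simpl. rewrite F1, Hv by auto. rewrite Nat.add_1_r. split.
        -- apply upd_eq.
        -- exact HI'.
    + intros s' Hf [_ HI]. apply HQ; auto. eapply frame_trans; [exact H00|]. auto.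
  - assert (sumf n (fun i => f i + 1) = n + sumf n f); [|lia]. clear. induction n; simpl; lia.
Qed.

(** The counter is decremented before the body, so the invariant must not depend on it. In preorder
    children come after their parent, so counting down is bottom-up evaluation. *)
Lemma tri_down (Inv : nat -> st -> Prop) (f : nat -> nat) (n x : nat) (e : exp) (c : cmd) (s : st) (k : nat) (Q : st -> Prop) :
  memb x (wvars c) = false -> (forall i s v, Inv i s -> Inv i (setv s x v)) ->
  ev e s = n -> Inv n s ->
  (forall i s', i < n -> frame (x :: wvars c) (warrs c) s s' -> V s' x = i -> Inv (S i) s' -> tri c s' (f i) (Inv i)) ->
  2 + (2 * n + sumf n f) <= k ->
  (forall s', frame (x :: wvars c) (warrs c) s s' -> Inv 0 s' -> Q s') ->
  tri (Down x e c) s k Q.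
Proof.
  intros Hx Hst He H0 Hb Hk HQ.
  assert (HF : forall s1 s2, frame (wvars (Seq (Asn x (Sub (Var x) (Cst 1))) c)) (warrs (Seq (Asn x (Sub (Var x) (Cst 1))) c)) s1 s2 ->
     frame (x :: wvars c) (warrs c) s1 s2) by auto.
  assert (H00 : forall s v, frame (x :: wvars c) (warrs c) s (setv s x v)).
  { intros s0 v. split; auto. intros y Hy. simpl in *. unfold upd. destruct (Nat.eqb y x); auto; discriminate. }
  apply tri_seq with (k1 := 1) (k2 := S (n + sumf n (fun i => f (n - 1 - i) + 1))) (Q1 := fun s1 => s1 = setv s x n).
  - apply tri_asn; auto. now rewrite He.
  - intros s1 _ ->. eapply tri_rep with (Inv := fun i s' => V s' x = n - i /\ Inv (n - i) s') (f := fun i => f (n - 1 - i) + 1).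
    + simpl. apply upd_eq.
    + split; [simpl; rewrite upd_eq; lia|]. rewrite Nat.sub_0_r. auto.
    + intros i s' Hi Hf [Hv HI]. rewrite Nat.add_1_r. apply tri_asn_seq. simpl ev. rewrite Hv.
      eapply tri_conseq with (k := f (n - 1 - i)); [apply Hb; [lia| | |] | lia |].
      * eapply frame_trans; [apply H00|]. eapply frame_trans; [apply HF; eauto|]. apply H00.
      * simpl. rewrite upd_eq. lia.
      * replace (S (n - 1 - i)) with (n - i) by lia. apply Hst. auto.
      * intros s2 [F1 _] HI2. split.
        -- rewrite F1 by auto. simpl. rewrite upd_eq. lia.
        -- replace (n - S i) with (n - 1 - i) by lia. auto.
    + lia.
    + intros s' Hf [_ HI]. rewrite Nat.sub_diag in HI. apply HQ; auto. eapply frame_trans; [apply (H00 s n)|]. auto.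
  - rewrite <- (sumf_rev n f) in Hk. rewrite sumf_add, sumf_const. lia.
Qed.

(** * Trees as arrays of nodes in preorder *)

Record node : Type := Nd { nkind : nat; nsym : nat; nchild : nat; narity : nat }.

(** One node format for [t], [s] and all right-hand sides, so that they share one array and the
    passes over it. *)
Inductive ntree : Type := NT : nat -> nat -> nat -> list ntree -> ntree.

Fixpoint flat (x : ntree) : list node :=
  match x with NT k s c xs => Nd k s c (length xs) :: flat_map flat xs end.

Fixpoint nsubs (x : ntree) : list ntree :=
  match x with NT _ _ _ xs => x :: flat_map nsubs xs end.

Definition nsize (x : ntree) : nat := length (flat x).

(* Node kinds: 0 output symbol, 1 state call, 2 parameter, 3 node of an input or output tree. *)
Fixpoint nt_tree (t : tree) : ntree :=
  match t with Node a ts => NT 3 a 0 (map nt_tree ts) end.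

Fixpoint nt_rhs (r : rhs) : ntree :=
  match r with
  | ROut d us => NT 0 d 0 (map nt_rhs us)
  | RCall q i us => NT 1 q i (map nt_rhs us)
  | RPar j => NT 2 j 0 []
  end.

Fixpoint rsubs (r : rhs) : list rhs :=
  r :: match r with ROut _ us | RCall _ _ us => flat_map rsubs us | RPar _ => [] end.

Definition node0 : node := Nd 0 0 0 0.

Definition forest_at (L : list node) (i : nat) (xs : list ntree) : Prop :=
  exists l1 l2, L = l1 ++ flat_map flat xs ++ l2 /\ length l1 = i.

Definition at_ (L : list node) (i : nat) (x : ntree) : Prop := forest_at L i [x].

Lemma ntree_ind_list (P : ntree -> Prop) :
  (forall k s c xs, Forall P xs -> P (NT k s c xs)) -> forall x, P x.
Proof.
  intros H. fix IH 1. intros [k s c xs]. apply H. induction xs as [|x xs IHxs]; constructor; auto.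
Qed.

Lemma nsize_pos (x : ntree) : 1 <= nsize x.
Proof. destruct x; unfold nsize; simpl; lia. Qed.

Lemma length_nsubs (x : ntree) : length (nsubs x) = nsize x.
Proof.
  unfold nsize. induction x as [k s c xs IH] using ntree_ind_list. simpl. f_equal.
  induction IH as [|x xs Hx _ IH]; simpl; auto. rewrite !length_app. lia.
Qed.

Lemma firstn_app_length {X : Type} (l l' : list X) : firstn (length l) (l ++ l') = l.
Proof. now rewrite firstn_app, Nat.sub_diag, firstn_all, app_nil_r. Qed.

Lemma forest_cons (L : list node) (i : nat) (x : ntree) (xs : list ntree) :
  forest_at L i (x :: xs) <-> at_ L i x /\ forest_at L (i + nsize x) xs.
Proof.
  split.
  - intros (l1 & l2 & -> & <-). split.
    + exists l1, (flat_map flat xs ++ l2). simpl. now rewrite app_nil_r, <- app_assoc.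
    + exists (l1 ++ flat x), l2. simpl. rewrite <- !app_assoc. split; auto. rewrite length_app. reflexivity.
  - intros [(l1 & l2 & E & L1) (m1 & m2 & E' & L2)]. simpl in E. rewrite app_nil_r in E.
    exists l1, m2. split; auto. simpl. rewrite <- app_assoc.
    assert (m1 = l1 ++ flat x).
    { rewrite <- (firstn_app_length m1 (flat_map flat xs ++ m2)), <- E', E, app_assoc, L2, <- L1.
      unfold nsize. rewrite <- length_app. apply firstn_app_length. }
    subst m1. now rewrite E', <- app_assoc.
Qed.

Lemma at_node (L : list node) (i k s c : nat) (xs : list ntree) :
  at_ L i (NT k s c xs) -> nth i L node0 = Nd k s c (length xs) /\ forest_at L (S i) xs /\ i + nsize (NT k s c xs) <= length L.
Proof.
  intros (l1 & l2 & -> & <-). simpl. rewrite app_nil_r. split; [|split].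
  - rewrite app_nth2, Nat.sub_diag by lia. auto.
  - exists (l1 ++ [Nd k s c (length xs)]), l2. rewrite <- app_assoc. split; auto. rewrite length_app. simpl. lia.
  - rewrite length_app. simpl. rewrite length_app. unfold nsize. simpl. lia.
Qed.

Lemma at_bound (L : list node) (i : nat) (x : ntree) : at_ L i x -> i + nsize x <= length L.
Proof. destruct x. apply at_node. Qed.

Lemma forest_nth (L : list node) (xs : list ntree) (d : ntree) : forall i p,
  forest_at L i xs -> p < length (flat_map nsubs xs) ->
  (forall x, In x xs -> forall i p, at_ L i x -> p < nsize x -> at_ L (i + p) (nth p (nsubs x) d)) ->
  at_ L (i + p) (nth p (flat_map nsubs xs) d).
Proof.
  induction xs as [|x xs IH]; intros i p Hf Hp Hx; simpl in *; [lia|].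
  apply forest_cons in Hf as [H1 H2]. rewrite length_app, length_nsubs in Hp.
  destruct (lt_dec p (nsize x)) as [Hlt|Hge].
  - rewrite app_nth1 by now rewrite length_nsubs. apply Hx; auto.
  - rewrite app_nth2, length_nsubs by (rewrite length_nsubs; lia).
    replace (i + p) with (i + nsize x + (p - nsize x)) by lia. apply IH; auto. lia.
Qed.

(** In preorder, offset and enumeration agree: the node [p] places after the root of [x] is the root
    of entry [p] of [nsubs x]. Array positions can therefore stand for subtrees. *)
Lemma at_nth (L : list node) (x : ntree) (d : ntree) : forall i p,
  at_ L i x -> p < nsize x -> at_ L (i + p) (nth p (nsubs x) d).
Proof.
  induction x as [k s c xs IH] using ntree_ind_list. rewrite Forall_forall in IH. intros i p Hi Hp.
  rewrite <- length_nsubs in Hp. simpl in Hp.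
  destruct p as [|p].
  - now rewrite Nat.add_0_r.
  - simpl. replace (i + S p) with (S i + p) by lia. apply forest_nth; auto; [|lia]. apply (at_node _ _ _ _ _ _ Hi).
Qed.

Lemma at_total (xs : list ntree) (i : nat) :
  i < length (flat_map flat xs) -> exists x, at_ (flat_map flat xs) i x.
Proof.
  intros Hi. exists (nth i (flat_map nsubs xs) (NT 0 0 0 [])).
  assert (E : length (flat_map nsubs xs) = length (flat_map flat xs)).
  { clear. induction xs as [|x xs IH]; simpl; auto. rewrite !length_app, length_nsubs, IH. auto. }
  change i with (0 + i) at 1. apply forest_nth; [|lia|].
  - exists [], []. now rewrite app_nil_r.
  - intros x _ j p. apply at_nth.
Qed.

(* The position of the [j]-th tree of a forest that starts at position [i]. *)
Definition cpos (i : nat) (xs : list ntree) (j : nat) : nat := i + list_sum (map nsize (firstn j xs)).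

Lemma cpos_0 (i : nat) (xs : list ntree) : cpos i xs 0 = i.
Proof. unfold cpos. simpl. lia. Qed.

Lemma cpos_S (i : nat) (xs : list ntree) (j : nat) (d : ntree) :
  j < length xs -> cpos i xs (S j) = cpos i xs j + nsize (nth j xs d).
Proof.
  intros Hj. unfold cpos. rewrite <- Nat.add_assoc. f_equal.
  revert j Hj; induction xs as [|x xs IH]; intros j Hj; simpl in Hj; [lia|].
  destruct j as [|j]; [simpl; lia|]. change (firstn (S (S j)) (x :: xs)) with (x :: firstn (S j) xs).
  change (firstn (S j) (x :: xs)) with (x :: firstn j xs).
  cbn [map list_sum fold_right nth]. change (fold_right Nat.add 0) with list_sum. rewrite IH by lia. lia.
Qed.

Lemma cpos_all (i : nat) (xs : list ntree) : cpos i xs (length xs) = i + length (flat_map flat xs).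
Proof.
  unfold cpos. f_equal. rewrite firstn_all. induction xs as [|x xs IH]; simpl; auto. rewrite length_app, IH. auto.
Qed.

Lemma forest_at_cpos (L : list node) (xs : list ntree) (j : nat) (d : ntree) : forall i,
  forest_at L i xs -> j < length xs -> at_ L (cpos i xs j) (nth j xs d).
Proof.
  revert j; induction xs as [|x xs IH]; intros j i Hf Hj; simpl in Hj; [lia|].
  apply forest_cons in Hf as [H1 H2]. destruct j as [|j].
  - rewrite cpos_0. auto.
  - unfold cpos. cbn [firstn map list_sum fold_right]. rewrite Nat.add_assoc. apply (IH j (i + nsize x)); auto. lia.
Qed.

Lemma cpos_bound (i : nat) (xs : list ntree) (j : nat) (d : ntree) :
  j < length xs -> cpos i xs j + nsize (nth j xs d) <= i + length (flat_map flat xs).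
Proof.
  intros Hj. rewrite <- cpos_S by auto. rewrite <- cpos_all. unfold cpos.
  assert (H : list_sum (map nsize (firstn (S j) xs)) <= list_sum (map nsize (firstn (length xs) xs))); [|lia].
  rewrite firstn_all. rewrite <- (firstn_skipn (S j) xs) at 2. rewrite map_app, list_sum_app. lia.
Qed.

Lemma nsubs_tree (t : tree) : nsubs (nt_tree t) = map nt_tree (subs t).
Proof.
  induction t as [a ts IH] using tree_ind_list. simpl. f_equal.
  induction IH as [|t ts Ht _ IH]; simpl; auto. now rewrite Ht, IH, map_app.
Qed.

Lemma nsubs_rhs (r : rhs) : nsubs (nt_rhs r) = map nt_rhs (rsubs r).
Proof.
  induction r as [d us IH|q i us IH|j] using rhs_ind_list; simpl; f_equal;
  induction IH as [|t ts Ht _ IH]; simpl; auto; now rewrite Ht, IH, map_app.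
Qed.

Lemma nsize_tree (t : tree) : nsize (nt_tree t) = tsize t.
Proof. rewrite <- length_nsubs, nsubs_tree, length_map. apply length_subs. Qed.

Lemma length_rsubs (r : rhs) : length (rsubs r) = rsize r.
Proof.
  induction r as [d us IH|q i us IH|j] using rhs_ind_list; simpl; f_equal;
  induction IH as [|t ts Ht _ IH]; simpl; auto; rewrite length_app; lia.
Qed.

Lemma nsize_rhs (r : rhs) : nsize (nt_rhs r) = rsize r.
Proof. rewrite <- length_nsubs, nsubs_rhs, length_map. apply length_rsubs. Qed.

Definition arity_sum (l : list node) : nat := list_sum (map narity l).

Lemma arity_sum_app (l l' : list node) : arity_sum (l ++ l') = arity_sum l + arity_sum l'.
Proof. unfold arity_sum. now rewrite map_app, list_sum_app. Qed.

(** Every node except the root is a child of exactly one node. All amortised cost bounds rest on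
    this count: work proportional to 1 + arity at each node is linear in total. *)
Lemma arity_sum_flat (x : ntree) : S (arity_sum (flat x)) = nsize x.
Proof.
  unfold nsize. induction x as [k s c xs IH] using ntree_ind_list.
  change (flat (NT k s c xs)) with ([Nd k s c (length xs)] ++ flat_map flat xs).
  rewrite arity_sum_app, length_app. unfold arity_sum at 1. cbn [map list_sum fold_right narity length].
  assert (length xs + arity_sum (flat_map flat xs) = length (flat_map flat xs)); [|lia].
  induction IH as [|x xs Hx _ IH]; simpl; auto. rewrite arity_sum_app, length_app. lia.
Qed.

Lemma arity_sum_forest (xs : list ntree) : arity_sum (flat_map flat xs) <= length (flat_map flat xs).
Proof.
  induction xs as [|x xs IH]; simpl; auto. rewrite arity_sum_app, length_app.
  pose proof (arity_sum_flat x). unfold nsize in *. lia.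
Qed.

Lemma sumf_arity (l : list node) (L : list node) : forall i l1 l2,
  L = l1 ++ l ++ l2 -> length l1 = i -> sumf (length l) (fun j => narity (nth (i + j) L node0)) = arity_sum l.
Proof.
  induction l as [|x l IH]; intros i l1 l2 E Hi; auto.
  cbn [length]. rewrite sumf_shift. unfold arity_sum. cbn [map list_sum fold_right]. f_equal.
  - rewrite E, Nat.add_0_r, app_nth2 by lia. rewrite Hi, Nat.sub_diag. auto.
  - change (fold_right Nat.add 0 (map narity l)) with (arity_sum l). rewrite <- (IH (S i) (l1 ++ [x]) l2).
    + apply sumf_ext. intros j _. do 2 f_equal. lia.
    + rewrite E, <- app_assoc. auto.
    + rewrite length_app. simpl. lia.
Qed.

Lemma at_arity_sum (L : list node) (i : nat) (x : ntree) :
  at_ L i x -> S (sumf (nsize x) (fun j => narity (nth (i + j) L node0))) = nsize x.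
Proof.
  intros (l1 & l2 & E & Hi). simpl in E. rewrite app_nil_r in E.
  unfold nsize at 1. erewrite sumf_arity by eauto. apply arity_sum_flat.
Qed.

(** * The decision procedure *)

Notation "c ;; d" := (Seq c d) (at level 60, right associativity).

(* Arrays. [aKD], [aSY], [aCI], [aAR]: kind, symbol, child index and arity of the nodes, first those of t,
   then those of s, then those of the right-hand sides; [aNX]: first position after the subtree. *)
Notation aIN := 0 (only parsing).
Notation aKD := 1 (only parsing).
Notation aSY := 2 (only parsing).
Notation aCI := 3 (only parsing).
Notation aAR := 4 (only parsing).
Notation aNX := 5 (only parsing).
(* State, input symbol and root position of each rule; 1 + rank of a state (0: state never called). *)
Notation aRQ := 6 (only parsing).
Notation aRS := 7 (only parsing).
Notation aRG := 8 (only parsing).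
Notation aRK := 9 (only parsing).
(* Offsets: [aVB] of the rows of [aVV], [aRB] + [aQB] of the blocks of [aF]. *)
Notation aVB := 10 (only parsing).
Notation aRB := 11 (only parsing).
Notation aQB := 12 (only parsing).
(* [aCA]: canonical position of a subtree of t; [aPW]: powers of n; [aMO], [aDI]: remainder and quotient by n. *)
Notation aCA := 13 (only parsing).
Notation aPW := 14 (only parsing).
Notation aMO := 15 (only parsing).
Notation aDI := 16 (only parsing).
(* [aF]: facts; [aCH]: block rows of the children; [aCB]: block of the callee; [aMK]: marked nodes;
   [aEN]: parameter values; [aVV]: which subtrees of t a node of a right-hand side generates. *)
Notation aF := 17 (only parsing).
Notation aCH := 18 (only parsing).
Notation aCB := 19 (only parsing).
Notation aMK := 20 (only parsing).
Notation aEN := 21 (only parsing).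
Notation aVV := 22 (only parsing).

(* n = |t|; |t| + |s|; number of nodes; number of rules; maximal rank of a called state;
   block size; row size of [aF]. *)
Notation vn := 1 (only parsing).
Notation vns := 2 (only parsing).
Notation vN := 3 (only parsing).
Notation vNR := 4 (only parsing).
Notation vMX := 5 (only parsing).
Notation vZ := 6 (only parsing).
Notation vW := 7 (only parsing).

(** The absolute difference, as a sum of two truncated subtractions. *)
Definition neq (a b : exp) : exp := Add (Sub a b) (Sub b a).
Definition inc (x : nat) (e : exp) : cmd := Asn x (Add (Var x) e).

Definition copy_tree : cmd :=
  Rep (Sub (Var 12) (Var 10))
    (If (Sub (Var 12) (Var 10))
      (Sto aKD (Var 11) (Cst 3) ;; Sto aSY (Var 11) (Arr aIN (Var 10)) ;; Sto aCI (Var 11) (Cst 0) ;;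
       Sto aAR (Var 11) (Arr aIN (Add (Var 10) (Cst 1))) ;; inc 10 (Cst 2) ;; inc 11 (Cst 1))
      Skip).

Definition parse_node : cmd :=
  Sto aKD (Var 11) (Arr aIN (Var 10)) ;;
  Sto aSY (Var 11) (Arr aIN (Add (Var 10) (Cst 1))) ;;
  Asn 14 (Arr aIN (Var 10)) ;;
  If (Var 14)
    (If (Sub (Var 14) (Cst 1))
      (Sto aCI (Var 11) (Cst 0) ;; Sto aAR (Var 11) (Cst 0) ;; inc 10 (Cst 2))
      (Asn 15 (Arr aIN (Add (Var 10) (Cst 3))) ;;
       Sto aCI (Var 11) (Arr aIN (Add (Var 10) (Cst 2))) ;; Sto aAR (Var 11) (Var 15) ;; inc 10 (Cst 4) ;;
       inc 13 (Var 15) ;; If (Sub (Var 15) (Var vMX)) (Asn vMX (Var 15)) Skip))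
    (Asn 15 (Arr aIN (Add (Var 10) (Cst 2))) ;;
     Sto aCI (Var 11) (Cst 0) ;; Sto aAR (Var 11) (Var 15) ;; inc 10 (Cst 3) ;; inc 13 (Var 15)) ;;
  Asn 13 (Sub (Var 13) (Cst 1)) ;; inc 11 (Cst 1).

(** When no subtree is pending, the next two words are the header of a rule. As in [copy_tree], the
    bound counts words and surplus rounds idle. *)
Definition parse_rules : cmd :=
  Rep (Sub (Var 12) (Var 10))
    (If (Sub (Var 12) (Var 10))
      (If (Var 13) parse_node
        (Sto aRQ (Var vNR) (Arr aIN (Var 10)) ;; Sto aRS (Var vNR) (Arr aIN (Add (Var 10) (Cst 1))) ;;
         Sto aRG (Var vNR) (Var 11) ;; inc vNR (Cst 1) ;; inc 10 (Cst 2) ;; Asn 13 (Cst 1)))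
      Skip).

Definition parse : cmd :=
  Asn 10 (Arr aIN (Cst 2)) ;; Asn 11 (Cst 0) ;; Asn 12 (Arr aIN (Cst 3)) ;; copy_tree ;;
  Asn vn (Var 11) ;; Asn 10 (Arr aIN (Cst 1)) ;; Asn 12 (Arr aIN (Cst 2)) ;; copy_tree ;;
  Asn vns (Var 11) ;; Asn 10 (Cst 6) ;; Asn 12 (Arr aIN (Cst 1)) ;; Asn 13 (Cst 0) ;; Asn vNR (Cst 0) ;; Asn vMX (Cst 0) ;;
  parse_rules ;; Asn vN (Var 11).

(** A subtree ends where its last child ends; following [aNX] once per child finds this place, since
    the children have been handled already. *)
Definition next_pass : cmd :=
  Down 10 (Var vN)
    (Asn 11 (Add (Var 10) (Cst 1)) ;; Rep (Arr aAR (Var 10)) (Asn 11 (Arr aNX (Var 11))) ;; Sto aNX (Var 10) (Var 11)).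

Definition power_pass : cmd :=
  Sto aPW (Cst 0) (Cst 1) ;;
  For 10 (Add (Var vMX) (Cst 1))
    (Asn 11 (Cst 0) ;; Rep (Var vn) (inc 11 (Arr aPW (Var 10))) ;; Sto aPW (Add (Var 10) (Cst 1)) (Var 11)).

Definition divmod_pass : cmd :=
  Asn 11 (Cst 0) ;; Asn 12 (Cst 0) ;;
  For 10 (Arr aPW (Add (Var vMX) (Cst 1)))
    (Sto aMO (Var 10) (Var 11) ;; Sto aDI (Var 10) (Var 12) ;; inc 11 (Cst 1) ;;
     If (Sub (Var vn) (Var 11)) Skip (Asn 11 (Cst 0) ;; inc 12 (Cst 1))).

(** The branches trade places because [neq] vanishes on equality. *)
Definition is_kind (g : exp) (k : nat) (c d : cmd) : cmd := If (neq (Arr aKD g) (Cst k)) d c.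

(** A call node reveals the rank of its state; for q_0 the rank is known to be 0. A rule of any
    other state does not reveal its rank, but such a state is never evaluated. All blocks get the
    size for the largest rank: the wasted memory costs no time because it is never initialised. *)
Definition state_pass : cmd :=
  Asn vZ (Add (Add (Var vMX) (Cst 1)) (Arr aPW (Add (Var vMX) (Cst 1)))) ;;
  Sto aRK (Arr aIN (Cst 4)) (Cst 1) ;; Sto aQB (Arr aIN (Cst 4)) (Cst 0) ;; Asn vW (Var vZ) ;;
  For 10 (Var vN)
    (is_kind (Var 10) 1
      (If (Arr aRK (Arr aSY (Var 10))) Skip
        (Sto aRK (Arr aSY (Var 10)) (Add (Arr aAR (Var 10)) (Cst 1)) ;;
         Sto aQB (Arr aSY (Var 10)) (Var vW) ;; inc vW (Var vZ)))
      Skip).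

Definition row_pass : cmd :=
  Asn 11 (Cst 0) ;; Asn 12 (Cst 0) ;;
  For 10 (Var vN)
    (Sto aVB (Var 10) (Var 11) ;; inc 11 (Var vn) ;; Sto aRB (Var 10) (Var 12) ;; inc 12 (Var vW)).

(** Position 11 lies behind position 10, and the children of both lie behind position 10, so their
    canonical positions are final. Two nodes carry equal subtrees if their symbols and the canonical
    positions of their children agree. *)
Definition canon_step : cmd :=
  Asn 12 (Cst 1) ;; If (neq (Arr aSY (Var 10)) (Arr aSY (Var 11))) (Asn 12 (Cst 0)) Skip ;;
  Asn 13 (Add (Var 10) (Cst 1)) ;; Asn 14 (Add (Var 11) (Cst 1)) ;;
  Rep (Arr aAR (Var 10))
    (If (neq (Arr aCA (Var 13)) (Arr aCA (Var 14))) (Asn 12 (Cst 0)) Skip ;;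
     Asn 13 (Arr aNX (Var 13)) ;; Asn 14 (Arr aNX (Var 14))) ;;
  If (Var 12) (Sto aCA (Var 10) (Arr aCA (Var 11))) Skip.

Definition canon_pass : cmd :=
  Down 10 (Var vn)
    (Sto aCA (Var 10) (Var 10) ;;
     For 11 (Var vn) (If (Sub (Var 11) (Var 10)) canon_step Skip)).

Definition prepare : cmd :=
  parse ;; next_pass ;; power_pass ;; divmod_pass ;; state_pass ;; row_pass ;; canon_pass.

(* Scan of the nodes of the current right-hand side: block of the callee of every call node,
   and whether all callees are productive (variable 29). *)
Definition calls_pass : cmd :=
  Asn 29 (Cst 1) ;;
  For 30 (Var 26)
    (Asn 31 (Add (Var 25) (Var 30)) ;;
     is_kind (Var 31) 1
       (Sto aCB (Var 31) (Add (Arr aCH (Arr aCI (Var 31))) (Arr aQB (Arr aSY (Var 31)))) ;;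
        If (Arr aF (Arr aCB (Var 31))) Skip (Asn 29 (Cst 0)))
       Skip).

(* A node is marked if its value can be passed on unchanged as the value of the whole right-hand side. *)
Definition mark_pass : cmd :=
  Sto aMK (Var 25) (Cst 1) ;;
  For 30 (Var 26)
    (Asn 31 (Add (Var 25) (Var 30)) ;; Asn 32 (Add (Var 31) (Cst 1)) ;; Asn 33 (Cst 1) ;;
     Rep (Arr aAR (Var 31))
       (Sto aMK (Var 32) (Cst 0) ;;
        If (Arr aMK (Var 31))
          (is_kind (Var 31) 1 (If (Arr aF (Add (Arr aCB (Var 31)) (Var 33))) (Sto aMK (Var 32) (Cst 1)) Skip) Skip)
          Skip ;;
        Asn 32 (Arr aNX (Var 32)) ;; inc 33 (Cst 1)) ;;
     is_kind (Var 31) 2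
       (If (Arr aMK (Var 31)) (Sto aF (Add (Var 27) (Arr aSY (Var 31))) (Cst 1)) Skip) Skip).

Definition cell (g p : exp) : exp := Add (Arr aVB g) p.

Definition eval_out : cmd :=
  For 52 (Var vn)
    (Asn 53 (Cst 1) ;; If (neq (Arr aSY (Var 51)) (Arr aSY (Var 52))) (Asn 53 (Cst 0)) Skip ;;
     Asn 54 (Add (Var 51) (Cst 1)) ;; Asn 55 (Add (Var 52) (Cst 1)) ;;
     Rep (Arr aAR (Var 51))
       (If (Arr aVV (cell (Var 54) (Var 55))) Skip (Asn 53 (Cst 0)) ;;
        Asn 54 (Arr aNX (Var 54)) ;; Asn 55 (Arr aNX (Var 55))) ;;
     Sto aVV (cell (Var 51) (Var 52)) (Var 53)).

(** Digit 0 of the code in variable 56 is the target, the others are the arguments. Variable 59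
    starts as the fact bit and is cleared by an argument that neither equals the target nor is
    generated. Variable 60 is set by an argument that generates the target and that the callee can
    return unchanged. *)
Definition eval_call_fact : cmd :=
  Asn 57 (Arr aMO (Var 56)) ;; Asn 58 (Arr aDI (Var 56)) ;;
  Asn 59 (Arr aF (Add (Add (Arr aCB (Var 51)) (Arr aAR (Var 51))) (Add (Cst 1) (Var 56)))) ;;
  Asn 60 (Cst 0) ;; Asn 54 (Add (Var 51) (Cst 1)) ;; Asn 61 (Cst 1) ;;
  Rep (Arr aAR (Var 51))
    (Asn 62 (Arr aMO (Var 58)) ;; Asn 58 (Arr aDI (Var 58)) ;;
     If (Arr aVV (cell (Var 54) (Var 62)))
       (If (neq (Arr aCA (Var 62)) (Arr aCA (Var 57))) Skip
         (If (Arr aF (Add (Arr aCB (Var 51)) (Var 61))) (Asn 60 (Cst 1)) Skip))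
       (If (neq (Arr aCA (Var 62)) (Arr aCA (Var 57))) (Asn 59 (Cst 0)) Skip) ;;
     Asn 54 (Arr aNX (Var 54)) ;; inc 61 (Cst 1)) ;;
  If (Add (Var 59) (Var 60)) (Sto aVV (cell (Var 51) (Var 57)) (Cst 1)) Skip.

Definition eval_call : cmd :=
  For 52 (Var vn) (Sto aVV (cell (Var 51) (Var 52)) (Cst 0)) ;;
  For 56 (Arr aPW (Add (Arr aAR (Var 51)) (Cst 1))) eval_call_fact.

(** The second comparison, with the target in variable 41, implements [erase]: a parameter equal to
    the target generates nothing. *)
Definition eval_par : cmd :=
  For 52 (Var vn)
    (Sto aVV (cell (Var 51) (Var 52)) (Cst 0) ;;
     If (neq (Arr aCA (Var 52)) (Arr aCA (Arr aEN (Arr aSY (Var 51))))) Skip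
       (If (neq (Arr aCA (Var 52)) (Arr aCA (Var 41))) (Sto aVV (cell (Var 51) (Var 52)) (Cst 1)) Skip)).

Definition eval_pass : cmd :=
  Down 50 (Var 26)
    (Asn 51 (Add (Var 25) (Var 50)) ;;
     is_kind (Var 51) 0 eval_out (is_kind (Var 51) 1 eval_call eval_par)).

(* For n = 1 all digits are 0, and filling [aEN] would cost more than the size of the rule. *)
Definition fact_step : cmd :=
  Asn 41 (Arr aMO (Var 40)) ;;
  If (Sub (Var vn) (Cst 1))
    (Asn 42 (Arr aDI (Var 40)) ;; Asn 43 (Cst 1) ;;
     Rep (Var 28) (Sto aEN (Var 43) (Arr aMO (Var 42)) ;; Asn 42 (Arr aDI (Var 42)) ;; inc 43 (Cst 1)))
    Skip ;;
  eval_pass ;;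
  If (Arr aVV (cell (Var 25) (Var 41))) (Sto aF (Add (Add (Var 27) (Var 28)) (Add (Cst 1) (Var 40))) (Cst 1)) Skip.

Definition fact_pass : cmd := For 40 (Arr aPW (Add (Var 28) (Cst 1))) fact_step.

Definition rule_step : cmd :=
  Asn 24 (Arr aRQ (Var 23)) ;; Asn 25 (Arr aRG (Var 23)) ;;
  Asn 26 (Sub (Arr aNX (Var 25)) (Var 25)) ;; Asn 27 (Add (Var 22) (Arr aQB (Var 24))) ;;
  Asn 28 (Sub (Arr aRK (Var 24)) (Cst 1)) ;;
  calls_pass ;;
  If (Var 29) (Sto aF (Var 27) (Cst 1) ;; mark_pass ;; fact_pass) Skip.

Definition rules_pass : cmd :=
  For 23 (Var vNR)
    (If (neq (Arr aRS (Var 23)) (Arr aSY (Var 21))) Skip (If (Arr aRK (Arr aRQ (Var 23))) rule_step Skip)).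

Definition children_pass : cmd :=
  Asn 32 (Add (Var 21) (Cst 1)) ;; Asn 33 (Cst 1) ;;
  Rep (Arr aAR (Var 21))
    (Sto aCH (Var 33) (Arr aRB (Var 32)) ;; Asn 32 (Arr aNX (Var 32)) ;; inc 33 (Cst 1)).

Definition main_pass : cmd :=
  Down 20 (Sub (Var vns) (Var vn))
    (Asn 21 (Add (Var vn) (Var 20)) ;; Asn 22 (Arr aRB (Var 21)) ;; children_pass ;; rules_pass).

(** The root of [s] is node |t|. The block of q_0 has rank 0: its productivity bit is followed
    directly by the facts, so offset 1 is the fact with code 0, whose target is position 0, the tree
    [t] itself. *)
Definition decide : cmd :=
  prepare ;; main_pass ;;
  Asn 0 (Arr aF (Add (Arr aRB (Var vn)) (Add (Arr aQB (Arr aIN (Cst 4))) (Cst 1)))).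

Lemma decide_wf : wf_cmd 0 decide = true.
Proof. reflexivity. Qed.

(** * Decoding the node array, and the specification of the prepared tables *)

Lemma ev_neq (a b : exp) (s : st) : ev (neq a b) s = 0 <-> ev a s = ev b s.
Proof. simpl. lia. Qed.

(** The stored arities make the preorder listing a prefix-free code. *)
Lemma flat_inj (x : ntree) : forall y l l', flat x ++ l = flat y ++ l' -> x = y /\ l = l'.
Proof.
  induction x as [k s c xs IH] using ntree_ind_list. intros [k' s' c' ys] l l' H. simpl in H.
  injection H as -> -> -> Hl H.
  assert (xs = ys /\ l = l') as [-> ->]; [|auto].
  revert ys Hl H. induction IH as [|x xs Hx _ IH]; intros [|y ys] Hl H; simpl in *; try discriminate; auto.
  rewrite <- !app_assoc in H. apply Hx in H as [-> H]. apply IH in H as [-> ->]; auto.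
Qed.

Lemma at_unique (L : list node) (i : nat) (x y : ntree) : at_ L i x -> at_ L i y -> x = y.
Proof.
  intros (l1 & l2 & E1 & L1) (m1 & m2 & E2 & L2). simpl in *. rewrite app_nil_r in *.
  assert (l1 = m1).
  { rewrite <- (firstn_app_length l1 (flat x ++ l2)), <- (firstn_app_length m1 (flat y ++ m2)). congruence. }
  subst m1. rewrite E1 in E2. apply app_inv_head in E2. eapply flat_inj; eauto.
Qed.

Lemma map_inj_Forall {X Y : Type} (f : X -> Y) (l l' : list X) :
  Forall (fun x => forall y, f x = f y -> x = y) l -> map f l = map f l' -> l = l'.
Proof.
  intros H. revert l'. induction H as [|x l Hx _ IH]; intros [|y l'] E; simpl in E; try discriminate; auto.
  injection E as E1 E2. f_equal; auto.
Qed.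

Lemma nt_tree_inj (t t' : tree) : nt_tree t = nt_tree t' -> t = t'.
Proof.
  revert t'. induction t as [a ts IH] using tree_ind_list. intros [b us] H. simpl in H.
  injection H as -> H. f_equal. eapply map_inj_Forall; eauto.
Qed.

Lemma nt_rhs_inj (r r' : rhs) : nt_rhs r = nt_rhs r' -> r = r'.
Proof.
  revert r'. induction r as [d us IH|q i us IH|j] using rhs_ind_list; intros [d' us'|q' i' us'|j'] H; simpl in H; try discriminate;
  injection H; intros; subst; f_equal; eapply map_inj_Forall; eauto.
Qed.

Definition forest (M : mtt) (s t : tree) : list ntree :=
  nt_tree t :: nt_tree s :: map (fun x => nt_rhs (snd x)) (rules M).

Definition nodes (M : mtt) (s t : tree) : list node := flat_map flat (forest M s t).

Definition rule0 : nat * nat * rhs := (0, 0, RPar 0).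

Definition rule_pos (M : mtt) (s t : tree) (i : nat) : nat := cpos 0 (forest M s t) (2 + i).

Definition dig (n c j : nat) : nat := (c / n ^ j) mod n.

Definition sub_at (t : tree) (p : nat) : tree := nth p (subs t) t.

(** The contract between [prepare] and [main_pass], which only reads these data. Everything is
    bounded through [vMX], the largest rank found; [st_MX] is its only link to the maximal rank of
    the states. *)
Record Static (M : mtt) (s t : tree) (S : st) : Prop := {
  st_q0 : A S aIN 4 = q0 M;
  st_n : V S vn = tsize t;
  st_ns : V S vns = tsize t + tsize s;
  st_NR : V S vNR = length (rules M);
  st_MX : V S vMX <= max_state_rank M;
  st_arity : forall i, nkind (nth i (nodes M s t) node0) = 1 -> narity (nth i (nodes M s t) node0) <= V S vMX;
  st_node : forall i, i < length (nodes M s t) ->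
    Nd (A S aKD i) (A S aSY i) (A S aCI i) (A S aAR i) = nth i (nodes M s t) node0;
  st_rule : forall i, i < length (rules M) ->
    A S aRQ i = fst (fst (nth i (rules M) rule0)) /\ A S aRS i = snd (fst (nth i (rules M) rule0)) /\
    A S aRG i = rule_pos M s t i;
  st_next : forall i x, at_ (nodes M s t) i x -> A S aNX i = i + nsize x;
  st_pow : forall j, j <= V S vMX + 1 -> A S aPW j = tsize t ^ j;
  st_divmod : forall c, c < tsize t ^ (V S vMX + 1) -> A S aMO c = c mod tsize t /\ A S aDI c = c / tsize t;
  st_canon : forall p p', p < tsize t -> p' < tsize t -> A S aCA p = A S aCA p' <-> sub_at t p = sub_at t p';
  st_row : forall g, g < length (nodes M s t) -> A S aVB g = g * tsize t /\ A S aRB g = g * V S vW;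
  st_rank : forall q, A S aRK q <> 0 -> exists m, A S aRK q = Datatypes.S m /\ In (q, m) (states M) /\ m <= V S vMX /\
    A S aQB q + (m + 1 + tsize t ^ (m + 1)) <= V S vW;
  st_sep : forall q q' m m', A S aRK q = Datatypes.S m -> A S aRK q' = Datatypes.S m' -> q <> q' ->
    A S aQB q + (m + 1 + tsize t ^ (m + 1)) <= A S aQB q' \/ A S aQB q' + (m' + 1 + tsize t ^ (m' + 1)) <= A S aQB q;
  st_rank_q0 : A S aRK (q0 M) <> 0;
  st_rank_call : forall i, nkind (nth i (nodes M s t) node0) = 1 -> A S aRK (nsym (nth i (nodes M s t) node0)) <> 0
}.

Definition disjoint_b (l l' : list nat) : bool := forallb (fun x => negb (memb x l')) l.

Lemma disjoint_b_memb (l l' : list nat) (x : nat) : disjoint_b l l' = true -> memb x l = true -> memb x l' = false.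
Proof.
  induction l as [|y l IH]; simpl; [discriminate|]. rewrite andb_true_iff, negb_true_iff. intros [H1 H2].
  destruct (Nat.eqb_spec x y) as [->|N]; simpl; auto.
Qed.

Definition static_vars : list nat := [1; 2; 3; 4; 5; 6; 7].
Definition static_arrs : list nat := [0; 1; 2; 3; 4; 5; 6; 7; 8; 9; 10; 11; 12; 13; 14; 15; 16].

(** For a concrete program both disjointness conditions hold by computation, so the tables survive
    every later pass without further argument. *)
Lemma static_frame (M : mtt) (s t : tree) (vs bs : list nat) (S S' : st) :
  frame vs bs S S' -> disjoint_b static_vars vs = true -> disjoint_b static_arrs bs = true ->
  Static M s t S -> Static M s t S'.
Proof.
  intros [F1 F2] D1 D2 H.
  assert (HV : forall x, memb x static_vars = true -> V S' x = V S x).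
  { intros x Hx. apply F1. eapply disjoint_b_memb; eauto. }
  assert (HA : forall a, memb a static_arrs = true -> forall i, A S' a i = A S a i).
  { intros x Hx. apply F2. eapply disjoint_b_memb; eauto. }
  assert (E1 := HV 1 eq_refl). assert (E2 := HV 2 eq_refl). assert (E3 := HV 3 eq_refl).
  assert (E4 := HV 4 eq_refl). assert (E5 := HV 5 eq_refl). assert (E7 := HV 7 eq_refl). clear HV F1 F2 D1 D2.
  destruct H. constructor; intros; rewrite ?E1, ?E2, ?E4, ?E5, ?E7, ?(HA 0 eq_refl), ?(HA 1 eq_refl), ?(HA 2 eq_refl), ?(HA 3 eq_refl), ?(HA 4 eq_refl),
    ?(HA 5 eq_refl), ?(HA 6 eq_refl), ?(HA 7 eq_refl), ?(HA 8 eq_refl), ?(HA 9 eq_refl), ?(HA 10 eq_refl), ?(HA 11 eq_refl),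
    ?(HA 12 eq_refl), ?(HA 13 eq_refl), ?(HA 14 eq_refl), ?(HA 15 eq_refl), ?(HA 16 eq_refl) in *; auto.
Qed.

Lemma tree_at (M : mtt) (s t : tree) (p : nat) : p < tsize t -> at_ (nodes M s t) p (nt_tree (sub_at t p)).
Proof.
  intros Hp.
  assert (H : at_ (nodes M s t) 0 (nt_tree t)).
  { exists [], (flat_map flat (tl (forest M s t))). split; auto. simpl. now rewrite app_nil_r. }
  apply at_nth with (p := p) (d := nt_tree t) in H; [|now rewrite nsize_tree].
  rewrite nsubs_tree, map_nth in H. auto.
Qed.

Lemma input_at (M : mtt) (s t : tree) (p : nat) :
  p < tsize s -> at_ (nodes M s t) (tsize t + p) (nt_tree (sub_at s p)).
Proof.
  intros Hp.
  assert (H : at_ (nodes M s t) (tsize t) (nt_tree s)).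
  { exists (flat (nt_tree t)), (flat_map flat (tl (tl (forest M s t)))). split; [|apply nsize_tree].
    simpl. now rewrite app_nil_r. }
  apply at_nth with (p := p) (d := nt_tree s) in H; [|now rewrite nsize_tree].
  rewrite nsubs_tree, map_nth in H. auto.
Qed.

Lemma rule_at (M : mtt) (s t : tree) (i : nat) :
  i < length (rules M) -> at_ (nodes M s t) (rule_pos M s t i) (nt_rhs (snd (nth i (rules M) rule0))).
Proof.
  intros Hi. unfold rule_pos.
  assert (H : forest_at (nodes M s t) 0 (forest M s t)).
  { exists [], []. split; auto. now rewrite app_nil_r. }
  apply forest_at_cpos with (j := 2 + i) (d := nt_rhs (snd rule0)) in H.
  - cbn [nth forest Nat.add] in H. rewrite (map_nth (fun x => nt_rhs (snd x))) in H. auto.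
  - cbn [length forest]. rewrite length_map. lia.
Qed.

Lemma In_sub_at (t t' : tree) : In t' (subs t) -> exists p, p < tsize t /\ sub_at t p = t'.
Proof.
  intros H. apply (In_nth _ _ t) in H as (p & Hp & H). rewrite length_subs in Hp. eauto.
Qed.

Lemma sub_at_In (t : tree) (p : nat) : p < tsize t -> In (sub_at t p) (subs t).
Proof. intros H. apply nth_In. now rewrite length_subs. Qed.

(** * Digits *)

Lemma dig_lt (n c j : nat) : n <> 0 -> dig n c j < n.
Proof. intros; apply Nat.mod_upper_bound; auto. Qed.

(** Horner's scheme, with the head of the list as the least significant digit. *)
Lemma digits_exist (n : nat) (l : list nat) :
  Forall (fun d => d < n) l -> exists c, c < n ^ length l /\ forall j, j < length l -> dig n c j = nth j l 0.
Proof.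
  induction 1 as [|d l Hd _ (c & Hc & IH)].
  - exists 0. simpl. split; [lia|]. intros; lia.
  - exists (d + c * n). split; [simpl; nia|]. intros [|j] Hj; unfold dig.
    + rewrite Nat.pow_0_r, Nat.div_1_r, Nat.Div0.mod_add, Nat.mod_small; auto.
    + rewrite Nat.pow_succ_r', <- Nat.Div0.div_div, Nat.div_add, (Nat.div_small d n) by lia.
      apply IH. simpl in Hj. lia.
Qed.

Lemma div_pow_S (n c j : nat) : c / n ^ j / n = c / n ^ S j.
Proof. rewrite Nat.Div0.div_div. f_equal. simpl. lia. Qed.

Lemma div_le_self (c m : nat) : c / m <= c.
Proof. destruct m; [simpl; lia|]. apply Nat.Div0.div_le_upper_bound. nia. Qed.

(** The digits start at 1 because digit 0 is reserved for the target. *)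
Definition digit_trees (t : tree) (c m : nat) : list tree :=
  map (fun j => sub_at t (dig (tsize t) c j)) (seq 1 m).

Lemma nth_digit_trees (t : tree) (c m j : nat) (d : tree) :
  j < m -> nth j (digit_trees t c m) d = sub_at t (dig (tsize t) c (S j)).
Proof.
  intros Hj. unfold digit_trees.
  rewrite (nth_map_gen _ _ _ 0) by (now rewrite length_seq). now rewrite seq_nth.
Qed.

Lemma length_digit_trees (t : tree) (c m : nat) : length (digit_trees t c m) = m.
Proof. unfold digit_trees. now rewrite length_map, length_seq. Qed.

(** * Subterms of right-hand sides *)

Lemma rsubs_wf (M : mtt) (k m : nat) (r u : rhs) : wf_rhs M k m r -> In u (rsubs r) -> wf_rhs M k m u.
Proof.
  induction r as [d us IH|q i us IH|j] using rhs_ind_list; intros Hw Hu; simpl in Hu; destruct Hu as [<-|Hu]; auto; try tauto;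
  apply in_flat_map in Hu as (u' & H1 & H2); rewrite Forall_forall in IH; apply (IH u'); auto;
  inversion Hw; subst; match goal with H : Forall _ us |- _ => rewrite Forall_forall in H; auto end.
Qed.

Lemma rsubs_productive (M : mtt) (ss : list tree) (r u : rhs) : productive M ss r -> In u (rsubs r) -> productive M ss u.
Proof.
  induction r as [d us IH|q i us IH|j] using rhs_ind_list; intros Hw Hu; simpl in Hu; destruct Hu as [<-|Hu]; auto; try tauto;
  apply in_flat_map in Hu as (u' & H1 & H2); rewrite Forall_forall in IH; apply (IH u'); auto.
  - apply productive_out in Hw. rewrite Forall_forall in Hw; auto.
  - apply productive_call in Hw as [_ Hw]. rewrite Forall_forall in Hw; auto.
Qed.

Lemma rhs_at (L : list node) (g : nat) (r : rhs) (j : nat) :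
  at_ L g (nt_rhs r) -> j < rsize r -> exists u, In u (rsubs r) /\ at_ L (g + j) (nt_rhs u).
Proof.
  intros H Hj. exists (nth j (rsubs r) r). split; [apply nth_In; now rewrite length_rsubs|].
  apply at_nth with (p := j) (d := nt_rhs r) in H; [|now rewrite nsize_rhs].
  rewrite nsubs_rhs, map_nth in H. auto.
Qed.

(** * Evaluation of the nodes of a right-hand side *)

Arguments updA f a i v b j /.

Ltac vs := cbn [V A ev upd updA setv Nat.eqb].

(* Reads of the current state are traced back through assignments and frames. *)
Ltac norm := repeat (progress vs || match goal with
  | F : frame _ _ _ ?s' |- context [V ?s' ?x] => rewrite (proj1 F x eq_refl)
  | F : frame _ _ _ ?s' |- context [A ?s' ?a ?i] => rewrite (proj2 F a eq_refl i)
  end).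

Ltac norm_in K := repeat (progress (cbn [V A ev upd updA setv Nat.eqb] in K) || match goal with
  | F : frame _ _ _ ?s' |- _ => match type of K with
    | context [V s' ?x] => rewrite (proj1 F x eq_refl) in K
    | context [A s' ?a ?i] => rewrite (proj2 F a eq_refl i) in K
    end
  end).

Definition row_is (M : mtt) (t : tree) (ss : list tree) (E : list form) (u : rhs) (S : st) (g : nat) : Prop :=
  forall p, p < tsize t -> (A S aVV (g * tsize t + p) <> 0 <-> gen M ss E u (sub_at t p)).

Definition row_only (t : tree) (g : nat) (S S' : st) : Prop :=
  forall x, x < g * tsize t \/ g * tsize t + tsize t <= x -> A S' aVV x = A S aVV x.

Lemma node_at (M : mtt) (s t : tree) (S : st) (i k a c : nat) (xs : list ntree) :
  Static M s t S -> at_ (nodes M s t) i (NT k a c xs) ->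
  A S aKD i = k /\ A S aSY i = a /\ A S aCI i = c /\ A S aAR i = length xs /\ A S aVB i = i * tsize t /\ A S aRB i = i * V S vW.
Proof.
  intros HS H. apply at_node in H as (H & _ & Hb). pose proof (nsize_pos (NT k a c xs)).
  assert (Hi : i < length (nodes M s t)) by lia.
  rewrite <- (st_node _ _ _ _ HS i Hi) in H. injection H as -> -> -> ->.
  repeat split; apply (st_row _ _ _ _ HS i Hi).
Qed.

Lemma child_at (L : list node) (g k a c : nat) (xs : list ntree) (j : nat) (d : ntree) :
  at_ L g (NT k a c xs) -> j < length xs -> at_ L (cpos (S g) xs j) (nth j xs d).
Proof. intros H Hj. apply at_node in H as (_ & H & _). apply forest_at_cpos; auto. Qed.

Lemma cpos_ge (i : nat) (xs : list ntree) (j : nat) : i <= cpos i xs j.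
Proof. unfold cpos; lia. Qed.

Lemma next_child (M : mtt) (s t : tree) (S : st) (g k a c : nat) (xs : list ntree) (j : nat) :
  Static M s t S -> at_ (nodes M s t) g (NT k a c xs) -> j < length xs ->
  A S aNX (cpos (Datatypes.S g) xs j) = cpos (Datatypes.S g) xs (Datatypes.S j) /\
  A S aVB (cpos (Datatypes.S g) xs j) = cpos (Datatypes.S g) xs j * tsize t.
Proof.
  intros HS H Hj. pose proof (child_at _ _ _ _ _ _ j (NT 0 0 0 []) H Hj) as Hc. split.
  - rewrite (st_next _ _ _ _ HS _ _ Hc). symmetry. now apply cpos_S.
  - destruct (nth j xs (NT 0 0 0 [])) as [k' a' c' ys]. apply (node_at _ _ _ _ _ _ _ _ _ HS Hc).
Qed.

Lemma sub_at_bound (t : tree) (p : nat) : p < tsize t -> p + tsize (sub_at t p) <= tsize t.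
Proof.
  intros Hp. assert (H : at_ (flat (nt_tree t)) 0 (nt_tree t)).
  { exists [], []. split; auto. simpl. now rewrite !app_nil_r. }
  apply at_nth with (p := p) (d := nt_tree t) in H; [|now rewrite nsize_tree].
  rewrite nsubs_tree, map_nth in H. apply at_bound in H. rewrite nsize_tree in H.
  fold (nsize (nt_tree t)) in H. rewrite nsize_tree in H. exact H.
Qed.

(** Both sides are trees that start at the same position of the preorder listing of [t], so unique
    decoding identifies them. *)
Lemma child_sub (t : tree) (p a : nat) (ts : list tree) (j : nat) :
  p < tsize t -> sub_at t p = Node a ts -> j < length ts ->
  cpos (S p) (map nt_tree ts) j < tsize t /\ sub_at t (cpos (S p) (map nt_tree ts) j) = nth j ts t.
Proof.
  intros Hp Ep Hj. pose proof (sub_at_bound t p Hp) as Hb. rewrite Ep in Hb.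
  assert (Hj' : j < length (map nt_tree ts)) by now rewrite length_map.
  assert (Hlt : cpos (S p) (map nt_tree ts) j < tsize t).
  { pose proof (cpos_bound (S p) (map nt_tree ts) j (nt_tree t) Hj') as Hc.
    pose proof (nsize_pos (nth j (map nt_tree ts) (nt_tree t))).
    rewrite <- nsize_tree in Hb. unfold nsize in Hb. simpl in Hb. lia. }
  split; auto.
  assert (H : at_ (flat (nt_tree t)) 0 (nt_tree t)).
  { exists [], []. split; auto. simpl. now rewrite !app_nil_r. }
  assert (Hat : forall p, p < tsize t -> at_ (flat (nt_tree t)) p (nt_tree (sub_at t p))).
  { intros q Hq. apply at_nth with (p := q) (d := nt_tree t) in H; [|now rewrite nsize_tree].
    rewrite nsubs_tree, map_nth in H. auto. }
  apply nt_tree_inj. eapply at_unique; [apply Hat; auto|].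
  pose proof (Hat p Hp) as Hp'. rewrite Ep in Hp'. simpl in Hp'.
  apply child_at with (j := j) (d := nt_tree t) in Hp'; auto. now rewrite map_nth in Hp'.
Qed.

Lemma eval_out_ok (M : mtt) (s t : tree) (S : st) (ss : list tree) (E : list form) (g d : nat) (us : list rhs) :
  wf_mtt M -> wf_tree (outp M) t -> Static M s t S -> V S 51 = g ->
  at_ (nodes M s t) g (nt_rhs (ROut d us)) -> In (d, length us) (outp M) ->
  (forall j, j < length us -> row_is M t ss E (nth j us (RPar 0)) S (cpos (Datatypes.S g) (map nt_rhs us) j)) ->
  tri eval_out S (20 * (tsize t * (1 + length us))) (fun S' => row_is M t ss E (ROut d us) S' g /\ row_only t g S S').
Proof.
  intros HM Ht HS Hg Hat Hd Hch. set (n := tsize t) in *.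
  assert (Hn : 1 <= n) by apply tsize_pos.
  simpl in Hat. destruct (node_at _ _ _ _ _ _ _ _ _ HS Hat) as (_ & NS & _ & NA & NV & _). rewrite length_map in NA.
  eapply tri_for with (n := n) (f := fun _ => 10 + 5 * length us)
    (Inv := fun p S' => (forall p', p' < p -> (A S' aVV (g * n + p') <> 0 <-> gen M ss E (ROut d us) (sub_at t p'))) /\ row_only t g S S').
  - reflexivity.
  - vs. apply (st_n _ _ _ _ HS).
  - split; [intros; lia|]. intros x _. reflexivity.
  - intros p S1 Hp F1 Vp [I1 I2].
    destruct (sub_at t p) as [a ts] eqn:Ep.
    pose proof (tree_at M s t p Hp) as Hpt. rewrite Ep in Hpt. simpl in Hpt.
    destruct (node_at _ _ _ _ _ _ _ _ _ HS Hpt) as (_ & PS & _ & PA & _ & _).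
    (* The loop runs over the children of the right-hand side node. Equal output symbols have equal
       rank, so it then also runs over exactly the children of position [p]. *)
    assert (Harity : a = d -> length ts = length us).
    { intros ->. assert (W : wf_tree (outp M) (Node d ts)) by (eapply subs_wf; eauto; rewrite <- Ep; apply sub_at_In; auto).
      inversion W; subst. eapply ralph_rank_unique; eauto. apply HM. }
    apply tri_asn_seq. vs.
    eapply tri_seq with (k1 := 2) (k2 := 6 + 5 * length us) (Q1 := fun s1 => V s1 53 <> 0 <-> a = d); [|intros S2 F2 H53|lia].
    { apply tri_if; intros Hc.
      - apply tri_asn; auto. vs. split; [lia|]. intros Ead. exfalso. apply Hc. apply ev_neq. norm. rewrite Vp, Hg, PS, NS. auto.
      - apply tri_skip. vs. apply ev_neq in Hc. norm_in Hc. rewrite Vp, Hg, PS, NS in Hc. split; auto. }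
    apply tri_asn_seq. vs. apply tri_asn_seq. vs.
    eapply tri_seq with (k1 := 1 + 5 * length us) (k2 := 1)
      (Q1 := fun s1 => V s1 53 <> 0 <-> gen M ss E (ROut d us) (sub_at t p)); [|intros S3 F3 H53'|lia].
    + eapply tri_rep with (n := length us) (f := fun _ => 4)
        (Inv := fun i s1 => V s1 54 = cpos (Datatypes.S g) (map nt_rhs us) i /\ (a <> d -> V s1 53 = 0) /\
          (a = d -> V s1 55 = cpos (Datatypes.S p) (map nt_tree ts) i /\
            (V s1 53 <> 0 <-> forall j, j < i -> gen M ss E (nth j us (RPar 0)) (nth j ts t)))).
      * norm. rewrite Hg. auto.
      * norm. rewrite Hg, Vp, !Nat.add_1_r, !cpos_0. split; auto. split; [intros; lia|].
        intros Ead. split; auto. split; [intros; lia|]. intros _. apply H53; auto.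
      * intros i S3 Hi F3 (J1 & J2 & J3).
        destruct (next_child _ _ _ _ _ _ _ _ _ i HS Hat) as [NX VB]; [now rewrite length_map|].
        eapply tri_seq with (k1 := 2) (k2 := 2) (Q1 := fun s1 => (a <> d -> V s1 53 = 0) /\
          (a = d -> (V s1 53 <> 0 <-> forall j, j < Datatypes.S i -> gen M ss E (nth j us (RPar 0)) (nth j ts t)))); [|intros S4 F4 [K1 K2]|lia].
        -- assert (Hcell : a = d -> (ev (Arr aVV (cell (Var 54) (Var 55))) S3 <> 0 <-> gen M ss E (nth i us (RPar 0)) (nth i ts t))).
           { intros Ead. unfold cell. norm. rewrite J1, VB. destruct (J3 Ead) as [-> _].
             destruct (child_sub t p a ts i Hp Ep) as [Hlt Hci]; [rewrite Harity; auto|].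
             rewrite <- Hci. rewrite <- (Hch i Hi _ Hlt). rewrite I2; [tauto|].
             right. fold n. pose proof (cpos_ge (Datatypes.S g) (map nt_rhs us) i). nia. }
           apply tri_if; intros Hc; [apply tri_skip|apply tri_asn; auto]; vs; (split; [auto|]); intros Ead;
             specialize (Hcell Ead); destruct (J3 Ead) as [_ J4].
           ++ rewrite J4. split.
              ** intros H j Hj. destruct (Nat.eq_dec j i) as [->|N]; [tauto|]. apply H. lia.
              ** intros H j Hj. apply H. lia.
           ++ split; [intros; lia|]. intros H. exfalso. assert (gen M ss E (nth i us (RPar 0)) (nth i ts t)) by (apply H; lia). tauto.
        -- apply tri_asn_seq. vs. apply tri_asn; auto. vs. split; [|split].
           ++ norm. rewrite J1. auto.
           ++ auto.
           ++ intros Ead. destruct (J3 Ead) as [J5 _]. split; [|auto].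
              norm. rewrite J5. apply (next_child _ _ _ _ _ _ _ _ _ i HS Hpt).
              rewrite length_map, Harity; auto.
      * rewrite sumf_const. lia.
      * intros S3 F3 (J1 & J2 & J3). rewrite Ep, gen_out. destruct (Nat.eq_dec a d) as [Ead|Nad].
        -- destruct (J3 Ead) as [_ J4]. rewrite J4. split.
           ++ intros H. exists ts. split; [congruence|]. apply Forall2_nth with (x := RPar 0) (y := t); auto. symmetry; auto.
           ++ intros (ts' & E' & H) j Hj. injection E' as _ <-. apply (Forall2_nth_inv _ _ _ _ _ H); auto.
        -- split; [intros H; exfalso; auto|]. intros (ts' & E' & _). congruence.
    + apply tri_sto; auto. unfold cell. vs. split.
      * intros p' Hp'. norm. rewrite Hg, Vp, NV. fold n.
        destruct (Nat.eqb_spec (g * n + p') (g * n + p)) as [Epp|Npp].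
        -- replace p' with p by lia. auto.
        -- apply I1. lia.
      * intros x Hx. vs. norm. rewrite Hg, Vp, NV. fold n in Hx |- *.
        destruct (Nat.eqb_spec x (g * n + p)) as [Ex|Nx]; [lia|]. apply I2. auto.
  - rewrite sumf_const. nia.
  - intros S' F' [I1 I2]. split; auto.
Qed.

Ltac use_step H b :=
  cbv beta; match goal with |- _ /\ row_only _ _ _ ?X => eapply (H _ X b); [reflexivity| |] end.

(** The condition on [E] is what [erase] guarantees, stated in terms of the two positions that the
    machine holds; it applies for any such environment. *)
Lemma eval_par_ok (M : mtt) (s t : tree) (S : st) (ss : list tree) (E : list form) (g j : nat) :
  Static M s t S -> V S 51 = g -> at_ (nodes M s t) g (nt_rhs (RPar j)) ->
  A S aEN j < tsize t -> V S 41 < tsize t ->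
  (forall t', nth (j - 1) E (FY j) = form_of_tree t' <-> sub_at t (A S aEN j) = t' /\ t' <> sub_at t (V S 41)) ->
  tri eval_par S (20 * tsize t) (fun S' => row_is M t ss E (RPar j) S' g /\ row_only t g S S').
Proof.
  intros HS Hg Hat Hj H0 HE. set (n := tsize t) in *.
  assert (Hn : 1 <= n) by apply tsize_pos.
  simpl in Hat. destruct (node_at _ _ _ _ _ _ _ _ _ HS Hat) as (_ & NS & _ & _ & NV & _).
  eapply tri_for with (n := n) (f := fun _ => 5)
    (Inv := fun p S' => (forall p', p' < p -> (A S' aVV (g * n + p') <> 0 <-> gen M ss E (RPar j) (sub_at t p'))) /\ row_only t g S S').
  - reflexivity.
  - vs. apply (st_n _ _ _ _ HS).
  - split; [intros; lia|]. intros x _. reflexivity.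
  - intros p S1 Hp F1 Vp [I1 I2].
    apply tri_sto_seq. unfold cell. vs.
    assert (Step : forall S2 (b : bool), (forall x, A S2 aVV x = if Nat.eqb x (g * n + p) then (if b then 1 else 0) else A S1 aVV x) ->
       (b = true <-> sub_at t p = sub_at t (A S aEN j) /\ sub_at t p <> sub_at t (V S 41)) ->
       (forall p', p' < Datatypes.S p -> (A S2 aVV (g * n + p') <> 0 <-> gen M ss E (RPar j) (sub_at t p'))) /\ row_only t g S S2).
    { intros S2 b HA Hb. split.
      - intros p' Hp'. rewrite HA. destruct (Nat.eqb_spec (g * n + p') (g * n + p)) as [Epp|Npp].
        + replace p' with p by lia. rewrite gen_par, HE. destruct b; [|split; [lia|]].
          * split; [|lia]. intros _. destruct Hb as [Hb _]. specialize (Hb eq_refl). split; [symmetry|]; apply Hb.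
          * intros [G1 G2]. assert (false = true) by (apply Hb; auto). discriminate.
        + apply I1. lia.
      - intros x Hx. fold n in Hx. rewrite HA. destruct (Nat.eqb_spec x (g * n + p)); [lia|]. apply I2. auto. }
    assert (Step' : forall S2 S3 (b : bool), S3 = setv S2 52 (Datatypes.S p) ->
       (forall x, A S2 aVV x = if Nat.eqb x (g * n + p) then (if b then 1 else 0) else A S1 aVV x) ->
       (b = true <-> sub_at t p = sub_at t (A S aEN j) /\ sub_at t p <> sub_at t (V S 41)) ->
       (forall p', p' < Datatypes.S p -> (A S3 aVV (g * n + p') <> 0 <-> gen M ss E (RPar j) (sub_at t p'))) /\ row_only t g S S3).
    { intros S2 S3 b -> G1 G2. exact (Step S2 b G1 G2). }
    apply tri_if; intros Hc1.
    + apply tri_skip. use_step Step' false.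
      * intros x. norm. rewrite Hg, Vp, NV. auto.
      * split; [discriminate|]. intros [G _]. exfalso. apply Hc1. apply ev_neq. norm.
        rewrite Hg, Vp, NS. apply (st_canon _ _ _ _ HS); auto.
    + apply ev_neq in Hc1. norm_in Hc1. rewrite Hg, Vp, NS in Hc1.
      apply (st_canon _ _ _ _ HS) in Hc1; auto.
      eapply tri_conseq with (k := 2); [|lia|intros ? _ HQ0; exact HQ0].
      apply tri_if; intros Hc2.
      * apply tri_sto; auto. use_step Step' true.
        -- intros x. norm. rewrite Hg, Vp, NV. fold n. destruct (Nat.eqb x (g * n + p)); auto.
        -- split; auto. intros _. split; auto. intros G. apply Hc2. apply ev_neq. norm. rewrite Vp.
           apply (st_canon _ _ _ _ HS); auto.
      * apply tri_skip. use_step Step' false.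
        -- intros x. norm. rewrite Hg, Vp, NV. auto.
        -- split; [discriminate|]. intros [_ G]. exfalso. apply ev_neq in Hc2. norm_in Hc2. rewrite Vp in Hc2.
           apply G. apply (st_canon _ _ _ _ HS); auto.
  - rewrite sumf_const. nia.
  - intros S' F' [I1 I2]. split; auto.
Qed.

Lemma all_lt_S (P : nat -> Prop) (j : nat) : (forall j', j' < S j -> P j') <-> (forall j', j' < j -> P j') /\ P j.
Proof.
  split.
  - intros H. split; intros; apply H; lia.
  - intros [H1 H2] j' H. destruct (Nat.eq_dec j' j) as [->|N]; auto. apply H1. lia.
Qed.

Lemma ex_lt_S (P : nat -> Prop) (j : nat) : (exists j', j' < S j /\ P j') <-> (exists j', j' < j /\ P j') \/ P j.
Proof.
  split.
  - intros (j' & H & HP). destruct (Nat.eq_dec j' j) as [->|N]; auto. left. exists j'. split; auto. lia.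
  - intros [(j' & H & HP)|HP]; [exists j'; split; auto; lia|exists j; split; auto; lia].
Qed.

(** The part of a block that the evaluation of a call reads. The productivity bit is missing because
    it is tested beforehand, for all calls of a right-hand side at once. *)
Definition callee_ok (M : mtt) (t : tree) (v : tree) (q k : nat) (S : st) (b : nat) : Prop :=
  (forall l, 1 <= l <= k -> (A S aF (b + l) <> 0 <-> call_proj M v q l)) /\
  (forall c, c < tsize t ^ (k + 1) ->
    (A S aF (b + k + (1 + c)) <> 0 <-> call_fact M v q (sub_at t (dig (tsize t) c 0)) (digit_trees t c k))).

(* The tuple of positions coded by [c] witnesses that the call generates the tree at its 0-th digit. *)
Definition tuple_ok (M : mtt) (t v : tree) (ss : list tree) (E : list form) (q : nat) (us : list rhs) (c : nat) : Prop :=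
  let d j := sub_at t (dig (tsize t) c j) in
  call_fact M v q (d 0) (digit_trees t c (length us)) /\
    (forall j, j < length us -> d (S j) = d 0 \/ gen M ss E (nth j us (RPar 0)) (d (S j))) \/
  exists j, j < length us /\ d (S j) = d 0 /\ gen M ss E (nth j us (RPar 0)) (d (S j)) /\ call_proj M v q (S j).

Lemma eval_call_fact_ok (M : mtt) (s t v : tree) (S : st) (ss : list tree) (E : list form) (g q i c : nat) (us : list rhs) :
  Static M s t S -> V S 51 = g -> V S 56 = c ->
  at_ (nodes M s t) g (nt_rhs (RCall q i us)) -> length us <= V S vMX -> c < tsize t ^ (length us + 1) ->
  callee_ok M t v q (length us) S (A S aCB g) ->
  (forall j, j < length us -> row_is M t ss E (nth j us (RPar 0)) S (cpos (Datatypes.S g) (map nt_rhs us) j)) ->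
  tri eval_call_fact S (20 + 10 * length us) (fun S' =>
    tuple_ok M t v ss E q us c /\
      (forall x, A S' aVV x = if Nat.eqb x (g * tsize t + dig (tsize t) c 0) then 1 else A S aVV x) \/
    ~ tuple_ok M t v ss E q us c /\ (forall x, A S' aVV x = A S aVV x)).
Proof.
  intros HS Hg Hc Hat Hk Hck [Hproj Hfact] Hch. set (n := tsize t) in *. set (k := length us) in *.
  assert (Hn : 1 <= n) by apply tsize_pos.
  simpl in Hat. destruct (node_at _ _ _ _ _ _ _ _ _ HS Hat) as (_ & NS & _ & NA & NV & _). rewrite length_map in NA. fold k in NA.
  assert (HDM : forall j, A S aMO (c / n ^ j) = dig n c j /\ A S aDI (c / n ^ j) = c / n ^ Datatypes.S j).
  { intros j. rewrite <- div_pow_S. apply (st_divmod _ _ _ _ HS). fold n.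
    pose proof (div_le_self c (n ^ j)). assert (n ^ (k + 1) <= n ^ (V S vMX + 1)) by (apply Nat.pow_le_mono_r; lia). lia. }
  assert (HDM0 := HDM 0). rewrite Nat.pow_0_r, Nat.div_1_r in HDM0. destruct HDM0 as [HM0 HD0].
  assert (Hd : forall j, dig n c j < n) by (intros; apply dig_lt; lia).
  specialize (Hfact c Hck).
  do 6 (apply tri_asn_seq; vs).
  eapply tri_seq with (k1 := 1 + 9 * k) (k2 := 2) (Q1 := fun s1 => V s1 59 + V s1 60 <> 0 <-> tuple_ok M t v ss E q us c); [| |lia].
  - eapply tri_rep with (n := k) (f := fun _ => 8)
      (Inv := fun i s1 => V s1 58 = c / n ^ Datatypes.S i /\ V s1 54 = cpos (Datatypes.S g) (map nt_rhs us) i /\ V s1 61 = Datatypes.S i /\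
        (V s1 59 <> 0 <-> call_fact M v q (sub_at t (dig n c 0)) (digit_trees t c k) /\
           forall j, j < i -> sub_at t (dig n c (Datatypes.S j)) = sub_at t (dig n c 0) \/
              gen M ss E (nth j us (RPar 0)) (sub_at t (dig n c (Datatypes.S j)))) /\
        (V s1 60 <> 0 <-> exists j, j < i /\ sub_at t (dig n c (Datatypes.S j)) = sub_at t (dig n c 0) /\
              gen M ss E (nth j us (RPar 0)) (sub_at t (dig n c (Datatypes.S j))) /\ call_proj M v q (Datatypes.S j))).
    + norm. rewrite Hg. auto.
    + norm. rewrite Hg, Hc, NA, HD0, Nat.add_1_r, cpos_0. split; auto. split; auto. split; auto. split.
      * rewrite Hfact. split; [intros H; split; auto; intros; lia|tauto].
      * split; [lia|]. intros (j & Hj & _). lia.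
    + intros j S1 Hj F1 (J1 & J2 & J3 & J4 & J5).
      destruct (next_child _ _ _ _ _ _ _ _ _ j HS Hat) as [NX VB]; [now rewrite length_map|].
      do 2 (apply tri_asn_seq; vs).
      eapply tri_seq with (k1 := 4) (k2 := 2) (Q1 := fun s1 =>
        (V s1 59 <> 0 <-> call_fact M v q (sub_at t (dig n c 0)) (digit_trees t c k) /\
           forall j', j' < Datatypes.S j -> sub_at t (dig n c (Datatypes.S j')) = sub_at t (dig n c 0) \/
              gen M ss E (nth j' us (RPar 0)) (sub_at t (dig n c (Datatypes.S j')))) /\
        (V s1 60 <> 0 <-> exists j', j' < Datatypes.S j /\ sub_at t (dig n c (Datatypes.S j')) = sub_at t (dig n c 0) /\
              gen M ss E (nth j' us (RPar 0)) (sub_at t (dig n c (Datatypes.S j'))) /\ call_proj M v q (Datatypes.S j')));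
        [|intros S2 F2 [K1 K2]|lia].
      * assert (Hcell : forall S2, V S2 54 = V S1 54 -> V S2 62 = dig n c (Datatypes.S j) -> A S2 = A S1 ->
          (ev (Arr aVV (cell (Var 54) (Var 62))) S2 <> 0 <-> gen M ss E (nth j us (RPar 0)) (sub_at t (dig n c (Datatypes.S j))))).
        { intros S2 E1 E2 E3. unfold cell. cbn [ev]. rewrite E1, E2, E3. norm. rewrite J2, VB. apply Hch; auto. }
        assert (Hcan : A S aCA (dig n c (Datatypes.S j)) = A S aCA (dig n c 0) <->
           sub_at t (dig n c (Datatypes.S j)) = sub_at t (dig n c 0)) by (apply (st_canon _ _ _ _ HS); apply Hd).
        destruct (HDM (Datatypes.S j)) as [HMj HDj].
        remember {| V := upd (upd (V S1) 62 (A S1 aMO (V S1 58))) 58 (A S1 aDI (V S1 58)); A := A S1 |} as S2 eqn:ES2.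
        assert (E59 : V S2 59 = V S1 59) by (rewrite ES2; reflexivity).
        assert (E60 : V S2 60 = V S1 60) by (rewrite ES2; reflexivity).
        assert (E62 : V S2 62 = dig n c (Datatypes.S j)) by (rewrite ES2; norm; rewrite J1; auto).
        assert (Hcell2 : ev (Arr aVV (cell (Var 54) (Var 62))) S2 <> 0 <-> gen M ss E (nth j us (RPar 0)) (sub_at t (dig n c (Datatypes.S j)))).
        { apply Hcell; auto; rewrite ES2; reflexivity. }
        assert (Hcan2 : ev (neq (Arr aCA (Var 62)) (Arr aCA (Var 57))) S2 = 0 <-> sub_at t (dig n c (Datatypes.S j)) = sub_at t (dig n c 0)).
        { rewrite ev_neq. cbn [ev]. rewrite E62, <- Hcan, ES2. norm. rewrite Hc, HM0. tauto. }
        assert (Hpr : ev (Arr aF (Add (Arr aCB (Var 51)) (Var 61))) S2 <> 0 <-> call_proj M v q (Datatypes.S j)).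
        { rewrite ES2. norm. rewrite Hg, J3. apply Hproj. lia. }
        assert (Goal : forall S3, (V S3 59 <> 0 <-> V S2 59 <> 0 /\ (sub_at t (dig n c (Datatypes.S j)) = sub_at t (dig n c 0) \/
              gen M ss E (nth j us (RPar 0)) (sub_at t (dig n c (Datatypes.S j))))) ->
           (V S3 60 <> 0 <-> V S2 60 <> 0 \/ sub_at t (dig n c (Datatypes.S j)) = sub_at t (dig n c 0) /\
              gen M ss E (nth j us (RPar 0)) (sub_at t (dig n c (Datatypes.S j))) /\ call_proj M v q (Datatypes.S j)) ->
           (V S3 59 <> 0 <-> call_fact M v q (sub_at t (dig n c 0)) (digit_trees t c k) /\
           forall j', j' < Datatypes.S j -> sub_at t (dig n c (Datatypes.S j')) = sub_at t (dig n c 0) \/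
              gen M ss E (nth j' us (RPar 0)) (sub_at t (dig n c (Datatypes.S j')))) /\
           (V S3 60 <> 0 <-> exists j', j' < Datatypes.S j /\ sub_at t (dig n c (Datatypes.S j')) = sub_at t (dig n c 0) /\
              gen M ss E (nth j' us (RPar 0)) (sub_at t (dig n c (Datatypes.S j'))) /\ call_proj M v q (Datatypes.S j'))).
        { intros S3 G1 G2. rewrite G1, G2, all_lt_S, ex_lt_S, E59, E60, J4, J5. split; [apply and_assoc|reflexivity]. }
        clear J4 J5 ES2 Hcell Hcan E59 E60 E62 Hproj Hfact Hch Hat Hd HDM HMj HDj HM0 HD0.
        (* Only three atoms matter from here on: whether the argument generates its digit, whether
           the digit denotes the target, and whether the callee returns this argument. Abstracted,
           every branch is propositional. *)
        revert Hcell2 Hcan2 Hpr Goal.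
        generalize (gen M ss E (nth j us (RPar 0)) (sub_at t (dig n c (Datatypes.S j)))) as G.
        generalize (sub_at t (dig n c (Datatypes.S j)) = sub_at t (dig n c 0)) as D.
        generalize (call_proj M v q (Datatypes.S j)) as Pr. intros Pr D G Hcell2 Hcan2 Hpr Goal.
        apply tri_if; intros Hc1.
        -- apply Hcell2 in Hc1. eapply tri_conseq with (k := 3); [|lia|intros ? _ HQ0; exact HQ0].
           apply tri_if; intros Hc2.
           ++ apply tri_skip. assert (~ D) by tauto. apply Goal; tauto.
           ++ apply Hcan2 in Hc2. apply tri_if; intros Hc3.
              ** apply Hpr in Hc3. apply tri_asn; auto. apply Goal; vs; try tauto. split; auto.
              ** apply tri_skip. assert (~ Pr) by tauto. apply Goal; tauto.
        -- assert (~ G) by tauto.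
           eapply tri_conseq with (k := 2); [|lia|intros ? _ HQ0; exact HQ0].
           apply tri_if; intros Hc2.
           ++ assert (~ D) by tauto.
              apply tri_asn; auto. apply Goal; vs; tauto.
           ++ apply Hcan2 in Hc2. apply tri_skip. apply Goal; tauto.
      * apply tri_asn_seq. vs. apply tri_asn; auto. vs. split; [|split; [|split]]; auto.
        -- norm. rewrite J1. apply HDM.
        -- norm. rewrite J2. auto.
        -- norm. rewrite J3. lia.
    + rewrite sumf_const. lia.
    + intros S1 F1 (J1 & J2 & J3 & J4 & J5). unfold tuple_ok. fold n k. rewrite <- J4, <- J5. lia.
  - intros S1 F1 H1. eapply tri_conseq with (k := 2); [|lia|intros ? _ HQ0; exact HQ0].
    apply tri_if; cbn [ev]; intros H; [apply tri_sto|apply tri_skip]; auto.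
    + left. split; [tauto|]. intros x. unfold cell. norm. rewrite Hg, Hc, NV, HM0. auto.
    + right. split; [intros Hn'; apply H1 in Hn'; auto|]. intros x. norm. auto.
Qed.

(** Carries the analysis of calls from tuples of trees over to numeric codes, so that one loop over
    all codes is exhaustive. Subtrees of the target are subtrees of [t] and thus have positions. *)
Lemma gen_call_tuple (M : mtt) (ss : list tree) (E : list form) (t : tree) (q i m p : nat) (us : list rhs) :
  wf_mtt M -> wf_rhs M (length ss) m (RCall q i us) -> Forall (wf_tree (inp M)) ss -> Forall (productive M ss) us ->
  p < tsize t ->
  (gen M ss E (RCall q i us) (sub_at t p) <->
   exists c, c < tsize t ^ (length us + 1) /\ dig (tsize t) c 0 = p /\ tuple_ok M t (nth (i - 1) ss (Node 0 [])) ss E q us c).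
Proof.
  intros HM Hw Hss Hpr Hp. split.
  - intros H. eapply gen_call_inv in H; eauto. destruct H as [(ts & Hl & Hf & Hsub & Hg)|(j & Hj & Hpj & Hg)].
    + assert (exists pl, length pl = length us /\ Forall (fun d => d < tsize t) pl /\ map (sub_at t) pl = ts) as (pl & Lpl & Hpl & Epl).
      { rewrite <- Hl. clear - Hsub Hp. induction Hsub as [|x ts Hx _ (pl & L & H & Em)]; [exists []; auto|].
        destruct (In_sub_at t x) as (p' & Hp' & <-).
        { eapply subs_trans; eauto. apply sub_at_In; auto. }
        exists (p' :: pl). simpl. split; [auto|]. split; [auto|]. congruence. }
      destruct (digits_exist (tsize t) (p :: pl)) as (c & Hc & Hd); [auto|].
      cbn [length] in Hc, Hd. rewrite Lpl in *.
      exists c. rewrite Nat.add_1_r. split; auto. split; [apply (Hd 0); lia|]. left.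
      assert (Ets : digit_trees t c (length us) = ts).
      { apply nth_ext with (d := t) (d' := t); [now rewrite length_digit_trees|].
        rewrite length_digit_trees. intros j Hj. rewrite nth_digit_trees by auto. rewrite Hd by lia.
        cbn [nth]. rewrite <- Epl. symmetry. apply nth_map_gen. lia. }
      rewrite Ets, (Hd 0) by lia. cbn [nth]. split; auto.
      intros j Hj. specialize (Hg j Hj). rewrite <- Ets in Hg. rewrite nth_digit_trees in Hg by auto. auto.
    (* In the projection case only the digit of the returned argument matters; filling the whole
       code with [p] is a convenient choice. *)
    + destruct (digits_exist (tsize t) (repeat p (length us + 1))) as (c & Hc & Hd).
      { apply Forall_forall. intros x Hx. apply repeat_spec in Hx. lia. }
      rewrite repeat_length in *.
      assert (Hd' : forall l, l <= length us -> dig (tsize t) c l = p).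
      { intros l Hl. rewrite Hd by lia. apply nth_repeat_lt. lia. }
      exists c. split; auto. split; [apply Hd'; lia|]. right. exists (j - 1).
      replace (S (j - 1)) with j by lia. rewrite !Hd' by lia. split; [lia|]. auto.
  - intros (c & Hc & <- & [[Hf Hg]|(j & Hj & Ed & Hg & Hpj)]).
    + eapply gen_call; eauto; [apply length_digit_trees|]. intros j Hj.
      rewrite nth_digit_trees by auto. auto.
    + eapply gen_call_proj with (j := S j); eauto; [lia|]. simpl. rewrite Nat.sub_0_r, <- Ed. auto.
Qed.

Lemma cell_row (n g g' p : nat) : p < n -> g < g' -> g * n + n <= g' * n + p.
Proof. nia. Qed.

(** The row may hold bits of an earlier evaluation, so it is cleared first; this costs a multiple of
    n, which is at most n^(k+1). Then each of the n^(k+1) codes costs O(k + 1). *)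
Lemma eval_call_ok (M : mtt) (s t : tree) (S : st) (ss : list tree) (E : list form) (g q i m : nat) (us : list rhs) :
  wf_mtt M -> wf_rhs M (length ss) m (RCall q i us) -> Forall (wf_tree (inp M)) ss -> Forall (productive M ss) us ->
  Static M s t S -> V S 51 = g ->
  at_ (nodes M s t) g (nt_rhs (RCall q i us)) -> length us <= V S vMX ->
  callee_ok M t (nth (i - 1) ss (Node 0 [])) q (length us) S (A S aCB g) ->
  (forall j, j < length us -> row_is M t ss E (nth j us (RPar 0)) S (cpos (Datatypes.S g) (map nt_rhs us) j)) ->
  tri eval_call S (40 * (tsize t ^ (length us + 1) * (1 + length us))) (fun S' =>
    row_is M t ss E (RCall q i us) S' g /\ row_only t g S S').
Proof.
  intros HM Hw Hss Hpr HS Hg Hat Hk Hcal Hch. set (n := tsize t) in *. set (k := length us) in *.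
  assert (Hn : 1 <= n) by apply tsize_pos.
  assert (Hat' := Hat). simpl in Hat'.
  destruct (node_at _ _ _ _ _ _ _ _ _ HS Hat') as (_ & NS & _ & NA & NV & _). rewrite length_map in NA. fold k in NA.
  assert (Hpow : n <= n ^ (k + 1)).
  { rewrite Nat.add_1_r, Nat.pow_succ_r'. pose proof (Nat.pow_nonzero n k). nia. }
  eapply tri_seq with (k1 := 2 + 3 * n) (k2 := 2 + n ^ (k + 1) * (22 + 10 * k))
    (Q1 := fun S1 => (forall p, p < n -> A S1 aVV (g * n + p) = 0) /\ row_only t g S S1); [| |nia].
  - eapply tri_for with (n := n) (f := fun _ => 1)
      (Inv := fun p S' => (forall p', p' < p -> A S' aVV (g * n + p') = 0) /\ row_only t g S S').
    + reflexivity.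
    + vs. apply (st_n _ _ _ _ HS).
    + split; [intros; lia|]. intros x _. reflexivity.
    + intros p S1 Hp F1 Vp [I1 I2]. apply tri_sto; auto. unfold cell. split.
      * intros p' Hp'. norm. rewrite Vp, Hg, NV. fold n.
        destruct (Nat.eqb_spec (g * n + p') (g * n + p)); auto. apply I1. lia.
      * intros x Hx. norm. rewrite Vp, Hg, NV. fold n in Hx |- *.
        destruct (Nat.eqb_spec x (g * n + p)); [lia|]. apply I2; auto.
    + rewrite sumf_const. lia.
    + auto.
  - intros S1 F1 [I1 I2].
    assert (HS1 : Static M s t S1) by (eapply static_frame; eauto).
    assert (Hrow1 : forall S2 j, row_only t g S S2 -> j < k -> row_is M t ss E (nth j us (RPar 0)) S2 (cpos (Datatypes.S g) (map nt_rhs us) j)).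
    { intros S2 j HR Hj p Hp. rewrite <- (Hch j Hj p Hp). rewrite HR; [tauto|]. right.
      apply cell_row; auto. pose proof (cpos_ge (Datatypes.S g) (map nt_rhs us) j). lia. }
    eapply tri_for with (n := n ^ (k + 1)) (f := fun _ => 20 + 10 * k)
      (Inv := fun c S' => (forall p, p < n -> (A S' aVV (g * n + p) <> 0 <->
          exists c', c' < c /\ dig n c' 0 = p /\ tuple_ok M t (nth (i - 1) ss (Node 0 [])) ss E q us c')) /\ row_only t g S S').
    + reflexivity.
    + norm. rewrite Hg, NA. apply (st_pow _ _ _ _ HS). lia.
    + split; auto. intros p Hp. vs. rewrite I1 by auto. split; [lia|]. intros (c' & Hc' & _). lia.
    + intros c S2 Hc F2 Vc [J1 J2].
      assert (HS2 : Static M s t S2) by (eapply static_frame; [exact F2|reflexivity|reflexivity|auto]).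
      eapply tri_conseq; [eapply eval_call_fact_ok with (g := g) (c := c); eauto| |].
      * norm. auto.
      * norm. auto.
      * destruct Hcal as [C1 C2]. split; intros; norm; auto.
      * fold k. lia.
      * intros S3 F3 HS3. cbv beta in HS3. fold n in HS3. split.
        -- intros p Hp. vs. rewrite ex_lt_S. destruct HS3 as [[HT HA]|[HT HA]]; rewrite HA.
           ++ destruct (Nat.eqb_spec (g * n + p) (g * n + dig n c 0)) as [Ep|Np].
              ** split; [|lia]. intros _. right. split; auto. lia.
              ** rewrite J1 by auto. split; [auto|]. intros [H|[H _]]; auto. subst p. lia.
           ++ rewrite J1 by auto. split; [auto|]. intros [H|[_ H]]; auto. contradiction.
        -- intros x Hx. vs. fold n in Hx. destruct HS3 as [[HT HA]|[HT HA]]; rewrite HA; auto.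
           assert (dig n c 0 < n) by (apply dig_lt; lia).
           destruct (Nat.eqb_spec x (g * n + dig n c 0)); [lia|]. auto.
    + rewrite sumf_const. nia.
    + intros S2 F2 [J1 J2]. split; auto. intros p Hp. fold n. rewrite J1 by auto.
      rewrite (gen_call_tuple M ss E t q i m p us) by auto. fold n k. tauto.
Qed.

Lemma sub_bound (L : list node) (i g : nat) (x y : ntree) :
  at_ L i x -> i <= g < i + nsize x -> at_ L g y -> g + nsize y <= i + nsize x.
Proof.
  intros Hx Hg Hy.
  assert (E : nth (g - i) (nsubs x) x = y).
  { apply at_nth with (p := g - i) (d := x) in Hx; [|lia]. replace (i + (g - i)) with g in Hx by lia.
    eapply at_unique; eauto. }
  assert (H : at_ (flat x) 0 x).
  { exists [], []. split; auto. simpl. now rewrite !app_nil_r. }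
  apply at_nth with (p := g - i) (d := x) in H; [|lia]. rewrite E in H. apply at_bound in H.
  unfold nsize in *. lia.
Qed.

Lemma tri_is_kind (g : exp) (k : nat) (c d : cmd) (s : st) (n : nat) (Q : st -> Prop) :
  (A s aKD (ev g s) = k -> tri c s n Q) -> (A s aKD (ev g s) <> k -> tri d s n Q) -> tri (is_kind g k c d) s (S n) Q.
Proof.
  intros H1 H2. unfold is_kind. apply tri_if; intros H.
  - apply H2. intros E. apply H. apply ev_neq. exact E.
  - apply H1. apply ev_neq in H. exact H.
Qed.

Lemma rhs_in (L : list node) (root g : nat) (r u : rhs) :
  at_ L root (nt_rhs r) -> root <= g < root + rsize r -> at_ L g (nt_rhs u) -> In u (rsubs r).
Proof.
  intros Hr Hg Hu. destruct (rhs_at L root r (g - root) Hr) as (u' & Hin & Hu'); [lia|].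
  replace (root + (g - root)) with g in Hu' by lia.
  assert (u = u') by (apply nt_rhs_inj; eapply at_unique; eauto). congruence.
Qed.

Lemma child_in (L : list node) (root g k a c j : nat) (r : rhs) (us : list rhs) :
  at_ L root (nt_rhs r) -> root <= g < root + rsize r -> at_ L g (NT k a c (map nt_rhs us)) -> j < length us ->
  at_ L (cpos (S g) (map nt_rhs us) j) (nt_rhs (nth j us (RPar 0))) /\
  g < cpos (S g) (map nt_rhs us) j < root + rsize r.
Proof.
  intros Hr Hg Hu Hj.
  assert (Hj' : j < length (map nt_rhs us)) by now rewrite length_map.
  pose proof (child_at _ _ _ _ _ _ j (nt_rhs (RPar 0)) Hu Hj') as Hc.
  pose proof (cpos_bound (S g) (map nt_rhs us) j (nt_rhs (RPar 0)) Hj') as Hb.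
  pose proof (nsize_pos (nth j (map nt_rhs us) (nt_rhs (RPar 0)))).
  pose proof (cpos_ge (S g) (map nt_rhs us) j).
  rewrite <- nsize_rhs in *. pose proof (sub_bound _ _ _ _ _ Hr Hg Hu) as Hs. unfold nsize in Hs at 1. simpl in Hs.
  rewrite map_nth in Hc. split; auto. lia.
Qed.

(** Everything one evaluation of a right-hand side relies on. [ec_prod] makes all its arguments
    productive; [ec_env] ties the abstract environment to the positions in [aEN] with the target
    erased. *)
Record EvalCtx (M : mtt) (s t : tree) (ss : list tree) (E : list form) (r : rhs) (m root : nat) (S : st) : Prop := {
  ec_static : Static M s t S;
  ec_root : V S 25 = root;
  ec_size : V S 26 = rsize r;
  ec_at : at_ (nodes M s t) root (nt_rhs r);
  ec_wf : wf_rhs M (length ss) m r;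
  ec_ss : Forall (wf_tree (inp M)) ss;
  ec_prod : productive M ss r;
  ec_callee : forall g q i us, root <= g < root + rsize r -> at_ (nodes M s t) g (nt_rhs (RCall q i us)) ->
    callee_ok M t (nth (i - 1) ss (Node 0 [])) q (length us) S (A S aCB g);
  ec_target : V S 41 < tsize t;
  ec_par : forall j, 1 <= j <= m -> A S aEN j < tsize t;
  ec_env : forall j t', 1 <= j <= m ->
    (nth (j - 1) E (FY j) = form_of_tree t' <-> sub_at t (A S aEN j) = t' /\ t' <> sub_at t (V S 41))
}.

Lemma EvalCtx_frame (M : mtt) (s t : tree) (ss : list tree) (E : list form) (r : rhs) (m root : nat) (S S' : st) (vs bs : list nat) :
  frame vs bs S S' -> disjoint_b (static_vars ++ [25; 26; 41]) vs = true ->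
  disjoint_b (static_arrs ++ [17; 19; 21]) bs = true ->
  EvalCtx M s t ss E r m root S -> EvalCtx M s t ss E r m root S'.
Proof.
  intros F D1 D2 []. assert (F0 := F). destruct F as [F1 F2].
  assert (HV : forall x, memb x (static_vars ++ [25; 26; 41]) = true -> V S' x = V S x).
  { intros x Hx. apply F1. eapply disjoint_b_memb; eauto. }
  assert (HA : forall a, memb a (static_arrs ++ [17; 19; 21]) = true -> forall i, A S' a i = A S a i).
  { intros x Hx. apply F2. eapply disjoint_b_memb; eauto. }
  constructor; intros; rewrite ?(HV 25), ?(HV 26), ?(HV 41), ?(HA 19), ?(HA 21) by reflexivity; auto.
  - eapply static_frame; eauto.
    + unfold disjoint_b in *. rewrite forallb_app in D1. apply andb_prop in D1. tauto.
    + unfold disjoint_b in *. rewrite forallb_app in D2. apply andb_prop in D2. tauto.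
  - destruct (ec_callee0 g q i us H H0) as [C1 C2]. split; intros; rewrite (HA 17) by reflexivity; auto.
Qed.

Lemma call_arity (M : mtt) (s t : tree) (S : st) (g q i : nat) (us : list rhs) :
  Static M s t S -> at_ (nodes M s t) g (nt_rhs (RCall q i us)) -> length us <= V S vMX.
Proof.
  intros HS H. simpl in H. apply at_node in H as [H _]. pose proof (st_arity _ _ _ _ HS g) as Ha.
  rewrite H in Ha. simpl in Ha. rewrite length_map in Ha. auto.
Qed.

Lemma eval_pass_ok (M : mtt) (s t : tree) (S : st) (ss : list tree) (E : list form) (r : rhs) (m root : nat) :
  wf_mtt M -> wf_tree (outp M) t -> EvalCtx M s t ss E r m root S ->
  tri eval_pass S (100 * (tsize t ^ (V S vMX + 1) * rsize r) + 2) (fun S' => row_is M t ss E r S' root).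
Proof.
  intros HM Ht HC. set (n := tsize t) in *. assert (Hn : 1 <= n) by apply tsize_pos.
  assert (Hat := ec_at _ _ _ _ _ _ _ _ _ HC). assert (HS := ec_static _ _ _ _ _ _ _ _ _ HC).
  set (X := n ^ (V S vMX + 1)).
  assert (Hpow : forall k, k <= V S vMX -> n ^ (k + 1) <= X) by (intros; apply Nat.pow_le_mono_r; lia).
  assert (HnX : n <= X) by (rewrite <- (Nat.pow_1_r n) at 1; apply Nat.pow_le_mono_r; lia).
  set (ar := fun i => narity (nth (root + i) (nodes M s t) node0)).
  (* A call with k arguments costs at most 40 X (k + 1), and the other kinds of nodes cost less; 4 X
     more covers the overhead. The arities add up to [rsize r - 1]. *)
  assert (Hsum : sumf (rsize r) (fun i => 44 * X + 40 * X * ar i) <= 84 * X * rsize r).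
  { rewrite sumf_add, sumf_const, sumf_mul. pose proof (at_arity_sum _ _ _ Hat) as Ha. rewrite nsize_rhs in Ha. fold ar in Ha. nia. }
  assert (1 <= X) by lia.
  eapply tri_down with (n := rsize r) (f := fun i => 44 * X + 40 * X * ar i)
    (Inv := fun i S' => forall g u, root + i <= g < root + rsize r -> at_ (nodes M s t) g (nt_rhs u) -> row_is M t ss E u S' g).
  - reflexivity.
  - intros i s0 v H0 g u Hg Hu. apply (H0 g u Hg Hu).
  - apply (ec_size _ _ _ _ _ _ _ _ _ HC).
  - intros; lia.
  - intros i S1 Hi F1 Vi I1.
    destruct (rhs_at _ _ _ i Hat Hi) as (u & Hu & Hat').
    assert (HC1 : EvalCtx M s t ss E r m root S1) by (eapply EvalCtx_frame; eauto).
    assert (HS1 := ec_static _ _ _ _ _ _ _ _ _ HC1).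
    apply tri_conseq with (k := Datatypes.S (Datatypes.S (Datatypes.S (41 * X + 40 * X * ar i - 0)))) (Q := fun S' => row_is M t ss E u S' (root + i) /\ row_only t (root + i) S1 S').
    2: lia.
    2:{ intros S2 F2 [R1 R2] g u' Hg Hu'. destruct (Nat.eq_dec g (root + i)) as [->|N].
      - replace u' with u; auto. apply nt_rhs_inj. eapply at_unique; eauto.
      - intros p Hp. assert (Hg' : root + Datatypes.S i <= g < root + rsize r) by lia. rewrite <- (I1 g u' Hg' Hu' p Hp). rewrite R2; [tauto|]. right. apply cell_row; auto. lia. }
    apply tri_asn_seq. vs.
    assert (HC2 : EvalCtx M s t ss E r m root {| V := upd (V S1) 51 (V S1 25 + V S1 50); A := A S1 |}).
    { eapply EvalCtx_frame with (vs := [51]) (bs := []); [|reflexivity|reflexivity|exact HC1].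
      split; auto. intros x Hx. simpl in *. unfold upd. destruct (Nat.eqb x 51); auto; discriminate. }
    assert (E51 : V S1 25 + V S1 50 = root + i) by (rewrite Vi, (ec_root _ _ _ _ _ _ _ _ _ HC1); auto).
    assert (E51' : V S 25 + V S1 50 = root + i) by (rewrite Vi, (ec_root _ _ _ _ _ _ _ _ _ HC); auto).
    assert (HS2 := ec_static _ _ _ _ _ _ _ _ _ HC2). clear Vi.
    assert (Hw : wf_rhs M (length ss) m u) by (eapply rsubs_wf; eauto; apply HC).
    assert (Hp : productive M ss u) by (eapply rsubs_productive; eauto; apply HC).
    assert (Hrow : forall k a c us, at_ (nodes M s t) (root + i) (NT k a c (map nt_rhs us)) ->
      forall j, j < length us -> row_is M t ss E (nth j us (RPar 0)) S1 (cpos (Datatypes.S (root + i)) (map nt_rhs us) j)).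
    { intros k a c us H' j Hj. edestruct child_in with (root := root) (r := r) as [Hc Hb]; eauto; [lia|]. apply I1; auto. lia. }
    destruct u as [d us|q j us|j]; simpl in Hat'; destruct (node_at _ _ _ _ _ _ _ _ _ HS Hat') as (NK & NS & _ & NA & _);
      rewrite ?length_map in NA.
    + assert (Har : ar i = length us).
      { unfold ar. apply at_node in Hat' as [-> _]. simpl. apply length_map. }
      apply tri_is_kind; [intros _|intros H'; exfalso; apply H'; norm; rewrite E51'; auto].
      inversion Hw as [? ? Hd Hus| |]; subst.
      eapply tri_conseq; [eapply eval_out_ok with (g := root + i); eauto| |].
      * fold n. rewrite Har. nia.
      * intros S2 F2 H'. exact H'.
    + assert (Har : ar i = length us).
      { unfold ar. apply at_node in Hat' as [-> _]. simpl. apply length_map. }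
      apply tri_is_kind; [intros H'; exfalso; revert H'; norm; rewrite E51', NK; discriminate|intros _].
      apply tri_is_kind; [intros _|intros H'; exfalso; apply H'; norm; rewrite E51'; auto].
      assert (Hk : length us <= V S vMX) by (eapply call_arity; eauto).
      eapply tri_conseq; [eapply eval_call_ok with (g := root + i); eauto| |].
      * apply HC.
      * apply productive_call in Hp. tauto.
      * norm. auto.
      * eapply (ec_callee _ _ _ _ _ _ _ _ _ HC2); eauto. lia.
      * fold n. rewrite Har. specialize (Hpow _ Hk). nia.
      * intros S2 F2 H'. exact H'.
    + apply tri_is_kind; [intros H'; exfalso; revert H'; norm; rewrite E51', NK; discriminate|intros _].
      apply tri_is_kind; [intros H'; exfalso; revert H'; norm; rewrite E51', NK; discriminate|intros _].
      inversion Hw as [| |? Hj Ej]; rewrite ?Ej in *.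
      eapply tri_conseq; [eapply eval_par_ok with (g := root + i) (j := j) (ss := ss) (E := E); eauto| |].
      * apply (ec_par _ _ _ _ _ _ _ _ _ HC2); auto.
      * apply (ec_target _ _ _ _ _ _ _ _ _ HC2).
      * intros t'. apply (ec_env _ _ _ _ _ _ _ _ _ HC2); auto.
      * fold n. lia.
      * intros S2 F2 H'. exact H'.
  - nia.
  - intros S1 F1 I1. apply I1; auto. pose proof (nsize_pos (nt_rhs r)). rewrite nsize_rhs in *. lia.
Qed.

(** * Blocks of facts *)

Definition block_len (t : tree) (m : nat) : nat := m + 1 + tsize t ^ (m + 1).

Definition fact_gen (M : mtt) (t : tree) (ss : list tree) (m : nat) (r : rhs) (c : nat) : Prop :=
  gen M ss (erase (sub_at t (dig (tsize t) c 0)) (digit_trees t c m)) r (sub_at t (dig (tsize t) c 0)).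

(** Facts appear here through the erased environment, as they are evaluated; [block_callee] turns
    them back into [call_fact]. *)
Definition rule_cell (M : mtt) (t : tree) (ss : list tree) (m : nat) (r : rhs) (o : nat) : Prop :=
  o = 0 /\ productive M ss r \/ 1 <= o <= m /\ den M (inst ss r) (FY o) \/
  exists c, o = m + 1 + c /\ fact_gen M t ss m r c.

Definition call_cell (M : mtt) (t v : tree) (q m o : nat) : Prop :=
  exists r ss, rule_of M q v r ss /\ rule_cell M t ss m r o.

Definition block_ok (M : mtt) (t v : tree) (q m : nat) (S : st) (b : nat) : Prop :=
  forall o, o < block_len t m -> (A S aF (b + o) <> 0 <-> call_cell M t v q m o).

Lemma block_productive (M : mtt) (t v : tree) (q m : nat) (S : st) (b : nat) :
  block_ok M t v q m S b -> (A S aF b <> 0 <-> call_productive M v q).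
Proof.
  intros H. specialize (H 0). rewrite Nat.add_0_r in H. rewrite H by (unfold block_len; lia).
  split.
  - intros (r & ss & Hr & [[_ Hp]|[[H1 _]|(c & Hc & _)]]); try lia. exists r, ss. auto.
  - intros (r & ss & Hr & Hp). exists r, ss. split; auto. left. auto.
Qed.

Lemma block_callee (M : mtt) (t v : tree) (q m : nat) (S : st) (b : nat) :
  wf_mtt M -> wf_tree (inp M) v -> In (q, m) (states M) -> block_ok M t v q m S b -> callee_ok M t v q m S b.
Proof.
  intros HM Hv Hq H. unfold block_ok in H. split.
  - intros l Hl. rewrite H by (unfold block_len; lia). split.
    + intros (r & ss & Hr & [[H0 _]|[[_ Hd]|(c & Hc & _)]]); try lia. exists r, ss. auto.
    + intros (r & ss & Hr & Hd). exists r, ss. split; auto. right; left. auto.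
  - intros c Hc. replace (b + m + (1 + c)) with (b + (m + 1 + c)) by lia. rewrite H by (unfold block_len; lia).
    rewrite call_fact_erase by (auto; now rewrite length_digit_trees). split.
    + intros (r & ss & Hr & [[H0 _]|[[H1 _]|(c' & Hc' & Hg)]]); try lia.
      replace c' with c in Hg by lia. exists r, ss. auto.
    + intros (r & ss & Hr & Hg). exists r, ss. split; auto. right; right. exists c. auto.
Qed.

Definition block_only (b len : nat) (S S' : st) : Prop :=
  forall x, x < b \/ b + len <= x -> A S' aF x = A S aF x.

(** Only calls can fail to have a value, and under call-by-value every call in a right-hand side is
    evaluated. So a flat scan of its nodes decides productivity. *)
Lemma productive_iff (M : mtt) (ss : list tree) (r : rhs) :
  productive M ss r <->
  forall q i us, In (RCall q i us) (rsubs r) -> call_productive M (nth (i - 1) ss (Node 0 [])) q.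
Proof.
  split.
  - intros H q i us Hin. eapply rsubs_productive in H; eauto. now apply productive_call in H.
  - induction r as [d us IH|q i us IH|j] using rhs_ind_list; intros H; try rewrite Forall_forall in IH.
    + apply productive_out. rewrite Forall_forall. intros u Hu. apply IH; auto.
      intros q i us' Hin. apply (H q i us'). simpl. right. apply in_flat_map. eauto.
    + apply productive_call. split; [apply (H q i us); simpl; auto|].
      rewrite Forall_forall. intros u Hu. apply IH; auto.
      intros q' i' us' Hin. apply (H q' i' us'). simpl. right. apply in_flat_map. eauto.
    + apply productive_par.
Qed.

Lemma block_pos (a W x y : nat) (c v : nat) : v < c -> x + y <= W -> v * W + x + y <= c * W + a.
Proof. intros H1 H2. assert (v * W + W <= c * W) by nia. lia. Qed.

(** [rc_child] is the induction hypothesis of the bottom-up pass: the children sit at later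
    positions [c], and their rows are complete. [rc_digits] supports the shortcut that leaves [aEN]
    untouched when |t| = 1. *)
Record RuleCtx (M : mtt) (s t : tree) (v q m : nat) (ss : list tree) (r : rhs) (root : nat) (S : st) : Prop := {
  rc_static : Static M s t S;
  rc_root : V S 25 = root;
  rc_size : V S 26 = rsize r;
  rc_base : V S 27 = v * V S vW + A S aQB q;
  rc_rank : V S 28 = m;
  rc_RK : A S aRK q = Datatypes.S m;
  rc_at : at_ (nodes M s t) root (nt_rhs r);
  rc_wf : wf_rhs M (length ss) m r;
  rc_ss : Forall (wf_tree (inp M)) ss;
  rc_child : forall i, 1 <= i <= length ss -> exists c, v < c /\ A S aCH i = c * V S vW /\
    forall q' m', A S aRK q' = Datatypes.S m' ->
      block_ok M t (nth (i - 1) ss (Node 0 [])) q' m' S (c * V S vW + A S aQB q');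
  rc_digits : tsize t = 1 -> forall j, A S aEN j = 0
}.

(** Bits are written only into one block of row [v]; the rows of the children begin after that row,
    so what they record remains true. *)
Lemma RuleCtx_frame (M : mtt) (s t : tree) (v q m root : nat) (ss : list tree) (r : rhs) (S S' : st) (vs bs : list nat) :
  frame vs bs S S' -> disjoint_b (static_vars ++ [25; 26; 27; 28]) vs = true ->
  disjoint_b (static_arrs ++ [18]) bs = true ->
  block_only (v * V S vW + A S aQB q) (block_len t m) S S' ->
  (tsize t = 1 -> forall j, A S' aEN j = 0) ->
  RuleCtx M s t v q m ss r root S -> RuleCtx M s t v q m ss r root S'.
Proof.
  intros F D1 D2 HB HE []. assert (F0 := F). destruct F as [F1 F2].
  assert (HV : forall x, memb x (static_vars ++ [25; 26; 27; 28]) = true -> V S' x = V S x).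
  { intros x Hx. apply F1. eapply disjoint_b_memb; eauto. }
  assert (HA : forall a, memb a (static_arrs ++ [18]) = true -> forall i, A S' a i = A S a i).
  { intros x Hx. apply F2. eapply disjoint_b_memb; eauto. }
  assert (HL : A S aQB q + block_len t m <= V S vW).
  { destruct (st_rank _ _ _ _ rc_static0 q) as (m' & E & _ & _ & Hle); [congruence|].
    rewrite rc_RK0 in E. injection E as <-. exact Hle. }
  constructor; intros; rewrite ?(HV 25), ?(HV 26), ?(HV 27), ?(HV 28), ?(HV 7), ?(HA 12), ?(HA 9), ?(HA 18) by reflexivity; auto.
  - eapply static_frame; eauto.
    + unfold disjoint_b in *. rewrite forallb_app in D1. apply andb_prop in D1. tauto.
    + unfold disjoint_b in *. rewrite forallb_app in D2. apply andb_prop in D2. tauto.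
  - destruct (rc_child0 i H) as (c & Hc & HCH & Hblk). exists c. split; auto. split; auto.
    intros q' m' Hq' o Ho. rewrite (HA 9) in Hq' by reflexivity. rewrite (HA 12) by reflexivity. rewrite HB.
    + apply Hblk; auto.
    + right. rewrite <- Nat.add_assoc with (n := c * V S vW). apply block_pos; auto.
Qed.

(** The recorded rank may stem from another call of the same state; uniqueness of ranks makes it
    agree with this one. *)
Lemma rank_call (M : mtt) (s t : tree) (S : st) (g q i : nat) (us : list rhs) :
  wf_mtt M -> Static M s t S -> at_ (nodes M s t) g (nt_rhs (RCall q i us)) -> In (q, length us) (states M) ->
  A S aRK q = Datatypes.S (length us).
Proof.
  intros HM HS H Hq. simpl in H. apply at_node in H as [H _]. pose proof (st_rank_call _ _ _ _ HS g) as Ha.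
  rewrite H in Ha. simpl in Ha. destruct (st_rank _ _ _ _ HS q (Ha eq_refl)) as (m & E & Hm & _). rewrite E. f_equal.
  eapply ralph_rank_unique; eauto. apply HM.
Qed.

Lemma wf_call (M : mtt) (k m q i : nat) (us : list rhs) :
  wf_rhs M k m (RCall q i us) -> In (q, length us) (states M) /\ 1 <= i <= k.
Proof. intros H. inversion H; auto. Qed.

Definition calls_set (M : mtt) (s t : tree) (ss : list tree) (root l : nat) (S : st) : Prop :=
  forall g q i us, root <= g < root + l -> at_ (nodes M s t) g (nt_rhs (RCall q i us)) ->
    A S aCB g = A S aCH i + A S aQB q.

(** The second half places the block of every callee beyond the block being written, so the facts
    read during evaluation are not disturbed by the facts found. *)
Lemma calls_callee (M : mtt) (s t : tree) (v q m root : nat) (ss : list tree) (r : rhs) (S : st) (g q' i : nat) (us : list rhs) :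
  wf_mtt M -> RuleCtx M s t v q m ss r root S -> calls_set M s t ss root (rsize r) S ->
  root <= g < root + rsize r -> at_ (nodes M s t) g (nt_rhs (RCall q' i us)) ->
  callee_ok M t (nth (i - 1) ss (Node 0 [])) q' (length us) S (A S aCB g) /\
  v * V S vW + A S aQB q + block_len t m <= A S aCB g.
Proof.
  intros HM HR HC Hg Hat. rewrite (HC g q' i us Hg Hat).
  assert (Hin : In (RCall q' i us) (rsubs r)) by (eapply rhs_in; eauto; apply HR).
  assert (Hw : wf_rhs M (length ss) m (RCall q' i us)) by (eapply rsubs_wf; eauto; apply HR).
  inversion Hw as [|? ? ? Hq Hi Hus|]; subst.
  destruct (rc_child _ _ _ _ _ _ _ _ _ _ HR i Hi) as (c & Hvc & -> & Hb).
  split.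
  - apply block_callee; auto.
    + pose proof (rc_ss _ _ _ _ _ _ _ _ _ _ HR) as Hss. rewrite Forall_forall in Hss. apply Hss, nth_In. lia.
    + apply Hb. eapply rank_call; eauto. apply HR.
  - apply block_pos; auto.
    destruct (st_rank _ _ _ _ (rc_static _ _ _ _ _ _ _ _ _ _ HR) q) as (m' & E & _ & _ & Hle).
    + rewrite (rc_RK _ _ _ _ _ _ _ _ _ _ HR). discriminate.
    + rewrite (rc_RK _ _ _ _ _ _ _ _ _ _ HR) in E. injection E as <-. exact Hle.
Qed.

Lemma calls_pass_ok (M : mtt) (s t : tree) (v q m root : nat) (ss : list tree) (r : rhs) (S : st) :
  wf_mtt M -> RuleCtx M s t v q m ss r root S ->
  tri calls_pass S (3 + 10 * rsize r) (fun S' =>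
    RuleCtx M s t v q m ss r root S' /\ calls_set M s t ss root (rsize r) S' /\ (V S' 29 <> 0 <-> productive M ss r)).
Proof.
  intros HM HR. assert (HS := rc_static _ _ _ _ _ _ _ _ _ _ HR). assert (Hat := rc_at _ _ _ _ _ _ _ _ _ _ HR).
  apply tri_asn_seq. vs.
  eapply tri_for with (n := rsize r) (f := fun _ => 5)
    (Inv := fun j S' => calls_set M s t ss root j S' /\
      (V S' 29 <> 0 <-> forall g q' i us, root <= g < root + j -> at_ (nodes M s t) g (nt_rhs (RCall q' i us)) ->
         call_productive M (nth (i - 1) ss (Node 0 [])) q')).
  - reflexivity.
  - vs. apply HR.
  - vs. split; [|split].
    + intros g q' i us Hg. lia.
    + intros _ g q' i us Hg. lia.
    + intros _. lia.
  - intros j S1 Hj F1 Vj [I1 I2].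
    destruct (rhs_at _ _ _ j Hat Hj) as (u & Hu & Hu').
    apply tri_asn_seq. vs.
    assert (E31 : V S 25 + V S1 30 = root + j) by (rewrite Vj, (rc_root _ _ _ _ _ _ _ _ _ _ HR); auto).
    assert (Hsplit : forall P : nat -> nat -> nat -> list rhs -> Prop,
      (forall g q' i us, root <= g < root + Datatypes.S j -> at_ (nodes M s t) g (nt_rhs (RCall q' i us)) -> P g q' i us) <->
      (forall g q' i us, root <= g < root + j -> at_ (nodes M s t) g (nt_rhs (RCall q' i us)) -> P g q' i us) /\
      (forall q' i us, u = RCall q' i us -> P (root + j) q' i us)).
    { intros P. split.
      - intros H. split; [intros; apply H; auto; lia|]. intros q' i us ->. apply H; auto. lia.
      - intros [H1 H2] g q' i us Hg Hg'. destruct (Nat.eq_dec g (root + j)) as [->|N].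
        + apply H2. apply nt_rhs_inj. eapply at_unique; eauto.
        + apply H1; auto. lia. }
    destruct (nt_rhs u) as [k a ci xs] eqn:Eu. destruct (node_at _ _ _ _ _ _ _ _ _ HS Hu') as (NK & NS & NC & _).
    eapply tri_conseq with (k := 4); [|lia|intros ? _ HQ0; exact HQ0].
    apply tri_is_kind.
    + intros HK. revert HK. norm. rewrite E31, NK. intros ->.
      destruct u as [d us|q' i us|y]; try discriminate. simpl in Eu. injection Eu as <- <- <-.
      assert (Hw : wf_rhs M (length ss) m (RCall q' i us)) by (eapply rsubs_wf; eauto; apply HR).
      apply wf_call in Hw as [Hq Hi].
      destruct (rc_child _ _ _ _ _ _ _ _ _ _ HR i Hi) as (c & Hvc & HCH & Hb).
      assert (Hp : A S aF (A S aCH i + A S aQB q') <> 0 <-> call_productive M (nth (i - 1) ss (Node 0 [])) q').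
      { rewrite HCH. eapply block_productive. apply Hb. eapply rank_call; eauto. }
      apply tri_sto_seq. vs.
      assert (Hset : forall S2, (forall x, A S2 aCB x = if Nat.eqb x (root + j) then A S aCH i + A S aQB q' else A S1 aCB x) ->
         (forall i, A S2 aCH i = A S aCH i) -> (forall i, A S2 aQB i = A S aQB i) ->
         calls_set M s t ss root (Datatypes.S j) S2).
      { intros S2 H1 H2 H3. unfold calls_set. apply Hsplit. split.
        - intros g q1 i1 us1 Hg Hg'. rewrite H1, H2, H3. destruct (Nat.eqb_spec g (root + j)); [lia|].
          rewrite (I1 g q1 i1 us1 Hg Hg'). norm. auto.
        - intros q1 i1 us1 E. injection E as <- <- <-. rewrite H1, H2, H3, Nat.eqb_refl. auto. }
      apply tri_if; intros HF.
      * apply tri_skip. revert HF. norm. rewrite ?E31, Nat.eqb_refl, NS, NC. intros HF. apply Hp in HF.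
        split.
        -- apply Hset; intros; norm; rewrite ?E31, ?NS, ?NC; auto.
        -- rewrite I2, (Hsplit (fun _ q' i _ => call_productive M (nth (i - 1) ss (Node 0 [])) q')).
           split; [intros H; split; auto|tauto]. intros q1 i1 us1 E. injection E as <- <- <-. auto.
      * apply tri_asn; auto. revert HF. norm. rewrite ?E31, Nat.eqb_refl, NS, NC. intros HF.
        split.
        -- apply Hset; intros; norm; rewrite ?E31, ?NS, ?NC; auto.
        -- rewrite (Hsplit (fun _ q' i _ => call_productive M (nth (i - 1) ss (Node 0 [])) q')).
           split; [lia|]. intros [_ H]. exfalso. apply Hp; auto. eapply H; eauto.
    + intros HK. apply tri_skip. vs. revert HK. norm. rewrite E31, NK. intros HK.
      assert (Hnc : forall q' i us, u <> RCall q' i us).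
      { intros q' i us ->. simpl in Eu. injection Eu as <- _ _ _. auto. }
      split.
      * unfold calls_set. apply Hsplit. split; [|intros; exfalso; eapply Hnc; eauto].
        intros g q1 i1 us1 Hg Hg'. norm. rewrite (I1 g q1 i1 us1 Hg Hg'). norm. auto.
      * rewrite I2, (Hsplit (fun _ q' i _ => call_productive M (nth (i - 1) ss (Node 0 [])) q')).
        split; [|tauto]. intros H; split; auto. intros; exfalso; eapply Hnc; eauto.
  - rewrite sumf_const. lia.
  - intros S1 F1 [I1 I2]. split; [|split; auto].
    + eapply RuleCtx_frame with (S := {| V := upd (V S) 29 1; A := A S |}); [exact F1|reflexivity|reflexivity| | |].
      * intros x _. norm. auto.
      * intros Hn j. norm. apply (rc_digits _ _ _ _ _ _ _ _ _ _ HR); auto.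
      * eapply RuleCtx_frame with (vs := [29]) (bs := []); [|reflexivity|reflexivity| | |exact HR].
        -- split; auto. intros x Hx. simpl in *. unfold upd. destruct (Nat.eqb x 29); auto; discriminate.
        -- intros x _. reflexivity.
        -- intros Hn j. apply (rc_digits _ _ _ _ _ _ _ _ _ _ HR); auto.
    + rewrite I2, productive_iff. split.
      * intros H q' i us Hin. apply In_nth with (d := r) in Hin as (j & Hj & E). rewrite length_rsubs in Hj.
        apply (H (root + j) q' i us); [lia|].
        assert (Hj' := Hat). apply at_nth with (p := j) (d := nt_rhs r) in Hj'; [|now rewrite nsize_rhs].
        rewrite nsubs_rhs, map_nth, E in Hj'. auto.
      * intros H g q' i us Hg Hg'. apply (H q' i us). eapply rhs_in; eauto.
Qed.

Lemma forest_app (L : list node) (xs ys : list ntree) : forall i,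
  forest_at L i (xs ++ ys) <-> forest_at L i xs /\ forest_at L (i + length (flat_map flat xs)) ys.
Proof.
  induction xs as [|x xs IH]; intros i; simpl.
  - rewrite Nat.add_0_r. split; [|tauto]. intros H. split; auto.
    destruct H as (l1 & l2 & -> & Hl). exists l1, (flat_map flat ys ++ l2). auto.
  - rewrite !forest_cons, IH, length_app, Nat.add_assoc. unfold nsize. tauto.
Qed.

(** Defined along the forest that starts at position [g], in the shape in which a preorder scan
    consumes it: the first tree, then the rest behind it. *)
Fixpoint marked_proj (M : mtt) (ss : list tree) (mk : nat -> nat) (g : nat) (us : list rhs) (y : nat) : Prop :=
  match us with
  | [] => False
  | u :: us => mk g <> 0 /\ den M (inst ss u) (FY y) \/ marked_proj M ss mk (g + rsize u) us y
  end.

Lemma marked_proj_app (M : mtt) (ss : list tree) (mk : nat -> nat) (us us' : list rhs) (y : nat) : forall g,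
  marked_proj M ss mk g (us ++ us') y <->
  marked_proj M ss mk g us y \/ marked_proj M ss mk (g + list_sum (map rsize us)) us' y.
Proof.
  induction us as [|u us IH]; intros g; simpl.
  - rewrite Nat.add_0_r. tauto.
  - rewrite IH, Nat.add_assoc. tauto.
Qed.

Lemma marked_proj_ext (M : mtt) (ss : list tree) (mk mk' : nat -> nat) (us : list rhs) (y : nat) : forall g,
  (forall x, g <= x -> mk' x = mk x) -> marked_proj M ss mk' g us y <-> marked_proj M ss mk g us y.
Proof.
  induction us as [|u us IH]; intros g H; simpl; [tauto|].
  rewrite H, IH by (intros; auto; apply H; lia). tauto.
Qed.

Lemma marked_proj_iff (M : mtt) (ss : list tree) (mk : nat -> nat) (us : list rhs) (y : nat) : forall g,
  marked_proj M ss mk g us y <->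
  exists l, l < length us /\ mk (cpos g (map nt_rhs us) l) <> 0 /\ den M (inst ss (nth l us (RPar 0))) (FY y).
Proof.
  induction us as [|u us IH]; intros g.
  - simpl. split; [tauto|]. intros (l & Hl & _). lia.
  - cbn [marked_proj]. rewrite IH. clear IH.
    assert (E : forall l, cpos g (map nt_rhs (u :: us)) (S l) = cpos (g + rsize u) (map nt_rhs us) l).
    { intros l. unfold cpos. cbn [map firstn list_sum fold_right]. change (fold_right Nat.add 0) with list_sum.
      rewrite nsize_rhs. lia. }
    split.
    + intros [[H1 H2]|(l & Hl & H1 & H2)].
      * exists 0. rewrite cpos_0. simpl. split; [lia|auto].
      * exists (S l). rewrite E. simpl. split; [lia|auto].
    + intros ([|l] & Hl & H1 & H2).
      * left. rewrite cpos_0 in H1. auto.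
      * right. exists l. rewrite E in H1. simpl in Hl, H2. split; [lia|auto].
Qed.

Lemma flat_map_nt (us : list rhs) : length (flat_map flat (map nt_rhs us)) = list_sum (map rsize us).
Proof. induction us as [|u us IH]; simpl; auto. rewrite length_app, IH. fold (nsize (nt_rhs u)). now rewrite nsize_rhs. Qed.

Lemma cpos_lt (g : nat) (us : list rhs) (i j : nat) :
  i < j -> j < length us -> cpos g (map nt_rhs us) i < cpos g (map nt_rhs us) j.
Proof.
  intros Hij Hj. induction Hij as [|j Hij IH].
  - rewrite cpos_S with (d := nt_rhs (RPar 0)) by (rewrite length_map; lia).
    pose proof (nsize_pos (nth i (map nt_rhs us) (nt_rhs (RPar 0)))). lia.
  - rewrite cpos_S with (d := nt_rhs (RPar 0)) by (rewrite length_map; lia).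
    specialize (IH ltac:(lia)). lia.
Qed.

Ltac use_block H := cbv beta; match goal with |- block_only _ _ _ ?X /\ _ => apply (H X) end.

(* The marked trees among those still to be scanned account for the remaining projections. *)
Lemma mark_pass_ok (M : mtt) (s t : tree) (v q m root : nat) (ss : list tree) (r : rhs) (S : st) :
  wf_mtt M -> RuleCtx M s t v q m ss r root S -> calls_set M s t ss root (rsize r) S -> productive M ss r ->
  tri mark_pass S (3 + 40 * rsize r) (fun S' =>
    (forall o, A S' aF (V S 27 + o) <> 0 <-> A S aF (V S 27 + o) <> 0 \/ 1 <= o <= m /\ den M (inst ss r) (FY o)) /\
    block_only (V S 27) (block_len t m) S S').
Proof.
  intros HM HR HC Hpr. assert (HS := rc_static _ _ _ _ _ _ _ _ _ _ HR). assert (Hat := rc_at _ _ _ _ _ _ _ _ _ _ HR).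
  set (b := V S 27) in *. assert (Hb := rc_base _ _ _ _ _ _ _ _ _ _ HR). fold b in Hb.
  apply tri_sto_seq. vs.
  set (ar := fun i => narity (nth (root + i) (nodes M s t) node0)).
  assert (Hsum : sumf (rsize r) (fun i => 10 + 10 * ar i) <= 20 * rsize r).
  { rewrite sumf_add, sumf_const, sumf_mul. pose proof (at_arity_sum _ _ _ Hat) as Ha. rewrite nsize_rhs in Ha. fold ar in Ha. lia. }
  eapply tri_for with (n := rsize r) (f := fun i => 10 + 10 * ar i)
    (* [W] collects the parameters stored so far. The forest [us] starts as the whole right-hand
       side, and each round replaces its first tree by the children of that tree. *)
    (Inv := fun j S' => block_only b (block_len t m) S S' /\ exists us (W : nat -> Prop),
      forest_at (nodes M s t) (root + j) (map nt_rhs us) /\ j + list_sum (map rsize us) = rsize r /\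
      (forall o, A S' aF (b + o) <> 0 <-> A S aF (b + o) <> 0 \/ 1 <= o <= m /\ W o) /\
      (forall y, den M (inst ss r) (FY y) <-> W y \/ marked_proj M ss (A S' aMK) (root + j) us y)).
  - reflexivity.
  - vs. apply HR.
  - split; [intros x _; reflexivity|]. exists [r], (fun _ => False). split; [|split; [|split]].
    + rewrite Nat.add_0_r. exact Hat.
    + simpl. lia.
    + intros o. vs. tauto.
    + intros y. cbn [marked_proj]. vs. rewrite Nat.add_0_r, (rc_root _ _ _ _ _ _ _ _ _ _ HR), Nat.eqb_refl.
      split; [intros; right; left; auto|]. intros [[]|[[_ H]|[]]]. auto.
  - intros j S1 Hj F1 Vj [I0 (us & W & I1 & I2 & I3 & I4)].
    destruct us as [|u us]; [simpl in I2; lia|].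
    cbn [map] in I1. apply forest_cons in I1 as [Hu Hus]. rewrite nsize_rhs in Hus.
    cbn [map list_sum fold_right] in I2. change (fold_right Nat.add 0) with list_sum in I2.
    assert (Hg : root <= root + j < root + rsize r) by lia.
    assert (Hin : In u (rsubs r)) by (eapply rhs_in; eauto).
    assert (Hw : wf_rhs M (length ss) m u) by (eapply rsubs_wf; eauto; apply HR).
    assert (Hp : productive M ss u) by (eapply rsubs_productive; eauto).
    assert (E31 : V S 25 + V S1 30 = root + j) by (rewrite Vj, (rc_root _ _ _ _ _ _ _ _ _ _ HR); auto).
    set (g := root + j) in *.
    set (ch := match u with ROut _ us | RCall _ _ us => us | RPar _ => [] end).
    assert (Hnt : exists k a c, nt_rhs u = NT k a c (map nt_rhs ch) /\
      (k = 0 /\ (exists d us, u = ROut d us) \/ k = 1 /\ u = RCall a c ch \/ k = 2 /\ u = RPar a)).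
    { destruct u as [d us'|q' i us'|y]; simpl; do 3 eexists; split; try reflexivity; eauto 6. }
    destruct Hnt as (k & a & c & Ent & Hk). rewrite Ent in Hu.
    destruct (node_at _ _ _ _ _ _ _ _ _ HS Hu) as (NK & NS & NC & NA & _). rewrite length_map in NA.
    assert (Har : ar j = length ch).
    { unfold ar. fold g. apply at_node in Hu as [-> _]. simpl. apply length_map. }
    assert (Hsz : rsize u = 1 + list_sum (map rsize ch)).
    { rewrite <- nsize_rhs, Ent. unfold nsize. cbn [flat length]. now rewrite flat_map_nt. }
    assert (Hfch : forest_at (nodes M s t) (Datatypes.S g) (map nt_rhs ch)) by (apply at_node in Hu; tauto).
    assert (Hcallee : k = 1 -> forall l, l < length ch ->
      (A S1 aF (A S aCB g + Datatypes.S l) <> 0 <-> call_proj M (nth (c - 1) ss (Node 0 [])) a (Datatypes.S l))).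
    { intros -> l Hl. destruct Hk as [[? _]|[[_ Eu]|[? _]]]; try lia.
      assert (Hu' : at_ (nodes M s t) g (nt_rhs (RCall a c ch))) by (rewrite <- Eu, Ent; auto).
      destruct (calls_callee M s t v q m root ss r S g a c ch HM HR HC Hg Hu') as [[C1 _] C2].
      rewrite <- Hb in C2. rewrite I0 by lia. apply C1. lia. }
    do 3 (apply tri_asn_seq; vs).
    eapply tri_seq with (k1 := 1 + 9 * length ch) (k2 := 4) (Q1 := fun S2 =>
      (forall l, l < length ch -> (A S2 aMK (cpos (Datatypes.S g) (map nt_rhs ch) l) <> 0 <->
         A S1 aMK g <> 0 /\ k = 1 /\ call_proj M (nth (c - 1) ss (Node 0 [])) a (Datatypes.S l))) /\
      (forall x, x <= g \/ g + rsize u <= x -> A S2 aMK x = A S1 aMK x)); [| |rewrite Har; lia].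
    + eapply tri_rep with (n := length ch) (f := fun _ => 8)
        (Inv := fun i S2 => V S2 32 = cpos (Datatypes.S g) (map nt_rhs ch) i /\ V S2 33 = Datatypes.S i /\
          (forall l, l < i -> (A S2 aMK (cpos (Datatypes.S g) (map nt_rhs ch) l) <> 0 <->
             A S1 aMK g <> 0 /\ k = 1 /\ call_proj M (nth (c - 1) ss (Node 0 [])) a (Datatypes.S l))) /\
          (forall x, x <= g \/ g + rsize u <= x -> A S2 aMK x = A S1 aMK x)).
      * norm. rewrite E31, NA. auto.
      * norm. rewrite E31, Nat.add_1_r, cpos_0. split; auto. split; auto. split; [intros; lia|auto].
      * intros i S2 Hi F2 (J1 & J2 & J3 & J4).
        destruct (next_child _ _ _ _ _ _ _ _ _ i HS Hu) as [NX _]; [now rewrite length_map|].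
        set (cp := cpos (Datatypes.S g) (map nt_rhs ch)) in *.
        assert (Hci : g < cp i < g + rsize u).
        { unfold cp. split; [apply cpos_ge|].
          pose proof (cpos_bound (Datatypes.S g) (map nt_rhs ch) i (nt_rhs (RPar 0))) as Hb'.
          rewrite length_map, flat_map_nt in Hb'. specialize (Hb' Hi).
          pose proof (nsize_pos (nth i (map nt_rhs ch) (nt_rhs (RPar 0)))). lia. }
        apply tri_sto_seq. vs.
        assert (E27 : V S2 31 = g) by (norm; rewrite E31; auto).
        assert (Step : forall S3 (mk : Prop), V S3 32 = V S2 32 -> V S3 33 = V S2 33 -> A S3 aNX (cp i) = A S aNX (cp i) ->
          (forall x, x <> cp i -> A S3 aMK x = A S2 aMK x) -> (A S3 aMK (cp i) <> 0 <-> mk) ->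
          (mk <-> A S1 aMK g <> 0 /\ k = 1 /\ call_proj M (nth (c - 1) ss (Node 0 [])) a (Datatypes.S i)) ->
          tri (Asn 32 (Arr aNX (Var 32)) ;; inc 33 (Cst 1)) S3 2 (fun S4 =>
            V S4 32 = cp (Datatypes.S i) /\ V S4 33 = Datatypes.S (Datatypes.S i) /\
            (forall l, l < Datatypes.S i -> (A S4 aMK (cp l) <> 0 <->
               A S1 aMK g <> 0 /\ k = 1 /\ call_proj M (nth (c - 1) ss (Node 0 [])) a (Datatypes.S l))) /\
            (forall x, x <= g \/ g + rsize u <= x -> A S4 aMK x = A S1 aMK x))).
        { intros S3 mk G1 G2 G3 G4 G5 G6. apply tri_asn_seq. apply tri_asn; auto. vs. rewrite G1, G2, J1, J2, G3, NX.
          split; auto. split; [lia|]. split.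
          - intros l Hl. destruct (Nat.eq_dec l i) as [->|N].
            + rewrite G5, G6. tauto.
            + rewrite G4; [apply J3; lia|]. assert (cp l < cp i) by (apply cpos_lt; lia). lia.
          - intros x Hx. rewrite G4 by lia. apply J4; auto. }
        eapply tri_seq with (k1 := 5) (k2 := 2) (Q1 := fun S3 => V S3 32 = V S2 32 /\ V S3 33 = V S2 33 /\
          (forall x, x <> cp i -> A S3 aMK x = A S2 aMK x) /\
          (A S3 aMK (cp i) <> 0 <-> A S1 aMK g <> 0 /\ k = 1 /\ call_proj M (nth (c - 1) ss (Node 0 [])) a (Datatypes.S i)));
          [| |lia].
        -- assert (Hmk : A S2 aMK g = A S1 aMK g) by (apply J4; lia).
           assert (Hng : Nat.eqb g (cp i) = false) by (apply Nat.eqb_neq; lia).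
           assert (Hoth : forall x, x <> cp i -> Nat.eqb x (cp i) = false) by (intros; apply Nat.eqb_neq; auto).
           apply tri_if; intros H1.
           ++ revert H1. vs. rewrite E27, J1. fold cp. rewrite Hng, Hmk. intros H1.
              eapply tri_conseq with (k := 3); [|lia|intros ? _ HQ0; exact HQ0].
              apply tri_is_kind; intros H2; revert H2; vs; rewrite E27; norm; rewrite NK; intros H2.
              ** apply tri_if; intros H3; revert H3; vs; rewrite E27, J2; norm; intros H3.
                 --- apply tri_sto; auto. vs. rewrite J1. fold cp. rewrite Nat.eqb_refl. split; auto. split; auto. split.
                     +++ intros x Hx. rewrite !Hoth; auto.
                     +++ split; [|lia]. intros _. split; auto. split; auto. apply Hcallee; auto.
                 --- apply tri_skip. vs. rewrite J1. fold cp. rewrite Nat.eqb_refl. split; auto. split; auto. split.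
                     +++ intros x Hx. rewrite !Hoth; auto.
                     +++ split; [lia|]. intros (_ & _ & H4). apply Hcallee in H4; auto.
              ** apply tri_skip. vs. rewrite J1. fold cp. rewrite Nat.eqb_refl. split; auto. split; auto. split.
                 --- intros x Hx. rewrite !Hoth; auto.
                 --- split; [lia|tauto].
           ++ revert H1. vs. rewrite E27, J1. fold cp. rewrite Hng, Hmk. intros H1.
              apply tri_skip. vs. rewrite J1. fold cp. rewrite Nat.eqb_refl. split; auto. split; auto. split.
              ** intros x Hx. rewrite !Hoth; auto.
              ** split; [lia|tauto].
        -- intros S3 F3 (G1 & G2 & G3 & G4). eapply Step; eauto; [|tauto]. norm. auto.
      * rewrite sumf_const. lia.
      * intros S2 F2 (J1 & J2 & J3 & J4). auto.
    + intros S2 F2 [K1 K2].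
      assert (E31' : V S2 31 = g) by (norm; rewrite E31; auto).
      assert (HF2 : forall x, A S2 aF x = A S1 aF x) by (intros; norm; auto).
      set (W' := fun y => W y \/ k = 2 /\ A S1 aMK g <> 0 /\ a = y).
      assert (Step : forall S3, (forall x, A S3 aMK x = A S2 aMK x) -> block_only b (block_len t m) S1 S3 ->
        (forall o, A S3 aF (b + o) <> 0 <-> A S1 aF (b + o) <> 0 \/ 1 <= o <= m /\ k = 2 /\ A S1 aMK g <> 0 /\ a = o) ->
        block_only b (block_len t m) S S3 /\ exists us (W : nat -> Prop),
          forest_at (nodes M s t) (root + Datatypes.S j) (map nt_rhs us) /\ Datatypes.S j + list_sum (map rsize us) = rsize r /\
          (forall o, A S3 aF (b + o) <> 0 <-> A S aF (b + o) <> 0 \/ 1 <= o <= m /\ W o) /\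
          (forall y, den M (inst ss r) (FY y) <-> W y \/ marked_proj M ss (A S3 aMK) (root + Datatypes.S j) us y)).
      { intros S3 G1 G2 G3. replace (root + Datatypes.S j) with (Datatypes.S g) by (unfold g; lia).
        split; [intros x Hx; rewrite G2, I0 by auto; auto|]. exists (ch ++ us), W'. split; [|split; [|split]].
        - rewrite map_app. apply forest_app. split; auto. rewrite flat_map_nt.
          replace (Datatypes.S g + list_sum (map rsize ch)) with (g + rsize u) by lia. auto.
        - rewrite map_app, list_sum_app. lia.
        - intros o. rewrite G3, I3. unfold W'. tauto.
        - intros y. rewrite I4, marked_proj_app. cbn [marked_proj].
          replace (Datatypes.S g + list_sum (map rsize ch)) with (g + rsize u) by lia.
          rewrite (marked_proj_ext _ _ (A S1 aMK) (A S3 aMK) us y (g + rsize u)) by (intros x Hx; rewrite G1; apply K2; auto).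
          (* The projections of a marked node are conserved: a parameter stores its own, a call
             hands them to the children it marks, and an output node has none. *)
          assert (Hch : A S1 aMK g <> 0 /\ den M (inst ss u) (FY y) <->
             (k = 2 /\ A S1 aMK g <> 0 /\ a = y) \/ marked_proj M ss (A S3 aMK) (Datatypes.S g) ch y).
          { rewrite marked_proj_iff. destruct Hk as [[-> (d & us' & ->)]|[[-> Eu]|[-> Eu]]].
            - split.
              + intros [_ H]. apply proj_out in H. tauto.
              + intros [[H _]|(l & Hl & H & _)]; [discriminate|]. rewrite G1 in H. apply K1 in H; auto. lia.
            - rewrite Eu in Hw, Hp |- *. rewrite proj_call; eauto; [|apply HR|apply productive_call in Hp; tauto]. split.
              + intros (H1 & l & Hl & H2 & H3). right. exists (l - 1). split; [lia|]. split; auto.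
                rewrite G1. apply K1; [lia|]. replace (Datatypes.S (l - 1)) with l by lia. auto.
              + intros [[H _]|(l & Hl & H1 & H2)]; [discriminate|]. rewrite G1 in H1. apply K1 in H1; auto.
                split; [tauto|]. exists (Datatypes.S l). split; [lia|]. split; [tauto|].
                replace (Datatypes.S l - 1) with l by lia. auto.
            - rewrite Eu, proj_par. split; [intros [H1 H2]; left; auto|].
              intros [(_ & H1 & H2)|(l & Hl & H & _)]; auto. rewrite G1 in H. apply K1 in H; auto. lia. }
          rewrite Hch. unfold W'. tauto. }
      clear K1 I3 I4 Hcallee.
      assert (Hmk : A S2 aMK g = A S1 aMK g) by (apply K2; lia).
      eapply tri_conseq with (k := 3); [|lia|intros ? _ HQ0; exact HQ0].
      apply tri_is_kind; intros H1; revert H1; vs; rewrite E31'; norm; rewrite NK; intros H1.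
      * apply tri_if; intros H2; revert H2; vs; rewrite E31', Hmk; intros H2.
        -- destruct Hk as [[? _]|[[? _]|[_ Eu]]]; try lia.
           assert (Ha : 1 <= a <= m) by (rewrite Eu in Hw; inversion Hw; auto).
           apply tri_sto; auto.
           assert (EA : forall x, A (St (V S2) (updA (A S2) aF (ev (Add (Var 27) (Arr aSY (Var 31))) S2) 1)) aF x =
              if Nat.eqb x (b + a) then 1 else A S1 aF x).
           { intros x. vs. rewrite E31', HF2. norm. rewrite NS. fold b. auto. }
           use_block Step; [reflexivity| |].
           ++ intros x Hx. etransitivity; [apply EA|]. destruct (Nat.eqb_spec x (b + a)); auto. unfold block_len in Hx. lia.
           ++ intros o. transitivity ((if Nat.eqb (b + o) (b + a) then 1 else A S1 aF (b + o)) <> 0); [rewrite <- EA; reflexivity|].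
              destruct (Nat.eqb_spec (b + o) (b + a)) as [E|N].
              ** replace o with a by lia. split; [|lia]. intros _. right. auto.
              ** split; [auto|]. intros [H|(_ & _ & _ & H)]; auto.
        -- apply tri_skip. use_block Step; [reflexivity|intros x _; apply HF2|].
           intros o. vs. rewrite HF2. split; [auto|]. intros [H|(_ & _ & H & _)]; auto.
      * apply tri_skip. use_block Step; [reflexivity|intros x _; apply HF2|].
        intros o. vs. rewrite HF2. split; [auto|]. intros [H|(_ & H & _)]; auto.
  - lia.
  - intros S1 F1 [I0 (us & W & I1 & I2 & I3 & I4)]. split; auto. intros o. rewrite I3, I4.
    destruct us as [|u us]; [simpl; tauto|]. exfalso.
    pose proof (nsize_pos (nt_rhs u)). rewrite nsize_rhs in *. simpl in I2. lia.
Qed.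

Lemma calls_set_frame (M : mtt) (s t : tree) (ss : list tree) (root l : nat) (S S' : st) (vs bs : list nat) :
  frame vs bs S S' -> disjoint_b [12; 18; 19] bs = true ->
  calls_set M s t ss root l S -> calls_set M s t ss root l S'.
Proof.
  intros [_ F] D H g q i us Hg Hat.
  assert (HA : forall a, memb a [12; 18; 19] = true -> forall i, A S' a i = A S a i).
  { intros x Hx. apply F. eapply disjoint_b_memb; eauto. }
  rewrite (HA 12), (HA 18), (HA 19) by reflexivity. eapply H; eauto.
Qed.

Lemma RuleCtx_rank (M : mtt) (s t : tree) (v q m root : nat) (ss : list tree) (r : rhs) (S : st) :
  RuleCtx M s t v q m ss r root S -> m <= V S vMX.
Proof.
  intros HR. destruct (st_rank _ _ _ _ (rc_static _ _ _ _ _ _ _ _ _ _ HR) q) as (m' & E & _ & H & _).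
  - rewrite (rc_RK _ _ _ _ _ _ _ _ _ _ HR). discriminate.
  - rewrite (rc_RK _ _ _ _ _ _ _ _ _ _ HR) in E. injection E as <-. auto.
Qed.

(** Unpacking [m] digits takes time proportional to [m], which must be absorbed by a power of
    |t|. *)
Lemma env_fill_ok (M : mtt) (s t : tree) (S : st) (m c : nat) :
  Static M s t S -> V S 28 = m -> V S 40 = c -> m <= V S vMX -> c < tsize t ^ (m + 1) ->
  (tsize t = 1 -> forall j, A S aEN j = 0) ->
  tri (If (Sub (Var vn) (Cst 1))
    (Asn 42 (Arr aDI (Var 40)) ;; Asn 43 (Cst 1) ;;
     Rep (Var 28) (Sto aEN (Var 43) (Arr aMO (Var 42)) ;; Asn 42 (Arr aDI (Var 42)) ;; inc 43 (Cst 1)))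
    Skip) S (8 + 4 * tsize t ^ m) (fun S' =>
      (forall j, 1 <= j <= m -> A S' aEN j = dig (tsize t) c j) /\ (tsize t = 1 -> forall j, A S' aEN j = 0)).
Proof.
  intros HS Hm Hc Hmx Hlt Hdig. set (n := tsize t) in *. assert (Hn : 1 <= n) by apply tsize_pos.
  eapply tri_conseq with (k := Datatypes.S (7 + 4 * n ^ m)); [|lia|intros ? _ HQ0; exact HQ0].
  apply tri_if; vs; rewrite (st_n _ _ _ _ HS); fold n; intros H1.
  (* For n at least 2 the exponential dominates the rank. For n = 1 it does not, but then all digits
     are 0 and [aEN] already holds zeros. *)
  - assert (Hmn : m < n ^ m) by (apply Nat.pow_gt_lin_r; lia).
    assert (HDM : forall j, A S aMO (c / n ^ j) = dig n c j /\ A S aDI (c / n ^ j) = c / n ^ Datatypes.S j).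
    { intros j. rewrite <- div_pow_S. apply (st_divmod _ _ _ _ HS). fold n.
      pose proof (div_le_self c (n ^ j)). assert (n ^ (m + 1) <= n ^ (V S vMX + 1)) by (apply Nat.pow_le_mono_r; lia). lia. }
    do 2 (apply tri_asn_seq; vs).
    eapply tri_rep with (n := m) (f := fun _ => 3)
      (Inv := fun i S' => V S' 42 = c / n ^ Datatypes.S i /\ V S' 43 = Datatypes.S i /\
         forall j, 1 <= j <= i -> A S' aEN j = dig n c j).
    + vs. auto.
    + vs. rewrite Hc. destruct (HDM 0) as [_ H]. rewrite Nat.pow_0_r, Nat.div_1_r in H. rewrite H. split; auto. split; auto. intros; lia.
    + intros i S1 Hi F1 (J1 & J2 & J3). apply tri_sto_seq. vs. apply tri_asn_seq. vs. apply tri_asn; auto. vs.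
      split; [|split].
      * norm. rewrite J1. apply HDM.
      * rewrite J2. lia.
      * intros j Hj. norm. rewrite J1, J2. destruct (Nat.eqb_spec j (Datatypes.S i)) as [->|N]; [apply HDM|apply J3; lia].
    + rewrite sumf_const. lia.
    + intros S1 F1 (J1 & J2 & J3). split; auto. intros; lia.
  - apply tri_skip. assert (n = 1) by lia. split; auto. intros j Hj. rewrite Hdig by auto. unfold dig. rewrite H.
    now rewrite Nat.mod_1_r.
Qed.

(** The dominant cost. At most X = |t|^([vMX] + 1) codes are tried, and each evaluates the
    right-hand side in time proportional to X times its size; the two factors X give the exponent of
    the theorem. *)
Lemma fact_pass_ok (M : mtt) (s t : tree) (v q m root : nat) (ss : list tree) (r : rhs) (S : st) :
  wf_mtt M -> wf_tree (outp M) t -> RuleCtx M s t v q m ss r root S -> calls_set M s t ss root (rsize r) S -> productive M ss r ->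
  tri fact_pass S (150 * (tsize t ^ (V S vMX + 1) * (tsize t ^ (V S vMX + 1) * rsize r))) (fun S' =>
    (forall o, A S' aF (V S 27 + o) <> 0 <-> A S aF (V S 27 + o) <> 0 \/
       exists c, c < tsize t ^ (m + 1) /\ o = m + 1 + c /\ fact_gen M t ss m r c) /\
    block_only (V S 27) (block_len t m) S S' /\ (tsize t = 1 -> forall j, A S' aEN j = 0)).
Proof.
  intros HM Ht HR HC Hpr. assert (HS := rc_static _ _ _ _ _ _ _ _ _ _ HR). assert (Hat := rc_at _ _ _ _ _ _ _ _ _ _ HR).
  set (b := V S 27) in *. assert (Hb := rc_base _ _ _ _ _ _ _ _ _ _ HR). fold b in Hb.
  set (n := tsize t) in *. assert (Hn : 1 <= n) by apply tsize_pos.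
  assert (Hm := RuleCtx_rank _ _ _ _ _ _ _ _ _ _ HR).
  set (X := n ^ (V S vMX + 1)).
  assert (HX1 : n ^ (m + 1) <= X) by (apply Nat.pow_le_mono_r; lia).
  assert (HX2 : n ^ m <= X) by (apply Nat.pow_le_mono_r; lia).
  assert (HX : 1 <= X) by (unfold X; pose proof (Nat.pow_nonzero n (V S vMX + 1)); lia).
  assert (Hsz : 1 <= rsize r) by (rewrite <- nsize_rhs; apply nsize_pos).
  assert (HXr : X <= X * rsize r) by nia.
  destruct (nt_rhs r) as [rk ra rc rxs] eqn:Er.
  destruct (node_at _ _ _ _ _ _ _ _ _ HS Hat) as (_ & _ & _ & _ & NV & _). rewrite <- Er in Hat. clear Er.
  eapply tri_for with (n := n ^ (m + 1)) (f := fun _ => 130 * (X * rsize r))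
    (Inv := fun c S' => (forall o, A S' aF (b + o) <> 0 <-> A S aF (b + o) <> 0 \/
       exists c', c' < c /\ o = m + 1 + c' /\ fact_gen M t ss m r c') /\
      block_only b (block_len t m) S S' /\ (n = 1 -> forall j, A S' aEN j = 0)).
  - reflexivity.
  - vs. rewrite (rc_rank _ _ _ _ _ _ _ _ _ _ HR). apply (st_pow _ _ _ _ HS). lia.
  - split; [|split; [intros x _; reflexivity|]].
    + intros o. vs. split; [auto|]. intros [H|(c' & Hc' & _)]; [auto|lia].
    + apply (rc_digits _ _ _ _ _ _ _ _ _ _ HR).
  - intros c S1 Hc F1 Vc (I1 & I2 & I3).
    assert (HR1 : RuleCtx M s t v q m ss r root S1).
    { eapply RuleCtx_frame; [exact F1|reflexivity|reflexivity|rewrite <- Hb; auto|auto|auto]. }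
    assert (HC1 : calls_set M s t ss root (rsize r) S1) by (eapply calls_set_frame; [exact F1|reflexivity|auto]).
    assert (E5 : V S1 5 = V S 5) by (norm; auto). assert (E7 : V S1 7 = V S 7) by (norm; auto).
    assert (HS1 := rc_static _ _ _ _ _ _ _ _ _ _ HR1).
    assert (HM0 : A S1 aMO c = dig n c 0).
    { unfold dig. rewrite Nat.pow_0_r, Nat.div_1_r. apply (st_divmod _ _ _ _ HS1). rewrite E5. fold n X. lia. }
    eapply tri_conseq with (k := Datatypes.S (129 * (X * rsize r))); [|lia|intros ? _ HQ0; exact HQ0].
    apply tri_asn_seq. cbn [ev]. rewrite Vc, HM0.
    eapply tri_seq with (k2 := 100 * (X * rsize r) + 5); [eapply env_fill_ok with (m := m) (c := c)| |].
    + eapply static_frame with (vs := [41]) (bs := []); [|reflexivity|reflexivity|exact HS1].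
      split; auto. intros x Hx. simpl in *. unfold upd. destruct (Nat.eqb x 41); auto; discriminate.
    + vs. apply HR1.
    + vs. auto.
    + vs. rewrite E5. auto.
    + auto.
    + vs. auto.
    + intros S2 F2 [K1 K2].
      assert (HS2 : Static M s t S2).
      { eapply static_frame; [exact F2|reflexivity|reflexivity|].
        eapply static_frame with (vs := [41]) (bs := []); [|reflexivity|reflexivity|exact HS1].
        split; auto. intros x Hx. simpl in *. unfold upd. destruct (Nat.eqb x 41); auto; discriminate. }
      set (E := erase (sub_at t (dig n c 0)) (digit_trees t c m)).
      assert (HF2 : forall x, A S2 aF x = A S1 aF x) by (intros; rewrite (proj2 F2 17 eq_refl); auto).
      assert (HV2 : forall x, memb x [5; 7; 25; 26; 27; 28; 40] = true -> V S2 x = V S1 x).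
      { intros x Hx. rewrite (proj1 F2 x).
        - vs. apply upd_neq. intros ->. discriminate.
        - eapply (disjoint_b_memb [5; 7; 25; 26; 27; 28; 40]); [reflexivity|exact Hx]. }
      assert (E41 : V S2 41 = dig n c 0) by (rewrite (proj1 F2 41 eq_refl); vs; auto).
      (* The only delicate field is [ec_env]: a digit whose subtree equals the target is erased to
         [FY 0], which is no tree, so both sides of the equivalence fail. *)
      assert (HE : EvalCtx M s t ss E r m root S2).
      { constructor; rewrite ?HV2 by reflexivity; try apply HR1; auto.
        - intros g q' i us Hg Hg'. destruct (calls_callee M s t v q m root ss r S1 g q' i us) as [[C1 C2] _]; auto.
          assert (ECB : A S2 aCB g = A S1 aCB g) by (rewrite (proj2 F2 19 eq_refl); auto).
          split; intros; rewrite ECB, HF2; auto.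
        - rewrite E41. apply dig_lt. fold n. lia.
        - intros j Hj. rewrite K1 by auto. apply dig_lt. fold n. lia.
        - intros j t' Hj. rewrite E41, K1 by auto. unfold E, erase.
          rewrite (nth_map_gen _ _ _ t) by (rewrite length_digit_trees; lia).
          rewrite nth_digit_trees by lia. replace (Datatypes.S (j - 1)) with j by lia. fold n.
          destruct (tree_eq_dec (sub_at t (dig n c j)) (sub_at t (dig n c 0))) as [Eq|Nq].
          + split; [intros H; symmetry in H; exfalso; eapply form_of_tree_y; eauto|].
            intros [H1 H2]. congruence.
          + split; [intros H; apply form_of_tree_inj in H; subst; auto|]. intros [H1 _]. congruence. }
      eapply tri_seq with (k1 := 100 * (X * rsize r) + 2) (k2 := 2)
        (Q1 := fun S' => row_is M t ss E r S' root); [| |lia].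
      { eapply tri_conseq; [eapply eval_pass_ok; eauto| |auto]. rewrite HV2 by reflexivity. rewrite E5. fold n X. lia. }
      intros S3 F3 HRow. unfold row_is in HRow.
      assert (Hcell : ev (Arr aVV (cell (Var 25) (Var 41))) S3 <> 0 <-> fact_gen M t ss m r c).
      { unfold cell. cbn [ev]. rewrite (proj1 F3 25 eq_refl), (proj1 F3 41 eq_refl), (proj2 F3 10 eq_refl).
        rewrite E41, HV2, (proj2 F2 10 eq_refl) by reflexivity. cbn [A]. rewrite (proj2 F1 10 eq_refl). cbn [A setv].
        rewrite (rc_root _ _ _ _ _ _ _ _ _ _ HR1), NV. rewrite HRow by (apply dig_lt; fold n; lia). reflexivity. }
      assert (HF3 : forall x, A S3 aF x = A S1 aF x) by (intros; rewrite (proj2 F3 17 eq_refl); auto).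
      assert (HN3 : forall j, A S3 aEN j = A S2 aEN j) by (intros; rewrite (proj2 F3 21 eq_refl); auto).
      apply tri_if; intros Hc1.
      * apply tri_sto; auto.
        assert (EA : forall x, A (St (V S3) (updA (A S3) aF (ev (Add (Add (Var 27) (Var 28)) (Add (Cst 1) (Var 40))) S3) 1)) aF x =
              if Nat.eqb x (b + (m + 1 + c)) then 1 else A S1 aF x).
        { intros x. cbn [A updA Nat.eqb ev]. rewrite HF3, !(proj1 F3) by reflexivity. rewrite !HV2 by reflexivity.
          rewrite (rc_rank _ _ _ _ _ _ _ _ _ _ HR1), (rc_base _ _ _ _ _ _ _ _ _ _ HR1), Vc, E7.
          rewrite (proj2 F1 12 eq_refl). cbn [A setv]. rewrite <- Hb.
          replace (b + m + (1 + c)) with (b + (m + 1 + c)) by lia. auto. }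
        split; [|split].
        -- intros o. transitivity ((if Nat.eqb (b + o) (b + (m + 1 + c)) then 1 else A S1 aF (b + o)) <> 0); [rewrite <- EA; reflexivity|].
           rewrite ex_lt_S. destruct (Nat.eqb_spec (b + o) (b + (m + 1 + c))) as [Eo|No].
           ++ split; [|lia]. intros _. right. right. split; [lia|]. apply Hcell; auto.
           ++ rewrite I1. split; [tauto|]. intros [H|[H|[H _]]]; auto.
        -- intros x Hx. etransitivity; [apply EA|]. destruct (Nat.eqb_spec x (b + (m + 1 + c))); [|apply I2; auto].
           unfold block_len in Hx. fold n in Hx. lia.
        -- intros Hn1 j. vs. rewrite HN3. auto.
      * apply tri_skip. split; [|split].
        -- intros o. vs. rewrite HF3, ex_lt_S, I1. split; [tauto|]. intros [H|[H|[_ H]]]; auto. apply Hcell in H. contradiction.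
        -- intros x Hx. vs. rewrite HF3. auto.
        -- intros Hn1 j. vs. rewrite HN3. auto.
    + fold n. nia.
  - rewrite sumf_const. nia.
  - intros S1 F1 (I1 & I2 & I3). auto.
Qed.

(** * Processing one input node, and the pass over the input tree *)

Record NodeCtx (M : mtt) (s t : tree) (v sg : nat) (ss : list tree) (S : st) : Prop := {
  nc_static : Static M s t S;
  nc_pos : V S 21 = v;
  nc_row : V S 22 = v * V S vW;
  nc_sym : A S aSY v = sg;
  nc_ss : Forall (wf_tree (inp M)) ss;
  nc_rank : In (sg, length ss) (inp M);
  nc_child : forall i, 1 <= i <= length ss -> exists c, v < c /\ A S aCH i = c * V S vW /\
    forall q' m', A S aRK q' = Datatypes.S m' ->
      block_ok M t (nth (i - 1) ss (Node 0 [])) q' m' S (c * V S vW + A S aQB q');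
  nc_digits : tsize t = 1 -> forall j, A S aEN j = 0
}.

Lemma static_split (l l' bs : list nat) : disjoint_b (l ++ l') bs = true -> disjoint_b l bs = true.
Proof. unfold disjoint_b. rewrite forallb_app. intros H. apply andb_prop in H. tauto. Qed.

Lemma NodeCtx_frame (M : mtt) (s t : tree) (v sg : nat) (ss : list tree) (S S' : st) (vs bs : list nat) :
  frame vs bs S S' -> disjoint_b (static_vars ++ [21; 22]) vs = true ->
  disjoint_b (static_arrs ++ [18]) bs = true ->
  (forall x, v * V S vW + V S vW <= x -> A S' aF x = A S aF x) ->
  (tsize t = 1 -> forall j, A S' aEN j = 0) ->
  NodeCtx M s t v sg ss S -> NodeCtx M s t v sg ss S'.
Proof.
  intros F D1 D2 HB HE []. assert (F0 := F). destruct F as [F1 F2].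
  assert (HV : forall x, memb x (static_vars ++ [21; 22]) = true -> V S' x = V S x).
  { intros x Hx. apply F1. eapply disjoint_b_memb; eauto. }
  assert (HA : forall a, memb a (static_arrs ++ [18]) = true -> forall i, A S' a i = A S a i).
  { intros x Hx. apply F2. eapply disjoint_b_memb; eauto. }
  constructor; intros; rewrite ?(HV 21), ?(HV 22), ?(HV 7), ?(HA 2), ?(HA 18) by reflexivity; auto.
  - eapply static_frame; eauto; eapply static_split; eauto.
  - destruct (nc_child0 i H) as (c & Hc & HCH & Hblk). exists c. split; auto. split; auto.
    intros q' m' Hq' o Ho. rewrite (HA 9) in Hq' by reflexivity. rewrite (HA 12) by reflexivity. rewrite HB.
    + apply Hblk; auto.
    + nia.
Qed.

(** Each kind of bit presupposes some value of the right-hand side; so skipping an unproductive rule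
    loses nothing. *)
Lemma rule_cell_productive (M : mtt) (t : tree) (ss : list tree) (m o : nat) (r : rhs) :
  rule_cell M t ss m r o -> productive M ss r.
Proof.
  intros [[_ H]|[[_ H]|(c & _ & f & H & _)]]; auto; eexists; eauto.
Qed.

Lemma frame_asn (s : st) (x v : nat) : frame [x] [] s (St (upd (V s) x v) (A s)).
Proof. split; auto. intros y Hy. simpl in *. unfold upd. destruct (Nat.eqb y x); auto; discriminate. Qed.

Lemma frame_sto (s : st) (a i v : nat) : frame [] [a] s (St (V s) (updA (A s) a i v)).
Proof. split; auto. intros b Hb j. simpl in *. destruct (Nat.eqb b a); auto; discriminate. Qed.

Lemma block_in_row (M : mtt) (s t : tree) (S : st) (q m : nat) :
  Static M s t S -> A S aRK q = Datatypes.S m -> A S aQB q + block_len t m <= V S vW.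
Proof.
  intros HS HR. destruct (st_rank _ _ _ _ HS q) as (m' & E & _ & _ & Hle); [congruence|].
  rewrite HR in E. injection E as <-. exact Hle.
Qed.

Lemma rule_step_ok (M : mtt) (s t : tree) (v q m sg rho : nat) (ss : list tree) (r : rhs) (S : st) :
  wf_mtt M -> wf_tree (outp M) t -> NodeCtx M s t v sg ss S -> V S 23 = rho -> rho < length (rules M) ->
  nth rho (rules M) rule0 = (q, sg, r) -> A S aRK q = Datatypes.S m ->
  tri rule_step S (250 * (tsize t ^ (V S vMX + 1) * (tsize t ^ (V S vMX + 1) * rsize r))) (fun S' =>
    NodeCtx M s t v sg ss S' /\ block_only (v * V S vW + A S aQB q) (block_len t m) S S' /\
    forall o, o < block_len t m -> (A S' aF (v * V S vW + A S aQB q + o) <> 0 <->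
      A S aF (v * V S vW + A S aQB q + o) <> 0 \/ rule_cell M t ss m r o)).
Proof.
  intros HM Ht HN Hrho Hlt Hrule HRK. assert (HS := nc_static _ _ _ _ _ _ _ HN).
  destruct (st_rule _ _ _ _ HS rho Hlt) as (E1 & _ & E3). rewrite Hrule in E1. simpl in E1.
  pose proof (rule_at M s t rho Hlt) as Hat. rewrite Hrule in Hat. simpl in Hat.
  set (root := rule_pos M s t rho) in *.
  set (X := tsize t ^ (V S vMX + 1)).
  assert (HX : 1 <= X).
  { unfold X. pose proof (tsize_pos t). pose proof (Nat.pow_nonzero (tsize t) (V S vMX + 1)). lia. }
  assert (Hsz : 1 <= rsize r) by (rewrite <- nsize_rhs; apply nsize_pos).
  assert (Hin : In (q, sg, r) (rules M)) by (rewrite <- Hrule; apply nth_In; auto).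
  assert (Hqm : In (q, m) (states M)).
  { destruct (st_rank _ _ _ _ HS q) as (m' & E & H & _); [congruence|]. rewrite HRK in E. injection E as <-. auto. }
  assert (HL := block_in_row _ _ _ _ _ _ HS HRK).
  set (b := v * V S vW + A S aQB q) in *.
  assert (HXX : rsize r <= X * (X * rsize r)).
  { assert (rsize r <= X * rsize r) by nia. assert (X * rsize r <= X * (X * rsize r)) by nia. lia. }
  eapply tri_conseq with (k := 5 + (5 + 10 * rsize r + (1 + (50 * rsize r + 150 * (X * (X * rsize r)))))); [|lia|intros ? _ HQ0; exact HQ0].
  do 5 (apply tri_asn_seq; vs).
  rewrite Hrho, E1, E3, (nc_row _ _ _ _ _ _ _ HN), (st_next _ _ _ _ HS _ _ Hat), nsize_rhs, HRK. fold b.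
  replace (root + rsize r - root) with (rsize r) by lia. replace (Datatypes.S m - 1) with m by lia.
  match goal with |- tri _ ?X _ _ => remember X as S0 eqn:ES0 end.
  assert (F0 : frame [24; 25; 26; 27; 28] [] S S0).
  { rewrite ES0. split; auto. intros x Hx. cbn [V]. unfold upd. simpl in Hx.
    destruct (Nat.eqb x 24), (Nat.eqb x 25), (Nat.eqb x 26), (Nat.eqb x 27), (Nat.eqb x 28); try discriminate; auto. }
  assert (HR0 : RuleCtx M s t v q m ss r root S0).
  { constructor; try (rewrite ES0; vs; auto; fail).
    - eapply static_frame; eauto.
    - exact Hat.
    - eapply rule_wf; eauto. apply (nc_rank _ _ _ _ _ _ _ HN).
    - apply (nc_ss _ _ _ _ _ _ _ HN).
    - rewrite ES0. apply (nc_child _ _ _ _ _ _ _ HN).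
    - rewrite ES0. apply (nc_digits _ _ _ _ _ _ _ HN). }
  assert (E27 : V S0 27 = b) by (rewrite ES0; reflexivity).
  assert (E0 : forall x, A S0 aF x = A S aF x) by (rewrite ES0; reflexivity).
  assert (E5 : V S0 5 = V S 5) by (rewrite ES0; reflexivity).
  assert (E7 : V S0 7 = V S 7) by (rewrite ES0; reflexivity).
  assert (E12 : forall x, A S0 12 x = A S 12 x) by (rewrite ES0; reflexivity).
  clear ES0.
  (* The common end of both branches, productive or not. The lists name all variables and arrays
     that a rule may write. *)
  assert (Fin : forall S', frame [24;25;26;27;28;29;30;31;32;33;40;41;42;43;50;51;52;53;54;55;56;57;58;59;60;61;62] [17;19;20;21;22] S0 S' ->
    block_only b (block_len t m) S0 S' -> (tsize t = 1 -> forall j, A S' aEN j = 0) ->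
    (forall o, o < block_len t m -> (A S' aF (b + o) <> 0 <-> A S0 aF (b + o) <> 0 \/ rule_cell M t ss m r o)) ->
    NodeCtx M s t v sg ss S' /\ block_only b (block_len t m) S S' /\
    forall o, o < block_len t m -> (A S' aF (b + o) <> 0 <-> A S aF (b + o) <> 0 \/ rule_cell M t ss m r o)).
  { intros S' F HB HE Ho. split; [|split].
    - eapply NodeCtx_frame with (S := S).
      + eapply frame_trans; [eapply frame_weaken; [exact F0|..]|exact F]; reflexivity.
      + reflexivity.
      + reflexivity.
      + intros x Hx. rewrite HB; [apply E0|]. right. unfold b. lia.
      + auto.
      + auto.
    - intros x Hx. rewrite HB; auto.
    - intros o Hlo. rewrite <- E0. auto. }
  eapply tri_seq with (k2 := Datatypes.S (Datatypes.S (3 + 40 * rsize r + 150 * (X * (X * rsize r))))); [eapply calls_pass_ok; eauto| |].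
  - intros S1 F1 (HR1 & HC1 & HP1).
    assert (E1F : forall x, A S1 aF x = A S0 aF x) by (intros; norm; auto).
    apply tri_if; cbn [ev]; intros H29.
    + apply HP1 in H29. rename H29 into Hp. apply tri_sto_seq. cbn [ev].
      assert (E27' : V S1 27 = b) by (norm; auto). rewrite E27'.
      match goal with |- tri _ ?X _ _ => set (S2 := X) end.
      assert (F2 : frame [] [17] S1 S2) by apply frame_sto.
      assert (E12' : v * V S1 7 + A S1 12 q = b) by (norm; auto).
      assert (HR2 : RuleCtx M s t v q m ss r root S2).
      { eapply RuleCtx_frame; [exact F2|reflexivity|reflexivity| | |exact HR1].
        - rewrite E12'. intros x Hx. unfold S2. vs. destruct (Nat.eqb_spec x b); auto. unfold block_len in Hx. lia.
        - intros Hn j. unfold S2. vs. apply (rc_digits _ _ _ _ _ _ _ _ _ _ HR1); auto. }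
      assert (HC2 : calls_set M s t ss root (rsize r) S2) by (eapply calls_set_frame; [exact F2|reflexivity|auto]).
      assert (E2F : forall x, A S2 aF x = if Nat.eqb x b then 1 else A S0 aF x).
      { intros x. unfold S2. vs. rewrite E1F. auto. }
      assert (E27'' : V S2 27 = b) by (unfold S2; vs; auto).
      eapply tri_seq with (k2 := 150 * (X * (X * rsize r))); [eapply mark_pass_ok; eauto| |].
      * intros S3 F3 [HF3 HB3]. rewrite E27'' in HF3, HB3.
        assert (HR3 : RuleCtx M s t v q m ss r root S3).
        { eapply RuleCtx_frame; [exact F3|reflexivity|reflexivity| | |exact HR2].
          - assert (v * V S2 7 + A S2 12 q = b) as -> by (unfold S2; vs; auto). auto.
          - intros Hn j. norm. apply (nc_digits _ _ _ _ _ _ _ HN); auto. }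
        assert (HC3 : calls_set M s t ss root (rsize r) S3) by (eapply calls_set_frame; [exact F3|reflexivity|auto]).
        assert (E3' : V S3 27 = b) by (norm; auto).
        assert (E5' : V S3 5 = V S 5) by (rewrite (proj1 F3 5 eq_refl); unfold S2; vs; rewrite (proj1 F1 5 eq_refl); auto).
        eapply tri_conseq; [eapply fact_pass_ok; eauto| |].
        -- rewrite E5'. fold X. apply Nat.le_refl.
        -- intros S4 F4 (HF4 & HB4 & HE4). rewrite E3' in HF4, HB4. apply Fin; auto.
           ++ eapply frame_trans; [eapply frame_weaken; [exact F1|..]|]; try reflexivity.
              eapply frame_trans; [eapply frame_weaken; [exact F2|..]|]; try reflexivity.
              eapply frame_trans; [eapply frame_weaken; [exact F3|..]|]; try reflexivity.
              eapply frame_weaken; [exact F4|..]; reflexivity.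
           ++ intros x Hx. rewrite HB4, HB3, E2F by auto. destruct (Nat.eqb_spec x b); auto. unfold block_len in Hx. lia.
           ++ intros o Ho. rewrite HF4, HF3, E2F. unfold rule_cell.
              assert (H0 : (if Nat.eqb (b + o) b then 1 else A S0 aF (b + o)) <> 0 <-> A S0 aF (b + o) <> 0 \/ o = 0 /\ productive M ss r).
              { destruct (Nat.eqb_spec (b + o) b); split; auto; try lia. intros _. right. split; auto. lia. }
              assert (H1 : (exists c, c < tsize t ^ (m + 1) /\ o = m + 1 + c /\ fact_gen M t ss m r c) <->
                 exists c, o = m + 1 + c /\ fact_gen M t ss m r c).
              { split; intros (c & Hc); exists c; [tauto|]. unfold block_len in Ho. split; [lia|tauto]. }
              rewrite H0, H1. clear. tauto.
      * apply Nat.le_refl.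
    + apply tri_skip. apply Fin.
      * eapply frame_weaken; [exact F1|..]; reflexivity.
      * intros x _. auto.
      * intros Hn j. apply (rc_digits _ _ _ _ _ _ _ _ _ _ HR1); auto.
      * intros o _. rewrite E1F. split; [auto|]. intros [H|H]; auto. apply rule_cell_productive in H. exfalso. apply HP1 in H. auto.
  - lia.
Qed.

Lemma msize_sumf (M : mtt) : sumf (length (rules M)) (fun i => rsize (snd (nth i (rules M) rule0))) = msize M.
Proof.
  unfold msize. induction (rules M) as [|x l IH]; auto.
  cbn [length]. rewrite sumf_shift. simpl. rewrite IH. auto.
Qed.

Lemma ranked_cell_unique (M : mtt) (s t : tree) (S : st) (v q q' m m' o o' : nat) :
  Static M s t S -> A S aRK q = Datatypes.S m -> A S aRK q' = Datatypes.S m' -> q <> q' ->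
  o < block_len t m ->
  v * V S vW + A S aQB q + o < v * V S vW + A S aQB q' \/
  v * V S vW + A S aQB q' + block_len t m' <= v * V S vW + A S aQB q + o.
Proof.
  intros HS H1 H2 Hne Ho. unfold block_len in *.
  destruct (st_sep _ _ _ _ HS q q' m m' H1 H2 Hne); lia.
Qed.

(** Nondeterminism is a disjunction over rules: bits are set but never cleared, so the row has to
    start at zero. Summing the sizes of the right-hand sides produces the factor [msize M]. *)
Lemma rules_pass_ok (M : mtt) (s t : tree) (v sg : nat) (ss : list tree) (S : st) :
  wf_mtt M -> wf_tree (outp M) t -> NodeCtx M s t v sg ss S ->
  (forall x, x < v * V S vW + V S vW -> A S aF x = 0) ->
  tri rules_pass S (2 + (8 * length (rules M) + 250 * (tsize t ^ (V S vMX + 1) * (tsize t ^ (V S vMX + 1) * msize M)))) (fun S' =>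
    NodeCtx M s t v sg ss S' /\ (forall x, x < v * V S vW \/ v * V S vW + V S vW <= x -> A S' aF x = A S aF x) /\
    forall q m, A S aRK q = Datatypes.S m -> block_ok M t (Node sg ss) q m S' (v * V S vW + A S aQB q)).
Proof.
  intros HM Ht HN HZ. assert (HS := nc_static _ _ _ _ _ _ _ HN).
  set (X := tsize t ^ (V S vMX + 1)).
  eapply tri_for with (n := length (rules M)) (f := fun i => 6 + 250 * (X * (X * rsize (snd (nth i (rules M) rule0)))))
    (Inv := fun i S' => NodeCtx M s t v sg ss S' /\
      (forall x, x < v * V S vW \/ v * V S vW + V S vW <= x -> A S' aF x = A S aF x) /\
      (forall q m o, A S aRK q = Datatypes.S m -> o < block_len t m -> (A S' aF (v * V S vW + A S aQB q + o) <> 0 <->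
         exists i', i' < i /\ exists r, nth i' (rules M) rule0 = (q, sg, r) /\ rule_cell M t ss m r o))).
  - reflexivity.
  - vs. apply (st_NR _ _ _ _ HS).
  - split; [|split].
    + eapply NodeCtx_frame; [apply (frame_asn S 23 0)|reflexivity|reflexivity| |apply HN|exact HN]. auto.
    + auto.
    + intros q m o Hq Ho. vs. split.
      * intros H. exfalso. apply H. apply HZ. pose proof (block_in_row _ _ _ _ _ _ HS Hq). lia.
      * intros (i' & H & _). lia.
  - intros i S1 Hi F1 Vi (I1 & I2 & I3).
    assert (HS1 := nc_static _ _ _ _ _ _ _ I1).
    assert (E7 : V S1 7 = V S 7) by (norm; auto). assert (E5 : V S1 5 = V S 5) by (norm; auto).
    assert (E12 : forall x, A S1 12 x = A S 12 x) by (intros; norm; auto).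
    assert (E9 : forall x, A S1 9 x = A S 9 x) by (intros; norm; auto).
    destruct (nth i (rules M) rule0) as [[q sg'] r] eqn:Er.
    destruct (st_rule _ _ _ _ HS1 i Hi) as (R1 & R2 & _). rewrite Er in R1, R2. cbn [fst snd] in R1, R2 |- *.
    assert (Fin : forall S2, NodeCtx M s t v sg ss S2 -> (forall x, A S2 aF x = A S1 aF x) -> (sg' <> sg \/ A S aRK q = 0) ->
      NodeCtx M s t v sg ss (setv S2 23 (Datatypes.S i)) /\
      (forall x, x < v * V S vW \/ v * V S vW + V S vW <= x -> A (setv S2 23 (Datatypes.S i)) aF x = A S aF x) /\
      (forall q m o, A S aRK q = Datatypes.S m -> o < block_len t m -> (A (setv S2 23 (Datatypes.S i)) aF (v * V S vW + A S aQB q + o) <> 0 <->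
         exists i', i' < Datatypes.S i /\ exists r, nth i' (rules M) rule0 = (q, sg, r) /\ rule_cell M t ss m r o))).
    { intros S2 H1 H2 H3. split; [|split].
      - eapply NodeCtx_frame; [apply (frame_asn S2 23)|reflexivity|reflexivity| |apply H1|exact H1]. auto.
      - intros x Hx. vs. rewrite H2. auto.
      - intros q1 m1 o Hq1 Ho. vs. rewrite H2, (I3 q1 m1 o Hq1 Ho), ex_lt_S. split; [auto|]. intros [H|(r1 & H & _)]; auto.
        rewrite Er in H. injection H as <- <- <-. destruct H3; congruence. }
    eapply tri_conseq with (k := Datatypes.S (Datatypes.S (250 * (X * (X * rsize r))))); [|lia|intros ? _ HQ0; exact HQ0].
    apply tri_if; intros H1.
    + apply tri_skip. apply Fin; auto. left. intros ->. apply H1. apply ev_neq. vs. rewrite Vi, R2, (nc_pos _ _ _ _ _ _ _ I1), (nc_sym _ _ _ _ _ _ _ I1). auto.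
    + apply ev_neq in H1. revert H1. vs. rewrite Vi, R2, (nc_pos _ _ _ _ _ _ _ I1), (nc_sym _ _ _ _ _ _ _ I1). intros ->.
      apply tri_if; vs; rewrite Vi, R1; intros H2.
      * destruct (A S1 9 q) as [|m] eqn:Eq; [congruence|].
        eapply tri_conseq; [eapply rule_step_ok with (rho := i) (r := r) (q := q); eauto| |].
        -- rewrite E5. apply Nat.le_refl.
        -- intros S2 F2 (H3 & H4 & H5). rewrite E7, E12 in H4, H5.
           assert (HL := block_in_row _ _ _ _ _ _ HS1 Eq). rewrite E12, E7 in HL.
           assert (EqS : A S 9 q = Datatypes.S m) by (rewrite <- E9; auto).
           split; [|split].
           ++ eapply NodeCtx_frame; [apply (frame_asn S2 23)|reflexivity|reflexivity| |apply H3|exact H3]. auto.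
           ++ intros x Hx. vs. rewrite H4 by lia. auto.
           ++ intros q1 m1 o Hq1 Ho. vs. rewrite ex_lt_S. destruct (Nat.eq_dec q1 q) as [->|Nq].
              ** assert (m1 = m) by congruence. subst m1. rewrite H5, (I3 q m o Hq1 Ho) by auto. rewrite Er.
                 split; [intros [H|H]; [auto|right; eauto]|]. intros [H|(r1 & H & H')]; auto. injection H as <-. auto.
              ** rewrite H4 by (eapply ranked_cell_unique; eauto). rewrite (I3 q1 m1 o Hq1 Ho). rewrite Er.
                 split; [auto|]. intros [H|(r1 & H & _)]; auto. injection H as -> _. congruence.
      * apply tri_skip. apply Fin; auto. right. rewrite <- E9. auto.
  - rewrite sumf_add, sumf_const. rewrite (sumf_mul _ 250).
    assert (E : sumf (length (rules M)) (fun i => X * (X * rsize (snd (nth i (rules M) rule0)))) = X * (X * msize M)).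
    { rewrite <- msize_sumf, <- !sumf_mul. auto. }
    rewrite E. lia.
  - intros S1 F1 (I1 & I2 & I3). split; auto. split; auto. intros q m Hq o Ho. rewrite (I3 q m o Hq Ho). split.
    + intros (i & Hi & r & Hr & Hc). exists r, ss. split; auto. exists sg. split; auto. rewrite <- Hr. apply nth_In; auto.
    + intros (r & ss' & (sg' & E & Hin) & Hc). injection E as <- <-. apply In_nth with (d := rule0) in Hin as (i & Hi & Hr).
      exists i. split; auto. exists r. auto.
Qed.

Lemma children_pass_ok (M : mtt) (s t : tree) (S : st) (j sg : nat) (ss : list tree) :
  Static M s t S -> j < tsize s -> V S 21 = tsize t + j -> sub_at s j = Node sg ss ->
  tri children_pass S (3 + 4 * length ss) (fun S' => forall i, 1 <= i <= length ss ->
    A S' aCH i = (tsize t + cpos (Datatypes.S j) (map nt_tree ss) (i - 1)) * V S vW).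
Proof.
  intros HS Hj H21 Ej. pose proof (input_at M s t j Hj) as Hat. rewrite Ej in Hat. simpl in Hat.
  destruct (node_at _ _ _ _ _ _ _ _ _ HS Hat) as (_ & _ & _ & NA & _). rewrite length_map in NA.
  assert (Ec : forall i, cpos (Datatypes.S (tsize t + j)) (map nt_tree ss) i = tsize t + cpos (Datatypes.S j) (map nt_tree ss) i).
  { intros i. unfold cpos. lia. }
  do 2 (apply tri_asn_seq; vs).
  eapply tri_rep with (n := length ss) (f := fun _ => 3)
    (Inv := fun i S' => V S' 32 = cpos (Datatypes.S (tsize t + j)) (map nt_tree ss) i /\ V S' 33 = Datatypes.S i /\
       forall i', 1 <= i' <= i -> A S' aCH i' = (tsize t + cpos (Datatypes.S j) (map nt_tree ss) (i' - 1)) * V S vW).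
  - vs. rewrite H21. auto.
  - vs. rewrite H21, Nat.add_1_r, cpos_0. split; auto. split; auto. intros; lia.
  - intros i S1 Hi F1 (J1 & J2 & J3).
    assert (Hi' : i < length (map nt_tree ss)) by now rewrite length_map.
    destruct (next_child _ _ _ _ _ _ _ _ _ i HS Hat Hi') as [NX _].
    pose proof (child_at _ _ _ _ _ _ i (nt_tree s) Hat Hi') as Hc.
    destruct (nth i (map nt_tree ss) (nt_tree s)) as [k a c xs]. destruct (node_at _ _ _ _ _ _ _ _ _ HS Hc) as (_ & _ & _ & _ & _ & NR).
    apply tri_sto_seq. vs. apply tri_asn_seq. vs. apply tri_asn; auto. vs. split; [|split].
    + norm. rewrite J1. auto.
    + rewrite J2. lia.
    + intros i' Hi''. norm. rewrite J1, J2, NR. destruct (Nat.eqb_spec i' (Datatypes.S i)) as [->|N].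
      * rewrite Ec. replace (Datatypes.S i - 1) with i by lia. auto.
      * apply J3. lia.
  - rewrite sumf_const. lia.
  - intros S1 F1 (J1 & J2 & J3). auto.
Qed.

(** The invariant keeps the rows below the current node zero and those from it on complete. Fetching
    the children costs the arity of the node, which amortises over [s]. *)
Lemma main_pass_ok (M : mtt) (s t : tree) (S : st) :
  wf_mtt M -> wf_tree (inp M) s -> wf_tree (outp M) t -> Static M s t S ->
  (forall x, A S aF x = 0) -> (forall x, A S aEN x = 0) ->
  tri main_pass S (2 + tsize s * (20 + 8 * length (rules M) + 250 * (tsize t ^ (V S vMX + 1) * (tsize t ^ (V S vMX + 1) * msize M)))) (fun S' =>
    block_ok M t s (q0 M) 0 S' (tsize t * V S vW + A S aQB (q0 M))).
Proof.
  intros HM Hs Ht HS HF HE.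
  set (Y := 8 * length (rules M) + 250 * (tsize t ^ (V S vMX + 1) * (tsize t ^ (V S vMX + 1) * msize M))).
  set (ar := fun j => narity (nth (tsize t + j) (nodes M s t) node0)).
  assert (Hsum : sumf (tsize s) (fun j => (14 + Y) + 4 * ar j) <= tsize s * (18 + Y)).
  { rewrite sumf_add, sumf_const, sumf_mul. pose proof (tsize_pos s) as Hp. pose proof (input_at M s t 0 Hp) as Ha.
    rewrite Nat.add_0_r in Ha. apply at_arity_sum in Ha. unfold sub_at in Ha.
    assert (E0 : nth 0 (subs s) s = s) by (destruct s; reflexivity). rewrite E0, nsize_tree in Ha. fold ar in Ha. nia. }
  eapply tri_down with (n := tsize s) (f := fun j => (14 + Y) + 4 * ar j)
    (Inv := fun i S' => (forall x, x < (tsize t + i) * V S vW -> A S' aF x = 0) /\ (tsize t = 1 -> forall j, A S' aEN j = 0) /\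
      forall j q m, i <= j < tsize s -> A S aRK q = Datatypes.S m -> block_ok M t (sub_at s j) q m S' ((tsize t + j) * V S vW + A S aQB q)).
  - reflexivity.
  - intros i s0 v H. exact H.
  - vs. rewrite (st_n _ _ _ _ HS), (st_ns _ _ _ _ HS). lia.
  - split; [auto|]. split; [auto|]. intros; lia.
  - intros j S1 Hj F1 Vj (I1 & I2 & I3).
    destruct (sub_at s j) as [sg ss] eqn:Ej.
    pose proof (input_at M s t j Hj) as Hat. rewrite Ej in Hat. simpl in Hat.
    destruct (node_at _ _ _ _ _ _ _ _ _ HS Hat) as (_ & NS & _ & _ & _ & NR).
    assert (Har : ar j = length ss).
    { unfold ar. apply at_node in Hat as [-> _]. simpl. apply length_map. }
    assert (Hwf : wf_tree (inp M) (Node sg ss)) by (rewrite <- Ej; eapply subs_wf; eauto; apply sub_at_In; auto).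
    eapply tri_conseq with (k := 2 + (5 + 4 * length ss + Y)); [|rewrite Har; lia|intros ? _ HQ0; exact HQ0].
    do 2 (apply tri_asn_seq; vs).
    match goal with |- tri _ ?X _ _ => remember X as S2 eqn:ES2 end.
    assert (F2 : frame [21; 22] [] S1 S2).
    { rewrite ES2. split; auto. intros x Hx. cbn [V]. unfold upd. simpl in Hx.
      destruct (Nat.eqb x 21), (Nat.eqb x 22); try discriminate; auto. }
    assert (HS2 : Static M s t S2).
    { eapply static_frame; [exact F2|reflexivity|reflexivity|]. eapply static_frame; [exact F1|reflexivity|reflexivity|auto]. }
    assert (E21 : V S2 21 = tsize t + j).
    { rewrite ES2. norm. rewrite (st_n _ _ _ _ HS), Vj. auto. }
    assert (E22 : V S2 22 = (tsize t + j) * V S vW).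
    { rewrite ES2. norm. rewrite (st_n _ _ _ _ HS), Vj. auto. }
    clear ES2.
    eapply tri_seq with (k2 := 2 + Y); [eapply children_pass_ok; eauto| |].
    + intros S3 F3 HCH.
      assert (E7 : V S3 7 = V S 7) by (norm; auto). assert (E5 : V S3 5 = V S 5) by (norm; auto).
      assert (E7' : V S2 7 = V S 7) by (norm; auto).
      assert (E12 : forall x, A S3 12 x = A S 12 x) by (intros; norm; auto).
      assert (E9 : forall x, A S3 9 x = A S 9 x) by (intros; norm; auto).
      assert (EF : forall x, A S3 17 x = A S1 17 x) by (intros; rewrite (proj2 F3 17 eq_refl), (proj2 F2 17 eq_refl); auto).
      assert (HN : NodeCtx M s t (tsize t + j) sg ss S3).
      { constructor.
        - eapply static_frame; [exact F3|reflexivity|reflexivity|auto].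
        - rewrite (proj1 F3 21 eq_refl). auto.
        - rewrite (proj1 F3 22 eq_refl), E7. auto.
        - norm. auto.
        - inversion Hwf; auto.
        - inversion Hwf; auto.
        (* The array position of the child; [s] is stored behind [t], hence the shift. It exceeds
           the current position, so its row is complete. *)
        - intros i Hi. exists (tsize t + cpos (Datatypes.S j) (map nt_tree ss) (i - 1)).
          destruct (child_sub s j sg ss (i - 1) Hj Ej) as [Hlt Hsub]; [lia|].
          pose proof (cpos_ge (Datatypes.S j) (map nt_tree ss) (i - 1)).
          split; [lia|]. rewrite E7. rewrite HCH, E7' by auto. split; auto.
          intros q' m' Hq' o Ho. rewrite E9 in Hq'. rewrite E12, EF.
          assert (B : block_ok M t (sub_at s (cpos (Datatypes.S j) (map nt_tree ss) (i - 1))) q' m' S1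
             ((tsize t + cpos (Datatypes.S j) (map nt_tree ss) (i - 1)) * V S 7 + A S 12 q')) by (apply I3; auto; lia).
          unfold block_ok in B. rewrite (B o Ho), Hsub. rewrite (nth_indep ss s (Node 0 [])) by lia. tauto.
        - intros Hn i. rewrite (proj2 F3 21 eq_refl), (proj2 F2 21 eq_refl). auto. }
      eapply tri_conseq; [eapply rules_pass_ok; eauto| |].
      * intros x Hx. rewrite EF, E7 in *. apply I1. nia.
      * rewrite E5. unfold Y. apply Nat.le_refl.
      * intros S4 F4 (H1 & H2 & H3). rewrite E7 in H2, H3. split; [|split].
        -- intros x Hx. rewrite H2, EF by auto. apply I1. nia.
        -- apply H1.
        -- intros j' q m Hj' Hq. destruct (Nat.eq_dec j' j) as [->|N].
           ++ rewrite Ej, <- E12. apply H3. rewrite E9. auto.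
           ++ intros o Ho. rewrite H2, EF; [apply I3; auto; lia|]. right.
              assert ((tsize t + j) * V S 7 + V S 7 <= (tsize t + j') * V S 7) by nia. lia.
    + lia.
  - match goal with |- _ <= 2 + tsize s * ?Z => replace Z with (20 + Y) by (unfold Y; lia) end.
    rewrite !Nat.mul_add_distr_l in *. lia.
  - intros S1 F1 (I1 & I2 & I3). assert (E0 : sub_at s 0 = s) by (destruct s; reflexivity).
    destruct (st_rank _ _ _ _ HS (q0 M) (st_rank_q0 _ _ _ _ HS)) as (m & E & Hm & _).
    assert (m = 0) by (eapply ralph_rank_unique; eauto; apply HM). subst m.
    pose proof (tsize_pos s). pose proof (I3 0 (q0 M) 0 ltac:(lia) E) as B. rewrite E0, Nat.add_0_r in B. exact B.
Qed.

(** * Reading the input *)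

Definition code_in (f : nat -> nat) (a : nat) (l : list nat) : Prop :=
  forall x, x < length l -> f (a + x) = nth x l 0.

Lemma code_in_cons (f : nat -> nat) (a c : nat) (l : list nat) :
  code_in f a (c :: l) -> f a = c /\ code_in f (a + 1) l.
Proof.
  intros H. split.
  - specialize (H 0). rewrite Nat.add_0_r in H. apply H. simpl. lia.
  - intros x Hx. replace (a + 1 + x) with (a + S x) by lia. apply (H (S x)). simpl. lia.
Qed.

Lemma code_in_app (f : nat -> nat) (a : nat) (l l' : list nat) :
  code_in f a (l ++ l') -> code_in f a l /\ code_in f (a + length l) l'.
Proof.
  intros H. split; intros x Hx.
  - rewrite H by (rewrite length_app; lia). apply app_nth1. auto.
  - rewrite <- Nat.add_assoc, H by (rewrite length_app; lia). rewrite app_nth2 by lia. f_equal. lia.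
Qed.

Definition nodes_ok (L : list node) (i j : nat) (S : st) : Prop :=
  forall x, i <= x < j -> Nd (A S aKD x) (A S aSY x) (A S aCI x) (A S aAR x) = nth x L node0.

Lemma enc_tree_flat (t : tree) :
  enc_tree t = flat_map (fun x => [nsym x; narity x]) (flat (nt_tree t)) /\
  Forall (fun x => nkind x = 3 /\ nchild x = 0) (flat (nt_tree t)).
Proof.
  induction t as [a ts IH] using tree_ind_list. simpl. rewrite length_map.
  assert (flat_map enc_tree ts = flat_map (fun x => [nsym x; narity x]) (flat_map flat (map nt_tree ts)) /\
    Forall (fun x => nkind x = 3 /\ nchild x = 0) (flat_map flat (map nt_tree ts))) as [E1 E2].
  { induction IH as [|t ts [H1 H2] _ [IH1 IH2]]; simpl; auto. rewrite H1, IH1, flat_map_app.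
    split; auto. apply Forall_app. auto. }
  rewrite E1. split; auto.
Qed.

Lemma length_enc_tree (t : tree) : length (enc_tree t) = 2 * tsize t.
Proof.
  rewrite (proj1 (enc_tree_flat t)), <- nsize_tree. unfold nsize.
  induction (flat (nt_tree t)) as [|x l IH]; simpl in *; lia.
Qed.

Lemma nth_pairs (l : list node) (i : nat) : i < length l ->
  nth (2 * i) (flat_map (fun x => [nsym x; narity x]) l) 0 = nsym (nth i l node0) /\
  nth (2 * i + 1) (flat_map (fun x => [nsym x; narity x]) l) 0 = narity (nth i l node0).
Proof.
  revert i; induction l as [|x l IH]; intros i Hi; simpl in Hi; [lia|].
  destruct i as [|i]; [simpl; auto|]. replace (2 * S i) with (S (S (2 * i))) by lia.
  simpl. simpl in IH. apply IH. lia.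
Qed.

Lemma copy_tree_ok (S : st) (L : list node) (tr : tree) (g a : nat) :
  V S 11 = g -> V S 10 = a -> V S 12 = a + 2 * tsize tr -> code_in (A S aIN) a (enc_tree tr) ->
  at_ L g (nt_tree tr) -> nodes_ok L 0 g S ->
  tri copy_tree S (1 + 20 * tsize tr) (fun S' => nodes_ok L 0 (g + tsize tr) S' /\ V S' 11 = g + tsize tr).
Proof.
  intros Hg Ha He Hc Hat Hok.
  eapply tri_rep with (n := 2 * tsize tr) (f := fun _ => 7)
    (* The minimum accounts for the idle second half of the rounds. *)
    (Inv := fun k S' => let i := Nat.min k (tsize tr) in
       V S' 10 = a + 2 * i /\ V S' 11 = g + i /\ nodes_ok L 0 (g + i) S').
  - vs. lia.
  - cbn [Nat.min]. rewrite Hg, Ha. split; [lia|]. split; [lia|]. rewrite Nat.add_0_r. auto.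
  - intros k S1 Hk F1. cbv zeta. intros (J1 & J2 & J3).
    apply tri_if; vs; rewrite J1, (proj1 F1 12 eq_refl), He; intros H.
    + assert (Hlt : k < tsize tr) by lia.
      replace (Nat.min k (tsize tr)) with k in * by lia. replace (Nat.min (Datatypes.S k) (tsize tr)) with (Datatypes.S k) by lia.
      assert (Hnd : nth (g + k) L node0 = nth k (flat (nt_tree tr)) node0).
      { destruct Hat as (l1 & l2 & -> & <-). simpl. rewrite app_nil_r, app_nth2 by lia.
        rewrite app_nth1 by (fold (nsize (nt_tree tr)); rewrite nsize_tree; lia). f_equal. lia. }
      destruct (enc_tree_flat tr) as [E1 E2].
      assert (Hlk : k < length (flat (nt_tree tr))) by (fold (nsize (nt_tree tr)); rewrite nsize_tree; lia).
      destruct (nth_pairs _ _ Hlk) as [P1 P2]. rewrite <- E1 in P1, P2.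
      rewrite <- Hc in P1 by (rewrite length_enc_tree; lia). rewrite <- Hc in P2 by (rewrite length_enc_tree; lia).
      rewrite Forall_forall in E2. specialize (E2 _ (nth_In _ node0 Hlk)). destruct E2 as [P3 P4].
      do 5 (first [apply tri_sto_seq|apply tri_asn_seq]; vs). apply tri_asn; auto. vs. split; [|split].
      * rewrite J1. lia.
      * rewrite J2. lia.
      * intros x Hx. vs. rewrite J2. destruct (Nat.eqb_spec x (g + k)) as [->|N].
        -- rewrite J1, !(proj2 F1 0 eq_refl). rewrite Hnd.
           replace (a + 2 * k + 1) with (a + (2 * k + 1)) by lia. rewrite P1, P2.
           destruct (nth k (flat (nt_tree tr)) node0); simpl in *; subst; auto.
        -- apply J3. lia.
    + apply tri_skip. assert (k >= tsize tr) by lia.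
      replace (Nat.min k (tsize tr)) with (tsize tr) in * by lia.
      replace (Nat.min (Datatypes.S k) (tsize tr)) with (tsize tr) by lia. auto.
  - rewrite sumf_const. lia.
  - cbv zeta. intros S1 F1 (J1 & J2 & J3). replace (Nat.min (2 * tsize tr) (tsize tr)) with (tsize tr) in * by lia. auto.
Qed.

(** Both upper bounds are needed: the first controls the exponent, and the second pays for the table
    of powers, whose length no power of |t| covers when |t| = 1. *)
Definition arities_ok (M : mtt) (L : list node) (g : nat) (S : st) : Prop :=
  V S vMX <= Nat.min (max_state_rank M) (length L) /\
  forall x, x < g -> nkind (nth x L node0) = 1 -> narity (nth x L node0) <= V S vMX.

Lemma length_le_nsize (k a c : nat) (xs : list ntree) : length xs <= nsize (NT k a c xs).
Proof.
  unfold nsize. simpl. apply Nat.le_le_succ_r. induction xs as [|x xs IH]; simpl; auto.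
  rewrite length_app. pose proof (nsize_pos x). unfold nsize in *. lia.
Qed.

Lemma arity_rank (M : mtt) (q k : nat) : In (q, k) (states M) -> k <= max_state_rank M.
Proof.
  intros H. unfold max_state_rank. apply (in_map snd) in H. simpl in H.
  pose proof (list_max_le (map snd (states M)) (list_max (map snd (states M)))) as [Hm _].
  specialize (Hm (Nat.le_refl _)). rewrite Forall_forall in Hm. auto.
Qed.

Lemma nodes_ok_S (L : list node) (g : nat) (S S' : st) (k a c ar : nat) :
  nodes_ok L 0 g S -> nth g L node0 = Nd k a c ar ->
  (forall x, x <> g -> A S' aKD x = A S aKD x /\ A S' aSY x = A S aSY x /\ A S' aCI x = A S aCI x /\ A S' aAR x = A S aAR x) ->
  A S' aKD g = k -> A S' aSY g = a -> A S' aCI g = c -> A S' aAR g = ar ->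
  nodes_ok L 0 (Datatypes.S g) S'.
Proof.
  intros H Hn Ho <- <- <- <- x Hx. destruct (Nat.eq_dec x g) as [->|N]; auto.
  destruct (Ho x N) as (-> & -> & -> & ->). apply H. lia.
Qed.

Definition rule_code (us : list rhs) (rs : list (nat * nat * rhs)) : list nat :=
  flat_map enc_rhs us ++ flat_map enc_rule rs.

Definition parse_state (M : mtt) (L : list node) (a g : nat) (us : list rhs) (i : nat) (S : st) : Prop :=
  V S 10 = a /\ V S 11 = g /\ V S 13 = length us /\ V S vNR = i /\ nodes_ok L 0 g S /\ arities_ok M L g S.

(** Reading one node replaces the first pending tree by its children [ch]; [l] is the consumed
    prefix of its code. That [l] is nonempty drives the termination count of the whole parse. *)
Lemma parse_node_ok (M : mtt) (L : list node) (S : st) (a g i k m : nat) (u : rhs) (us : list rhs) (C : list nat) :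
  parse_state M L a g (u :: us) i S -> code_in (A S aIN) a (enc_rhs u ++ C) -> at_ L g (nt_rhs u) -> wf_rhs M k m u ->
  tri parse_node S 20 (fun S' => exists ch l, flat_map enc_rhs [u] = l ++ flat_map enc_rhs ch /\ 1 <= length l /\
    (exists kd y c, nt_rhs u = NT kd y c (map nt_rhs ch)) /\ Forall (wf_rhs M k m) ch /\
    parse_state M L (a + length l) (Datatypes.S g) (ch ++ us) i S').
Proof.
  intros (H10 & H11 & H13 & HNR & Hok & HMX1 & HMX2) Hc Hat Hw.
  do 3 (first [apply tri_sto_seq|apply tri_asn_seq]; vs). rewrite H10, H11.
  destruct u as [d ch|q j ch|y]; simpl in Hc, Hat; destruct (at_node _ _ _ _ _ _ Hat) as (Hn & _ & _);
    rewrite ?length_map in Hn; repeat match goal with H : code_in _ _ (_ :: _) |- _ => apply code_in_cons in H as [? H] end;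
    rewrite <- ?Nat.add_assoc in *; cbn [Nat.add] in *.
  - eapply tri_seq with (k1 := 8) (k2 := 2) (Q1 := fun S' => V S' 10 = a + 3 /\ V S' 13 = Datatypes.S (length us) + length ch /\ V S' vMX = V S vMX /\ nodes_ok L 0 (Datatypes.S g) S');
      [|intros S1 F1 (G1 & G2 & G5 & G3)|lia].
    + apply tri_if; intros H'; [exfalso; apply H'; vs; auto|].
      do 4 (first [apply tri_sto_seq|apply tri_asn_seq]; vs). eapply tri_asn; [|lia]. vs.
      split; [auto|]. split; [rewrite H13; simpl; congruence|]. split; [auto|].
      eapply nodes_ok_S; eauto; vs; rewrite ?H11, ?H10, ?Nat.eqb_refl; auto.
      intros x Hx. vs. rewrite ?H11. apply Nat.eqb_neq in Hx. rewrite !Hx. auto.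
    + apply tri_asn_seq. vs. apply tri_asn; auto.
      exists ch, [0; d; length ch]. split; [simpl; rewrite app_nil_r; auto|]. split; [simpl; lia|].
      split; [exists 0, d, 0; auto|]. split; [inversion Hw; auto|].
      split; [|split; [|split; [|split; [|split]]]]; vs; auto.
      * norm. lia.
      * rewrite G2, length_app. lia.
      * norm. auto.
      * split; vs; rewrite G5; auto. intros x Hx. destruct (Nat.eq_dec x g) as [->|N]; [rewrite Hn; discriminate|apply HMX2; lia].
  - assert (Hk : length ch <= Nat.min (max_state_rank M) (length L)).
    { apply Nat.min_glb; [eapply arity_rank; inversion Hw; eauto|].
      pose proof (at_bound _ _ _ Hat) as Hb. pose proof (length_le_nsize 1 q j (map nt_rhs ch)) as Hl. rewrite length_map in Hl. lia. }
    eapply tri_seq with (k1 := 12) (k2 := 2) (Q1 := fun S' => V S' 10 = a + 4 /\ V S' 13 = Datatypes.S (length us) + length ch /\ nodes_ok L 0 (Datatypes.S g) S' /\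
      V S' vMX <= Nat.min (max_state_rank M) (length L) /\ V S vMX <= V S' vMX /\ length ch <= V S' vMX);
      [|intros S1 F1 (G1 & G2 & G3 & G4 & G5 & G6)|lia].
    + eapply tri_conseq with (k := 10); [|lia|intros ? _ HQ0; exact HQ0].
      apply tri_if; intros H'; [|exfalso; revert H'; vs; lia].
      apply tri_if; intros H''; [exfalso; apply H''; vs; lia|].
      do 5 (first [apply tri_sto_seq|apply tri_asn_seq]; vs).
      assert (Hnod : forall S', A S' = updA (updA (updA (updA (A S) 1 g (A S 0 a)) 2 g (A S 0 (a + 1))) 3 g (A S 0 (a + 2))) 4 g (A S 0 (a + 3)) ->
        nodes_ok L 0 (Datatypes.S g) S').
      { intros S' ES'. eapply nodes_ok_S; eauto; rewrite ?ES'; vs; rewrite ?Nat.eqb_refl; auto.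
        intros x Hx. rewrite ?ES'. vs. apply Nat.eqb_neq in Hx. rewrite !Hx. auto. }
      assert (I3 : A S 0 (a + 3) = length ch) by assumption.
      apply tri_if; vs; intros H3; [apply tri_asn; auto|apply tri_skip]; try rewrite I3 in H3; vs; rewrite ?H13, ?H10, ?I3; cbn [length];
        (split; [lia|]; split; [lia|]; split; [apply Hnod; vs; rewrite ?H10, ?H11; auto|]); try lia.
      all: rewrite H10, I3 in H3; lia.
    + apply tri_asn_seq. vs. apply tri_asn; auto.
      exists ch, [1; q; j; length ch]. split; [simpl; rewrite app_nil_r; auto|]. split; [simpl; lia|].
      split; [exists 1, q, j; auto|]. split; [inversion Hw; auto|].
      split; [|split; [|split; [|split; [|split]]]]; vs; auto.
      * norm. lia.
      * rewrite G2, length_app. lia.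
      * norm. auto.
      * split; vs; auto. intros x Hx Hx'. destruct (Nat.eq_dec x g) as [->|N]; [rewrite Hn; simpl; lia|].
        eapply Nat.le_trans; [apply HMX2; auto; lia|]. lia.
  - eapply tri_seq with (k1 := 8) (k2 := 2) (Q1 := fun S' => V S' 10 = a + 2 /\ V S' 13 = Datatypes.S (length us) /\ V S' vMX = V S vMX /\ nodes_ok L 0 (Datatypes.S g) S');
      [|intros S1 F1 (G1 & G2 & G5 & G3)|lia].
    + eapply tri_conseq with (k := 6); [|lia|intros ? _ HQ0; exact HQ0].
      apply tri_if; intros H'; [|exfalso; revert H'; vs; lia].
      apply tri_if; intros H''; [|exfalso; revert H''; vs; lia].
      do 2 (first [apply tri_sto_seq|apply tri_asn_seq]; vs). eapply tri_asn; [|lia]. vs.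
      split; [lia|]. split; [rewrite H13; simpl; congruence|]. split; [auto|].
      eapply nodes_ok_S; eauto; vs; rewrite ?H11, ?H10, ?Nat.eqb_refl; auto.
      intros x Hx. vs. rewrite ?H11. apply Nat.eqb_neq in Hx. rewrite !Hx. auto.
    + apply tri_asn_seq. vs. apply tri_asn; auto.
      exists [], [2; y]. split; [simpl; auto|]. split; [simpl; lia|].
      split; [exists 2, y, 0; auto|]. split; [auto|].
      split; [|split; [|split; [|split; [|split]]]]; vs; auto.
      * norm. lia.
      * rewrite G2. simpl. lia.
      * norm. auto.
      * split; vs; rewrite G5; auto. intros x Hx. destruct (Nat.eq_dec x g) as [->|N]; [rewrite Hn; discriminate|apply HMX2; lia].
Qed.

Definition rule_nts (rs : list (nat * nat * rhs)) : list ntree := map (fun x => nt_rhs (snd x)) rs.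

Lemma length_flat_map_sizes (xs : list ntree) : length (flat_map flat xs) = list_sum (map nsize xs).
Proof. induction xs as [|x xs IH]; simpl; auto. rewrite length_app, IH. auto. Qed.

Lemma rule_pos_rest (M : mtt) (s t : tree) (i : nat) : i <= length (rules M) ->
  rule_pos M s t i + length (flat_map flat (rule_nts (skipn i (rules M)))) = length (nodes M s t).
Proof.
  intros Hi. unfold rule_pos, nodes, cpos, rule_nts. rewrite !length_flat_map_sizes. cbn [Nat.add].
  rewrite <- (firstn_skipn (2 + i) (forest M s t)) at 2. rewrite map_app, list_sum_app. do 3 f_equal.
  cbn [forest Nat.add skipn]. now rewrite skipn_map.
Qed.

Definition rules_ok (M : mtt) (s t : tree) (i : nat) (S : st) : Prop :=
  forall i', i' < i -> A S aRQ i' = fst (fst (nth i' (rules M) rule0)) /\ A S aRS i' = snd (fst (nth i' (rules M) rule0)) /\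
    A S aRG i' = rule_pos M s t i'.

Lemma skipn_cons {X : Type} (l : list X) (i : nat) (d : X) : i < length l -> skipn i l = nth i l d :: skipn (S i) l.
Proof.
  revert i; induction l as [|x l IH]; intros i Hi; simpl in Hi; [lia|]. destruct i as [|i]; auto. simpl. apply IH. lia.
Qed.

Lemma enc_rhs_pos (u : rhs) : 1 <= length (enc_rhs u).
Proof. destruct u; simpl; lia. Qed.

Lemma parse_rules_ok (M : mtt) (s t : tree) (S : st) (e : nat) :
  wf_mtt M -> V S 10 = 6 -> V S 11 = tsize t + tsize s -> V S 12 = e -> e = 6 + length (rules_code M) ->
  V S 13 = 0 -> V S vNR = 0 -> V S vMX = 0 ->
  code_in (A S aIN) 6 (rules_code M) -> nodes_ok (nodes M s t) 0 (tsize t + tsize s) S ->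
  (forall x, x < tsize t + tsize s -> nkind (nth x (nodes M s t) node0) <> 1) ->
  tri parse_rules S (1 + 30 * length (rules_code M)) (fun S' =>
    V S' 11 = length (nodes M s t) /\ V S' vNR = length (rules M) /\ nodes_ok (nodes M s t) 0 (length (nodes M s t)) S' /\
    arities_ok M (nodes M s t) (length (nodes M s t)) S' /\ rules_ok M s t (length (rules M)) S').
Proof.
  intros HM H10 H11 H12 He H13 HNR HMX Hc Hok Hnk. set (L := nodes M s t) in *.
  eapply tri_rep with (n := length (rules_code M)) (f := fun _ => 25)
    (* [us] lists the pending subtrees of the current rule and [i] counts the headers read. The
       third conjunct is the measure: every active round consumes at least one word. *)
    (Inv := fun k S' => exists us i a g,
      let C := rule_code us (skipn i (rules M)) in
      let xs := map nt_rhs us ++ rule_nts (skipn i (rules M)) in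
      code_in (A S aIN) a C /\ a + length C = e /\ length C <= length (rules_code M) - k /\ i <= length (rules M) /\
      forest_at L g xs /\ g + length (flat_map flat xs) = length L /\ Forall (fun u => exists k m, wf_rhs M k m u) us /\
      parse_state M L a g us i S' /\ rules_ok M s t i S').
  - vs. lia.
  - exists [], 0, 6, (tsize t + tsize s). cbv zeta. unfold rule_code. cbn [flat_map app map skipn].
    assert (E0 : rule_pos M s t 0 = tsize t + tsize s).
    { unfold rule_pos, cpos. cbn [forest Nat.add firstn map list_sum fold_right]. rewrite !nsize_tree. lia. }
    split; [exact Hc|]. split; [unfold rules_code in He; lia|]. split; [unfold rules_code; lia|]. split; [lia|]. split; [|split; [|split; [|split]]].
    + assert (HL : forest_at L 0 (forest M s t)) by (exists [], []; split; auto; unfold L, nodes; now rewrite app_nil_r).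
      unfold forest in HL. apply forest_cons in HL as [_ HL]. apply forest_cons in HL as [_ HL].
      rewrite !nsize_tree in HL. exact HL.
    + rewrite <- E0. apply (rule_pos_rest M s t 0). lia.
    + auto.
    + split; [|split; [|split; [|split; [|split]]]]; auto. split; [lia|]. intros x Hx Hk. exfalso. eapply Hnk; eauto.
    + intros i' Hi'. lia.
  - intros k S1 Hk F1 (us & i & a & g & H1 & H2 & H3 & H4 & H5 & H6 & H7 & H8 & H9). cbv zeta in *.
    assert (HIN : forall x, A S1 0 x = A S 0 x) by (intros; norm; auto).
    pose proof H8 as H8'. destruct H8' as (K1 & K2 & K3 & K4 & K5 & K6 & K7).
    eapply tri_conseq with (k := 22); [|lia|intros ? _ HQ0; exact HQ0].
    apply tri_if; vs; rewrite K1, (proj1 F1 12 eq_refl), H12; intros Hlt.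
    + apply tri_if; vs; rewrite K3; intros Hp.
      * destruct us as [|u us]; [simpl in Hp; lia|]. cbn [map app] in H5, H6. apply forest_cons in H5 as [Hu Hrest].
        apply Forall_cons_iff in H7 as [(k' & m & Hw) H7].
        unfold rule_code in *. cbn [flat_map] in H1, H2, H3. rewrite <- app_assoc in H1, H2, H3.
        eapply tri_conseq; [eapply parse_node_ok; eauto; intros x Hx; rewrite HIN; apply H1; auto|lia|].
        intros S2 F2 (ch & l & E1 & E2 & (kd & y & c & E3) & E4 & E5).
        cbn [flat_map] in E1. rewrite app_nil_r in E1. rewrite E1 in H1, H2, H3. rewrite <- app_assoc in H1, H2, H3.
        exists (ch ++ us), i, (a + length l), (Datatypes.S g).
        assert (EC : flat_map enc_rhs (ch ++ us) ++ flat_map enc_rule (skipn i (rules M)) =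
           flat_map enc_rhs ch ++ flat_map enc_rhs us ++ flat_map enc_rule (skipn i (rules M))).
        { now rewrite flat_map_app, <- app_assoc. }
        rewrite EC. apply code_in_app in H1 as [_ H1]. rewrite length_app in H2, H3.
        assert (Esz : nsize (nt_rhs u) = 1 + length (flat_map flat (map nt_rhs ch))) by (rewrite E3; reflexivity).
        split; [exact H1|]. split; [lia|]. split; [lia|]. split; [auto|]. split; [|split; [|split; [|split]]]; auto.
        -- rewrite map_app, <- app_assoc. apply forest_app. rewrite E3 in Hu. split; [apply at_node in Hu; tauto|].
           replace (Datatypes.S g + length (flat_map flat (map nt_rhs ch))) with (g + nsize (nt_rhs u)) by lia. auto.
        -- rewrite map_app, <- app_assoc, flat_map_app, length_app. cbn [flat_map] in H6. rewrite length_app in H6.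
           fold (nsize (nt_rhs u)) in H6. lia.
        -- apply Forall_app. split; auto. eapply Forall_impl; [|exact E4]. intros; eauto.
        -- intros i' Hi'. rewrite !(proj2 F2) by reflexivity. apply H9; auto.
      * destruct us as [|u us]; [|simpl in Hp; lia]. cbn [map app] in H5, H6.
        assert (Hi : i < length (rules M)).
        { destruct (Nat.eq_dec i (length (rules M))) as [->|N]; [|lia]. unfold rule_code in H2. rewrite skipn_all in H2. simpl in H2. lia. }
        pose proof (rule_pos_rest M s t i H4) as Hpos. fold L in Hpos.
        assert (Hg : g = rule_pos M s t i) by lia.
        assert (Hin : In (nth i (rules M) rule0) (rules M)) by (apply nth_In; auto).
        rewrite (skipn_cons _ _ rule0 Hi) in H1, H2, H3, H5, H6.
        destruct (nth i (rules M) rule0) as [[q sg] r] eqn:Er. unfold rule_code in *. cbn [flat_map enc_rule app rule_nts map snd length] in H1, H2, H3, H5, H6.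
        apply code_in_cons in H1 as [I1 H1]. apply code_in_cons in H1 as [I2 H1].
        do 5 (first [apply tri_sto_seq|apply tri_asn_seq]; vs). apply tri_asn; [|lia].
        exists [r], (Datatypes.S i), (a + 2), g. cbn [map app flat_map]. rewrite app_nil_r.
        split; [replace (a + 2) with (a + 1 + 1) by lia; auto|]. split; [lia|]. split; [lia|]. split; [lia|].
        split; [exact H5|]. split; [exact H6|]. split; [|split].
        -- constructor; auto. destruct HM as (_ & _ & _ & _ & _ & HM). destruct (HM _ _ _ Hin) as (m & k' & _ & _ & Hw). eauto.
        -- split; [|split; [|split; [|split; [|split]]]]; vs; auto; try lia. split; auto.
        -- intros i' Hi'. vs. rewrite K4. destruct (Nat.eqb_spec i' i) as [->|N].
           ++ rewrite K1, K2, !HIN, I1, I2, Er. auto.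
           ++ apply H9. lia.
    + apply tri_skip. exists us, i, a, g. cbv zeta. split; [auto|]. split; [auto|]. split; [lia|]. auto 10.
  - rewrite sumf_const. lia.
  - intros S1 F1 (us & i & a & g & H1 & H2 & H3 & H4 & H5 & H6 & H7 & H8 & H9). cbv zeta in *.
    (* There were as many rounds as words, so no code is left; a pending subtree or an unread rule
       would still contribute a word. *)
    assert (EC : rule_code us (skipn i (rules M)) = []) by (apply length_zero_iff_nil; lia).
    unfold rule_code in EC. apply app_eq_nil in EC as [EC1 EC2].
    destruct us as [|u us]; [|exfalso; simpl in EC1; pose proof (enc_rhs_pos u); destruct (enc_rhs u); simpl in *; [lia|discriminate]].
    assert (Hi : i = length (rules M)).
    { destruct (Nat.eq_dec i (length (rules M))) as [|N]; auto. exfalso. rewrite (skipn_cons _ _ rule0) in EC2 by lia.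
      destruct (nth i (rules M) rule0) as [[? ?] ?]. discriminate. }
    subst i. rewrite skipn_all in H6. simpl in H6. rewrite Nat.add_0_r in H6. subst g.
    destruct H8 as (K1 & K2 & K3 & K4 & K5 & K6 & K7). repeat split; auto; apply H9; auto.
Qed.

Record InputOk (M : mtt) (s t : tree) (S : st) : Prop := {
  in_1 : A S aIN 1 = 6 + length (rules_code M);
  in_2 : A S aIN 2 = 6 + length (rules_code M) + length (enc_tree s);
  in_3 : A S aIN 3 = ptr_alph M s t;
  in_4 : A S aIN 4 = q0 M;
  in_code : code_in (A S aIN) 6 (rules_code M ++ enc_tree s ++ enc_tree t);
  in_zero : forall a i, a <> 0 -> A S a i = 0
}.

Lemma input_ok (M : mtt) (s t : tree) (S : st) :
  (forall a i, A S a i = input_upto (enc_input M s t) (ptr_alph M s t) a i) -> InputOk M s t S.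
Proof.
  intros H.
  assert (Hin : forall i, 1 <= i <= 4 -> A S 0 i = nth i (enc_input M s t) 0).
  { intros i Hi. rewrite H. unfold input_upto. simpl (Nat.eqb 0 0).
    replace (Nat.leb 1 i && Nat.leb i 4) with true; auto. symmetry. apply andb_true_intro. split; apply Nat.leb_le; lia. }
  constructor; try (rewrite Hin by lia; reflexivity).
  - intros x Hx. rewrite H. unfold input_upto. simpl (Nat.eqb 0 0).
    replace (Nat.leb 6 (6 + x) && Nat.ltb (6 + x) (ptr_alph M s t)) with true.
    + rewrite orb_true_r. cbn [andb]. unfold enc_input. fold (rules_code M). cbn [Nat.add nth].
      match goal with |- nth x (?r ++ ?p ++ ?q ++ ?al) 0 = _ =>
        replace (r ++ p ++ q ++ al) with ((r ++ p ++ q) ++ al) by (now rewrite <- !app_assoc) end.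
      apply app_nth1. auto.
    + symmetry. apply andb_true_intro. split; [apply Nat.leb_le; lia|apply Nat.ltb_lt].
      unfold ptr_alph. rewrite !length_app in Hx. lia.
  - intros a i Ha. rewrite H. unfold input_upto. apply Nat.eqb_neq in Ha. rewrite Ha. auto.
Qed.

Record Parsed (M : mtt) (s t : tree) (S : st) : Prop := {
  ps_q0 : A S aIN 4 = q0 M;
  ps_n : V S vn = tsize t;
  ps_ns : V S vns = tsize t + tsize s;
  ps_N : V S vN = length (nodes M s t);
  ps_NR : V S vNR = length (rules M);
  ps_arity : arities_ok M (nodes M s t) (length (nodes M s t)) S;
  ps_nodes : nodes_ok (nodes M s t) 0 (length (nodes M s t)) S;
  ps_rules : rules_ok M s t (length (rules M)) S
}.

Lemma tree_nodes_kind (M : mtt) (s t : tree) (x : nat) :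
  x < tsize t + tsize s -> nkind (nth x (nodes M s t) node0) = 3.
Proof.
  intros Hx. unfold nodes, forest. cbn [flat_map]. rewrite app_assoc, app_nth1.
  - assert (H : Forall (fun x => nkind x = 3 /\ nchild x = 0) (flat (nt_tree t) ++ flat (nt_tree s))).
    { apply Forall_app. split; apply enc_tree_flat. }
    rewrite Forall_forall in H. apply H, nth_In. rewrite length_app. fold (nsize (nt_tree t)). fold (nsize (nt_tree s)).
    now rewrite !nsize_tree.
  - rewrite length_app. fold (nsize (nt_tree t)). fold (nsize (nt_tree s)). now rewrite !nsize_tree.
Qed.

Lemma parse_ok (M : mtt) (s t : tree) (S : st) :
  wf_mtt M -> InputOk M s t S ->
  tri parse S (20 + 20 * tsize t + 20 * tsize s + 30 * length (rules_code M)) (Parsed M s t).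
Proof.
  intros HM [I1 I2 I3 I4 IC IZ].
  apply code_in_app in IC as [IC1 IC]. apply code_in_app in IC as [IC2 IC3].
  eapply tri_conseq with (k := 3 + (1 + 20 * tsize t + (3 + (1 + 20 * tsize s + (6 + (1 + 30 * length (rules_code M) + 1)))))); [|lia|intros ? _ HQ0; exact HQ0].
  do 3 (apply tri_asn_seq; vs).
  eapply tri_seq; [eapply copy_tree_ok with (L := nodes M s t) (tr := t) (g := 0) (a := A S 0 2)| |apply Nat.le_refl].
  - reflexivity.
  - vs. auto.
  - vs. rewrite I3, I2. unfold ptr_alph. rewrite (length_enc_tree t). lia.
  - rewrite I2. exact IC3.
  - pose proof (tree_at M s t 0 (tsize_pos t)) as H. replace (sub_at t 0) with t in H by (destruct t; reflexivity). exact H.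
  - intros x Hx. lia.
  - intros S1 F1 [G1 G2]. do 3 (apply tri_asn_seq; vs).
    eapply tri_seq; [eapply copy_tree_ok with (L := nodes M s t) (tr := s) (g := tsize t) (a := A S 0 1)| |apply Nat.le_refl].
    + vs. auto.
    + norm. auto.
    + norm. rewrite I2, I1. rewrite (length_enc_tree s). lia.
    + intros x Hx. norm. rewrite I1. apply IC2. auto.
    + pose proof (input_at M s t 0 (tsize_pos s)) as H. replace (sub_at s 0) with s in H by (destruct s; reflexivity).
      rewrite Nat.add_0_r in H. exact H.
    + exact G1.
    + intros S2 F2 [K1 K2]. do 6 (apply tri_asn_seq; vs).
      eapply tri_seq; [eapply parse_rules_ok with (e := A S 0 1); eauto| |apply Nat.le_refl].
      * norm. auto.
      * intros x Hx. norm. apply IC1. auto.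
      * intros x Hx. rewrite tree_nodes_kind by auto. discriminate.
      * intros S3 F3 (J1 & J2 & J3 & [J4 J5] & J6). apply tri_asn; auto.
        constructor; try (norm; rewrite ?J1, ?J2, ?G2, ?K2; auto; fail).
        -- split; vs; auto.
Qed.

(** * Auxiliary tables *)

Lemma node_of (L : list node) (S : st) (i k a c : nat) (xs : list ntree) :
  nodes_ok L 0 (length L) S -> at_ L i (NT k a c xs) ->
  A S aKD i = k /\ A S aSY i = a /\ A S aCI i = c /\ A S aAR i = length xs /\ i < length L.
Proof.
  intros HO H. apply at_node in H as (H & _ & Hb). pose proof (nsize_pos (NT k a c xs)).
  assert (Hi : i < length L) by lia.
  rewrite <- (HO i (conj (Nat.le_0_l i) Hi)) in H. injection H as -> -> -> ->. auto.
Qed.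

Lemma next_pass_ok (M : mtt) (s t : tree) (S : st) :
  Parsed M s t S ->
  tri next_pass S (2 + 12 * length (nodes M s t)) (fun S' => forall i x, at_ (nodes M s t) i x -> A S' aNX i = i + nsize x).
Proof.
  intros HP. set (L := nodes M s t) in *.
  set (ar := fun i => narity (nth (0 + i) L node0)).
  assert (Hsum : sumf (length L) (fun i => 4 + 2 * ar i) <= 6 * length L).
  { rewrite sumf_add, sumf_const, sumf_mul. unfold ar. rewrite (sumf_arity L L 0 [] []); [|now rewrite app_nil_r|auto].
    pose proof (arity_sum_forest (forest M s t)) as H. fold (nodes M s t) in H. fold L in H. lia. }
  eapply tri_down with (n := length L) (f := fun i => 4 + 2 * ar i)
    (Inv := fun i S' => forall g x, i <= g -> at_ L g x -> A S' aNX g = g + nsize x).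
  - reflexivity.
  - intros i s0 v H. exact H.
  - vs. apply (ps_N _ _ _ _ HP).
  - intros g x Hg Hx. pose proof (at_bound _ _ _ Hx). pose proof (nsize_pos x). lia.
  - intros i S1 Hi F1 Vi I1.
    destruct (at_total (forest M s t) i Hi) as [[k a c xs] Hat]. fold (nodes M s t) in Hat. fold L in Hat.
    destruct (node_of _ _ _ _ _ _ _ (ps_nodes _ _ _ _ HP) Hat) as (_ & _ & _ & NA & _).
    assert (Har : ar i = length xs) by (unfold ar; cbn [Nat.add]; apply at_node in Hat as [-> _]; auto).
    rewrite Har. apply tri_asn_seq. vs.
    eapply tri_seq with (k1 := 1 + 2 * length xs) (k2 := 1) (Q1 := fun S' => V S' 11 = cpos (Datatypes.S i) xs (length xs)); [| |lia].
    + eapply tri_rep with (n := length xs) (f := fun _ => 1) (Inv := fun j S' => V S' 11 = cpos (Datatypes.S i) xs j).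
      * norm. rewrite Vi. auto.
      * vs. rewrite cpos_0, Vi. lia.
      * intros j S2 Hj F2 J. apply tri_asn; auto. vs. rewrite J. norm.
        pose proof (child_at _ _ _ _ _ _ j (NT 0 0 0 []) Hat Hj) as Hc.
        rewrite (I1 _ _ (cpos_ge (Datatypes.S i) xs j) Hc). symmetry. apply cpos_S; auto.
      * rewrite sumf_const. lia.
      * auto.
    + intros S2 F2 J. apply tri_sto; auto. intros g x Hg Hx. vs. rewrite J, (proj1 F2 10 eq_refl). vs. rewrite Vi.
      destruct (Nat.eqb_spec g i) as [->|N].
      * replace x with (NT k a c xs) by (eapply at_unique; eauto). rewrite cpos_all. unfold nsize. simpl. lia.
      * norm. apply I1; auto. lia.
  - lia.
  - intros S1 F1 I1 i x Hx. apply I1; auto. lia.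
Qed.

(** Each power is obtained from the previous one by [n] additions, whence the product of rank and
    |t| in the cost. *)
Lemma power_pass_ok (S : st) (n : nat) :
  V S vn = n ->
  tri power_pass S (4 + (V S vMX + 1) * (6 + 2 * n)) (fun S' => forall j, j <= V S vMX + 1 -> A S' aPW j = n ^ j).
Proof.
  intros Hn. eapply tri_conseq with (k := Datatypes.S (2 + (2 * (V S vMX + 1) + (V S vMX + 1) * (3 + 2 * n)))); [|nia|intros ? _ HQ0; exact HQ0].
  apply tri_sto_seq. vs.
  eapply tri_for with (n := V S vMX + 1) (f := fun _ => 3 + 2 * n)
    (Inv := fun j S' => forall j', j' <= j -> A S' aPW j' = n ^ j').
  - reflexivity.
  - vs. auto.
  - intros j' Hj'. replace j' with 0 by lia. reflexivity.
  - intros j S1 Hj F1 Vj I1. apply tri_asn_seq. vs.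
    eapply tri_seq with (k1 := 1 + 2 * n) (k2 := 1) (Q1 := fun S' => V S' 11 = n * n ^ j); [| |lia].
    + eapply tri_rep with (n := n) (f := fun _ => 1) (Inv := fun i S' => V S' 11 = i * n ^ j).
      * norm. auto.
      * vs. auto.
      * intros i S2 Hi F2 J. apply tri_asn; auto. vs. rewrite J. norm. rewrite Vj, I1 by lia. lia.
      * rewrite sumf_const. lia.
      * auto.
    + intros S2 F2 J. apply tri_sto; auto. intros j' Hj'. norm. rewrite J, Vj.
      destruct (Nat.eqb_spec j' (j + 1)) as [->|N]; [rewrite Nat.add_1_r; auto|apply I1; lia].
  - rewrite sumf_const. lia.
  - auto.
Qed.

Lemma divmod_pass_ok (S : st) (n : nat) :
  V S vn = n -> 1 <= n -> A S aPW (V S vMX + 1) = n ^ (V S vMX + 1) ->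
  tri divmod_pass S (4 + 8 * n ^ (V S vMX + 1)) (fun S' =>
    forall c, c < n ^ (V S vMX + 1) -> A S' aMO c = c mod n /\ A S' aDI c = c / n).
Proof.
  intros Hn Hn1 HP. do 2 (apply tri_asn_seq; vs).
  eapply tri_for with (n := n ^ (V S vMX + 1)) (f := fun _ => 6)
    (Inv := fun c S' => V S' 11 = c mod n /\ V S' 12 = c / n /\ forall c', c' < c -> A S' aMO c' = c' mod n /\ A S' aDI c' = c' / n).
  - reflexivity.
  - vs. auto.
  - vs. rewrite Nat.Div0.mod_0_l, Nat.Div0.div_0_l. split; auto. split; auto. intros; lia.
  - intros c S1 Hc F1 Vc (I1 & I2 & I3).
    do 3 (first [apply tri_sto_seq|apply tri_asn_seq]; vs).
    assert (HA : forall c', c' < Datatypes.S c -> (if Nat.eqb c' c then c mod n else A S1 aMO c') = c' mod n /\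
       (if Nat.eqb c' c then c / n else A S1 aDI c') = c' / n).
    { intros c' Hc'. destruct (Nat.eqb_spec c' c) as [->|N]; auto. apply I3. lia. }
    pose proof (Nat.div_mod_eq c n) as Hdm. pose proof (Nat.mod_upper_bound c n ltac:(lia)) as Hub.
    apply tri_if; norm; rewrite ?Hn, I1, I2, Vc; intros H.
    + apply tri_skip. vs. rewrite ?I1, ?I2, ?Vc. split; [|split; [|exact HA]].
      * apply (Nat.mod_unique _ _ (c / n)); lia.
      * apply (Nat.div_unique _ _ _ (c mod n + 1)); lia.
    + apply tri_asn_seq. vs. apply tri_asn; auto. vs. rewrite ?I1, ?I2, ?Vc. split; [|split; [|exact HA]].
      * apply (Nat.mod_unique _ _ (c / n + 1)); lia.
      * apply (Nat.div_unique _ _ _ 0); lia.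
  - rewrite sumf_const. lia.
  - intros S1 F1 (_ & _ & I3). auto.
Qed.

Lemma call_node_rank (M : mtt) (s t : tree) (i : nat) :
  wf_mtt M -> nkind (nth i (nodes M s t) node0) = 1 ->
  In (nsym (nth i (nodes M s t) node0), narity (nth i (nodes M s t) node0)) (states M).
Proof.
  intros HM. set (ok := fun x => nkind x = 1 -> In (nsym x, narity x) (states M)).
  assert (Htree : forall t, Forall ok (flat (nt_tree t))).
  { intros tr. eapply Forall_impl; [|apply (enc_tree_flat tr)]. intros x [H _] H1. congruence. }
  assert (Hrhs : forall k m r, wf_rhs M k m r -> Forall ok (flat (nt_rhs r))).
  { intros k m. assert (Hl : forall us, Forall (wf_rhs M k m) us -> Forall (fun r => wf_rhs M k m r -> Forall ok (flat (nt_rhs r))) us ->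
      Forall ok (flat_map flat (map nt_rhs us))).
    { intros us H1 H2. induction H1 as [|u us Hu _ IH]; simpl; auto. apply Forall_cons_iff in H2 as [H2 H3].
      apply Forall_app. auto. }
    induction r as [d us IH|q j us IH|j] using rhs_ind_list; intros Hw; inversion Hw; subst; simpl; constructor; auto;
      unfold ok; simpl; try discriminate. intros _. now rewrite length_map. }
  assert (HL : Forall ok (nodes M s t)).
  { unfold nodes, forest. cbn [flat_map]. apply Forall_app. split; auto. apply Forall_app. split; auto.
    destruct HM as (_ & _ & _ & _ & _ & HM). revert HM. induction (rules M) as [|[[q sg] r] rs IH]; intros HM; simpl; auto.
    apply Forall_app. split.
    - destruct (HM q sg r) as (m & k & _ & _ & Hw); [left; auto|]. eauto.
    - apply IH. intros q1 sg1 r1 H1. apply HM. right. auto. }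
  rewrite Forall_forall in HL. intros Hk. destruct (lt_dec i (length (nodes M s t))) as [Hi|Hi].
  - apply HL; auto. apply nth_In. auto.
  - rewrite nth_overflow in Hk by lia. discriminate.
Qed.

(** Blocks are handed out one after another, each new one at the current end [vW]. So all older
    blocks end before it and separation is immediate. *)
Lemma state_pass_ok (M : mtt) (s t : tree) (S : st) (X : nat) :
  wf_mtt M -> Parsed M s t S -> A S aPW (V S vMX + 1) = X -> (forall q, A S aRK q = 0) ->
  tri state_pass S (6 + 9 * length (nodes M s t)) (fun S' =>
    (forall q, A S' aRK q <> 0 -> exists m, A S' aRK q = Datatypes.S m /\ In (q, m) (states M) /\ m <= V S vMX /\
      A S' aQB q + (V S vMX + 1 + X) <= V S' vW) /\
    (forall q q', A S' aRK q <> 0 -> A S' aRK q' <> 0 -> q <> q' ->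
      A S' aQB q + (V S vMX + 1 + X) <= A S' aQB q' \/ A S' aQB q' + (V S vMX + 1 + X) <= A S' aQB q) /\
    A S' aRK (q0 M) <> 0 /\
    (forall i, nkind (nth i (nodes M s t) node0) = 1 -> A S' aRK (nsym (nth i (nodes M s t) node0)) <> 0)).
Proof.
  intros HM HP HX HR. set (L := nodes M s t) in *. set (Z := V S vMX + 1 + X).
  do 4 (first [apply tri_sto_seq|apply tri_asn_seq]; vs). rewrite HX, (ps_q0 _ _ _ _ HP). fold Z.
  eapply tri_for with (n := length L) (f := fun _ => 6)
    (Inv := fun g S' => V S' vZ = Z /\
      (forall q, A S' aRK q <> 0 -> exists m, A S' aRK q = Datatypes.S m /\ In (q, m) (states M) /\ m <= V S vMX /\ A S' aQB q + Z <= V S' vW) /\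
      (forall q q', A S' aRK q <> 0 -> A S' aRK q' <> 0 -> q <> q' -> A S' aQB q + Z <= A S' aQB q' \/ A S' aQB q' + Z <= A S' aQB q) /\
      A S' aRK (q0 M) <> 0 /\
      (forall i, i < g -> nkind (nth i L node0) = 1 -> A S' aRK (nsym (nth i L node0)) <> 0)).
  - reflexivity.
  - vs. apply (ps_N _ _ _ _ HP).
  - vs. split; [auto|]. split; [|split; [|split]].
    + intros q. rewrite HR. destruct (Nat.eqb_spec q (q0 M)) as [->|N]; [|lia]. intros _. exists 0.
      split; auto. split; [apply HM|]. lia.
    + intros q q'. rewrite !HR. destruct (Nat.eqb_spec q (q0 M)), (Nat.eqb_spec q' (q0 M)); subst; try lia.
    + rewrite Nat.eqb_refl. lia.
    + intros; lia.
  - intros g S1 Hg F1 Vg (I0 & I1 & I2 & I3 & I4).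
    pose proof (ps_nodes _ _ _ _ HP g (conj (Nat.le_0_l g) Hg)) as Hnd. fold L in Hnd.
    destruct (nth g L node0) as [kd q ci k] eqn:En. injection Hnd as NK NS _ NA.
    assert (Skip' : forall S2, A S2 = A S1 -> V S2 vZ = V S1 vZ -> V S2 vW = V S1 vW -> (kd = 1 -> A S1 aRK q <> 0) ->
      V S2 vZ = Z /\
      (forall q, A S2 aRK q <> 0 -> exists m, A S2 aRK q = Datatypes.S m /\ In (q, m) (states M) /\ m <= V S vMX /\ A S2 aQB q + Z <= V S2 vW) /\
      (forall q q', A S2 aRK q <> 0 -> A S2 aRK q' <> 0 -> q <> q' -> A S2 aQB q + Z <= A S2 aQB q' \/ A S2 aQB q' + Z <= A S2 aQB q) /\
      A S2 aRK (q0 M) <> 0 /\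
      (forall i, i < Datatypes.S g -> nkind (nth i L node0) = 1 -> A S2 aRK (nsym (nth i L node0)) <> 0)).
    { intros S2 E1 E2 E3 Hq. rewrite E1, E2, E3. split; [auto|]. split; [auto|]. split; [auto|]. split; [auto|].
      intros i Hi Hk. destruct (Nat.eq_dec i g) as [->|N]; [rewrite En in Hk |- *; auto|apply I4; auto; lia]. }
    eapply tri_conseq with (k := 5); [|lia|intros ? _ HQ0; exact HQ0].
    apply tri_is_kind; vs; rewrite Vg; norm; rewrite NK; intros Hk.
    + apply tri_if; vs; rewrite Vg; norm; rewrite NS; intros Hq.
      * apply tri_skip. apply Skip'; auto.
      * do 2 (first [apply tri_sto_seq|apply tri_asn_seq]; vs). apply tri_asn; auto. norm. rewrite Vg, NS, NA.
        assert (Hin : In (q, k) (states M)).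
        { pose proof (call_node_rank M s t g HM) as H. fold L in H. rewrite En in H. apply H. auto. }
        assert (Hkm : k <= V S vMX).
        { pose proof (proj2 (ps_arity _ _ _ _ HP) g Hg) as H. fold L in H. rewrite En in H. apply H. auto. }
        assert (I1' : forall q1, A S1 aRK q1 <> 0 -> A S1 aQB q1 + Z <= V S1 vW).
        { intros q1 H1. destruct (I1 q1 H1) as (m & _ & _ & _ & H). auto. }
        split; [auto|]. split; [|split; [|split]].
        -- intros q1. vs. destruct (Nat.eqb_spec q1 q) as [->|N].
           ++ intros _. exists k. rewrite ?I0. repeat split; auto; lia.
           ++ intros H1. destruct (I1 q1 H1) as (m & E1 & E2 & E3 & E4). exists m. split; auto. split; auto. split; auto. lia.
        -- intros q1 q2. vs. destruct (Nat.eqb_spec q1 q), (Nat.eqb_spec q2 q); subst; intros H1 H2 H3.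
           ++ congruence.
           ++ right. auto.
           ++ left. auto.
           ++ auto.
        -- destruct (Nat.eqb_spec (q0 M) q); [lia|auto].
        -- intros i Hi Hk'. destruct (Nat.eqb_spec (nsym (nth i L node0)) q) as [E|N]; [lia|].
           apply I4; auto. destruct (Nat.eq_dec i g) as [->|N']; [rewrite En in N; simpl in N; congruence|lia].
    + apply tri_skip. apply Skip'; auto.
  - rewrite sumf_const. lia.
  - intros S1 F1 (I0 & I1 & I2 & I3 & I4). split; [auto|]. split; [auto|]. split; [auto|].
    intros i Hk. apply I4; auto. destruct (lt_dec i (length L)); auto. rewrite nth_overflow in Hk by lia. discriminate.
Qed.

Lemma row_pass_ok (S : st) (n N : nat) :
  V S vn = n -> V S vN = N ->
  tri row_pass S (4 + 6 * N) (fun S' => forall g, g < N -> A S' aVB g = g * n /\ A S' aRB g = g * V S vW).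
Proof.
  intros Hn HN. do 2 (apply tri_asn_seq; vs).
  eapply tri_for with (n := N) (f := fun _ => 4)
    (Inv := fun j S' => V S' 11 = j * n /\ V S' 12 = j * V S vW /\ forall g, g < j -> A S' aVB g = g * n /\ A S' aRB g = g * V S vW).
  - reflexivity.
  - vs. auto.
  - vs. split; auto. split; auto. intros; lia.
  - intros j S1 Hj F1 Vj (I1 & I2 & I3).
    do 3 (first [apply tri_sto_seq|apply tri_asn_seq]; vs). apply tri_asn; auto. norm. rewrite I1, I2, Vj, Hn.
    split; [lia|]. split; [lia|]. intros g Hg. destruct (Nat.eqb_spec g j) as [->|N']; auto. apply I3. lia.
  - rewrite sumf_const. lia.
  - intros S1 F1 (_ & _ & I3). auto.
Qed.

Lemma canon_step_ok (M : mtt) (s t : tree) (S : st) (p p2 : nat) :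
  wf_mtt M -> wf_tree (outp M) t -> nodes_ok (nodes M s t) 0 (length (nodes M s t)) S ->
  (forall i x, at_ (nodes M s t) i x -> A S aNX i = i + nsize x) ->
  V S 10 = p -> V S 11 = p2 -> p < p2 -> p2 < tsize t ->
  (forall a b, p < a < tsize t -> p < b < tsize t -> A S aCA a = A S aCA b <-> sub_at t a = sub_at t b) ->
  tri canon_step S (10 + 6 * narity (nth p (nodes M s t) node0)) (fun S' =>
    (forall x, x <> p -> A S' aCA x = A S aCA x) /\
    (sub_at t p = sub_at t p2 -> A S' aCA p = A S aCA p2) /\
    (sub_at t p <> sub_at t p2 -> A S' aCA p = A S aCA p)).
Proof.
  intros HM Ht HO HNX Hp Hp2 Hlt Hlt2 HC.
  destruct (sub_at t p) as [a ts] eqn:Ep. destruct (sub_at t p2) as [b us] eqn:Ep2.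
  pose proof (tree_at M s t p ltac:(lia)) as Hat. rewrite Ep in Hat. simpl in Hat.
  pose proof (tree_at M s t p2 ltac:(lia)) as Hat2. rewrite Ep2 in Hat2. simpl in Hat2.
  destruct (node_of _ _ _ _ _ _ _ HO Hat) as (_ & NS & _ & NA & _). destruct (node_of _ _ _ _ _ _ _ HO Hat2) as (_ & NS2 & _ & _ & _).
  assert (Har : narity (nth p (nodes M s t) node0) = length ts) by (apply at_node in Hat as [-> _]; apply length_map).
  rewrite Har. rewrite length_map in NA.
  assert (Hwf : forall q c vs, q < tsize t -> sub_at t q = Node c vs -> In (c, length vs) (outp M)).
  { intros q c vs Hq Eq. assert (W : wf_tree (outp M) (Node c vs)) by (eapply subs_wf; eauto; rewrite <- Eq; apply sub_at_In; auto).
    inversion W; auto. }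
  assert (Hlen : a = b -> length us = length ts).
  { intros ->. eapply ralph_rank_unique with (B := outp M) (a := b); [apply HM| |]; eapply Hwf; [|eauto| |eauto]; lia. }
  assert (Hnext : forall q c vs j, q < tsize t -> sub_at t q = Node c vs -> j < length vs ->
    A S aNX (cpos (Datatypes.S q) (map nt_tree vs) j) = cpos (Datatypes.S q) (map nt_tree vs) (Datatypes.S j)).
  { intros q c vs j Hq Eq Hj. pose proof (tree_at M s t q Hq) as H. rewrite Eq in H. simpl in H.
    apply child_at with (j := j) (d := nt_tree t) in H; [|now rewrite length_map].
    rewrite (HNX _ _ H). symmetry. apply cpos_S. now rewrite length_map. }
  eapply tri_conseq with (k := Datatypes.S (2 + (2 + (1 + 5 * length ts + 2)))); [|lia|intros ? _ HQ0; exact HQ0].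
  apply tri_asn_seq. vs.
  eapply tri_seq with (k1 := 2) (k2 := 2 + (1 + 5 * length ts + 2)) (Q1 := fun s1 => V s1 12 <> 0 <-> a = b); [|intros S2 F2 H12|lia].
  { apply tri_if; intros H; [apply tri_asn; auto|apply tri_skip]; vs.
    - split; [lia|]. intros E. exfalso. apply H. apply ev_neq. vs. rewrite Hp, Hp2, NS, NS2. auto.
    - apply ev_neq in H. revert H. vs. rewrite Hp, Hp2, NS, NS2. intros H. split; auto. }
  do 2 (apply tri_asn_seq; vs).
  eapply tri_seq with (k1 := 1 + 5 * length ts) (k2 := 2) (Q1 := fun s1 => V s1 12 <> 0 <-> Node a ts = Node b us); [| |lia].
  - eapply tri_rep with (n := length ts) (f := fun _ => 4)
      (Inv := fun i s1 => V s1 13 = cpos (Datatypes.S p) (map nt_tree ts) i /\ (a <> b -> V s1 12 = 0) /\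
        (a = b -> V s1 14 = cpos (Datatypes.S p2) (map nt_tree us) i /\
          (V s1 12 <> 0 <-> forall j, j < i -> nth j ts t = nth j us t))).
    + norm. rewrite Hp. auto.
    + norm. rewrite Hp, Hp2, !Nat.add_1_r, !cpos_0. split; auto. split; [intros; lia|]. intros E. split; auto.
      split; [intros; lia|]. intros _. apply H12; auto.
    + intros i S3 Hi F3 (J1 & J2 & J3).
      eapply tri_seq with (k1 := 2) (k2 := 2) (Q1 := fun s1 => (a <> b -> V s1 12 = 0) /\
          (a = b -> (V s1 12 <> 0 <-> forall j, j < Datatypes.S i -> nth j ts t = nth j us t))); [|intros S4 F4 [K1 K2]|lia].
      * assert (Hcell : a = b -> (ev (neq (Arr aCA (Var 13)) (Arr aCA (Var 14))) S3 = 0 <-> nth i ts t = nth i us t)).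
        { intros E. rewrite ev_neq. norm. rewrite J1. destruct (J3 E) as [-> _].
          destruct (child_sub t p a ts i ltac:(lia) Ep Hi) as [L1 E1].
          destruct (child_sub t p2 b us i ltac:(lia) Ep2) as [L2 E2]; [rewrite Hlen; auto|].
          rewrite <- E1, <- E2. apply HC.
          - pose proof (cpos_ge (Datatypes.S p) (map nt_tree ts) i). lia.
          - pose proof (cpos_ge (Datatypes.S p2) (map nt_tree us) i). lia. }
        apply tri_if; intros Hc; [apply tri_asn; auto|apply tri_skip]; vs; (split; [auto|]); intros E;
          specialize (Hcell E); destruct (J3 E) as [_ J4]; rewrite all_lt_S.
        -- split; [lia|]. intros [_ H]. tauto.
        -- rewrite J4. tauto.
      * apply tri_asn_seq. vs. apply tri_asn; auto. vs. split; [|split]; auto.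
        -- norm. rewrite J1. eapply Hnext; eauto. lia.
        -- intros E. split; [|auto]. destruct (J3 E) as [J4 _]. norm. rewrite J4. eapply Hnext; eauto. rewrite Hlen; auto.
    + rewrite sumf_const. lia.
    + intros S3 F3 (J1 & J2 & J3). destruct (Nat.eq_dec a b) as [E|N].
      * destruct (J3 E) as [_ ->]. split.
        -- intros H. f_equal; [exact E|]. apply nth_ext with (d := t) (d' := t); auto. symmetry; auto.
        -- intros H j Hj. injection H as _ ->. auto.
      * split; [intros H; exfalso; auto|congruence].
  - intros S3 F3 H. apply tri_if; vs; intros H'.
    + apply H in H'. apply tri_sto; auto. vs. norm. rewrite Hp, Hp2.
      split; [|split].
      * intros x Hx. apply Nat.eqb_neq in Hx. norm. rewrite Hx. auto.
      * intros _. rewrite Nat.eqb_refl. auto.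
      * intros N. contradiction.
    + apply tri_skip. split; [intros x _; norm; auto|]. split; [|intros _; norm; auto]. intros E. exfalso. apply H; auto.
Qed.

(** Quadratic because the comparisons for one position cost n times 1 + its arity, and the arities
    of [t] add up to less than n. *)
Lemma canon_pass_ok (M : mtt) (s t : tree) (S : st) :
  wf_mtt M -> wf_tree (outp M) t -> Parsed M s t S ->
  (forall i x, at_ (nodes M s t) i x -> A S aNX i = i + nsize x) ->
  tri canon_pass S (2 + 40 * (tsize t * tsize t)) (fun S' =>
    forall a b, a < tsize t -> b < tsize t -> A S' aCA a = A S' aCA b <-> sub_at t a = sub_at t b).
Proof.
  intros HM Ht HP HNX. set (n := tsize t) in *. assert (Hn : 1 <= n) by apply tsize_pos.
  set (ar := fun p => narity (nth (0 + p) (nodes M s t) node0)).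
  assert (Hsum : sumf n (fun p => 5 + 13 * n + 6 * n * ar p) <= n * (5 + 13 * n) + 6 * n * n).
  { rewrite sumf_add, sumf_const, sumf_mul. pose proof (tree_at M s t 0 (tsize_pos t)) as H.
    apply at_arity_sum in H. unfold sub_at in H. assert (E0 : nth 0 (subs t) t = t) by (destruct t; reflexivity).
    rewrite E0, nsize_tree in H. fold n ar in H. nia. }
  eapply tri_down with (n := n) (f := fun p => 5 + 13 * n + 6 * n * ar p)
    (* The lower bound on canonical positions makes [p] a fresh name when the next lower position
       [p] is treated. *)
    (Inv := fun p S' => forall a b, p <= a < n -> p <= b < n -> p <= A S' aCA a /\ (A S' aCA a = A S' aCA b <-> sub_at t a = sub_at t b)).
  - reflexivity.
  - intros i s0 v H. exact H.
  - vs. apply (ps_n _ _ _ _ HP).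
  - intros; lia.
  - intros p S1 Hp F1 Vp I1.
    eapply tri_conseq with (k := Datatypes.S (2 + (2 * n + n * (11 + 6 * ar p)))); [|nia|intros ? _ HQ0; exact HQ0].
    apply tri_sto_seq. vs. rewrite Vp.
    eapply tri_for with (n := n) (f := fun _ => 11 + 6 * ar p)
      (* Several later positions may match and overwrite the entry of [p]; they carry equal
         subtrees, so they all have the same canonical position. *)
      (Inv := fun k S' => (forall x, x <> p -> A S' aCA x = A S1 aCA x) /\
         (forall p2, p < p2 < k -> sub_at t p = sub_at t p2 -> A S' aCA p = A S1 aCA p2) /\
         ((forall p2, p < p2 < k -> sub_at t p <> sub_at t p2) -> A S' aCA p = p) /\
         (A S' aCA p = p \/ exists p2, p < p2 < n /\ A S' aCA p = A S1 aCA p2)).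
    + reflexivity.
    + norm. apply (ps_n _ _ _ _ HP).
    + vs. rewrite Nat.eqb_refl. split; [|split; [|split]]; auto; [|intros; lia].
      intros x Hx. apply Nat.eqb_neq in Hx. rewrite Hx. auto.
    + intros k S2 Hk F2 Vk (J1 & J2 & J3 & J4).
      assert (V10 : V S2 10 = p) by (norm; auto).
      eapply tri_conseq with (k := Datatypes.S (10 + 6 * ar p)); [|lia|intros ? _ HQ0; exact HQ0].
      apply tri_if; vs; rewrite Vk, V10; intros Hc.
      * eapply tri_conseq; [eapply canon_step_ok with (p := p) (p2 := k)| |].
        -- exact HM.
        -- exact Ht.
        -- intros x Hx. norm. apply (ps_nodes _ _ _ _ HP). auto.
        -- intros i x Hx. norm. apply HNX. auto.
        -- auto.
        -- auto.
        -- lia.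
        -- fold n. lia.
        -- intros a b Ha Hb. rewrite !J1 by lia. apply (I1 a b); lia.
        -- unfold ar. rewrite Nat.add_0_l. lia.
        -- intros S3 F3 (K1 & K2 & K3). vs. split; [|split; [|split]].
           ++ intros x Hx. rewrite K1, J1; auto.
           ++ intros p2 Hp2 E. destruct (Nat.eq_dec p2 k) as [->|N].
              ** rewrite K2 by auto. apply J1. lia.
              ** destruct (tree_eq_dec (sub_at t p) (sub_at t k)) as [E'|N'].
                 --- rewrite K2 by auto. rewrite J1 by lia. apply (I1 k p2); [lia|lia|congruence].
                 --- rewrite K3 by auto. apply J2; auto. lia.
           ++ intros H. rewrite K3 by (apply H; lia). apply J3. intros p2 Hp2. apply H. lia.
           ++ destruct (tree_eq_dec (sub_at t p) (sub_at t k)) as [E'|N'].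
              ** right. exists k. split; [lia|]. rewrite K2 by auto. apply J1. lia.
              ** rewrite K3 by auto. auto.
      * apply tri_skip. vs. split; [auto|]. split; [intros; lia|]. split; [|auto]. intros H. apply J3. intros; lia.
    + rewrite sumf_const. lia.
    + intros S2 F2 (J1 & J2 & J3 & J4).
      assert (Hge : p <= A S2 aCA p).
      { destruct J4 as [->|(p2 & Hp2 & ->)]; auto. destruct (I1 p2 p2) as [H _]; lia. }
      assert (Hmain : forall b, p < b < n -> A S2 aCA p = A S2 aCA b <-> sub_at t p = sub_at t b).
      { intros b Hb. rewrite (J1 b) by lia. split; [|apply J2; auto].
        intros E. destruct (classic (exists p2, p < p2 < n /\ sub_at t p = sub_at t p2)) as [(p2 & Hp2 & E2)|N].
        - rewrite (J2 p2 Hp2 E2) in E. rewrite E2. apply (I1 p2 b); [lia|lia|auto].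
        - rewrite J3 in E by (intros p2 Hp2 E2; apply N; eauto). destruct (I1 b b) as [H _]; lia. }
      intros a b Ha Hb. destruct (Nat.eq_dec a p) as [->|Na].
      * split; auto. destruct (Nat.eq_dec b p) as [->|Nb]; [tauto|]. apply Hmain. lia.
      * split; [rewrite J1 by auto; destruct (I1 a a) as [H _]; lia|]. destruct (Nat.eq_dec b p) as [->|Nb].
        -- split; intros E; symmetry; apply Hmain; auto; lia.
        -- rewrite !J1 by auto. apply (I1 a b); lia.
  - nia.
  - intros S1 F1 I1 a b Ha Hb. apply (I1 a b); lia.
Qed.

(** * The preparation as a whole *)

Lemma Parsed_frame (M : mtt) (s t : tree) (S S' : st) (vs bs : list nat) :
  frame vs bs S S' -> disjoint_b [1; 2; 3; 4; 5] vs = true -> disjoint_b [0; 1; 2; 3; 4; 6; 7; 8] bs = true ->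
  Parsed M s t S -> Parsed M s t S'.
Proof.
  intros [F1 F2] D1 D2 [].
  assert (HV : forall x, memb x [1; 2; 3; 4; 5] = true -> V S' x = V S x).
  { intros x Hx. apply F1. eapply disjoint_b_memb; eauto. }
  assert (HA : forall a, memb a [0; 1; 2; 3; 4; 6; 7; 8] = true -> forall i, A S' a i = A S a i).
  { intros x Hx. apply F2. eapply disjoint_b_memb; eauto. }
  constructor; try (rewrite ?HV, ?HA by reflexivity; auto; fail).
  - unfold arities_ok. rewrite HV by reflexivity. auto.
  - intros x Hx. rewrite !HA by reflexivity. auto.
  - intros x Hx. rewrite !HA by reflexivity. auto.
Qed.

Lemma length_nodes (M : mtt) (s t : tree) : length (nodes M s t) = tsize t + tsize s + msize M.
Proof.
  unfold nodes, forest. rewrite length_flat_map_sizes. cbn [map list_sum fold_right]. rewrite !nsize_tree, map_map.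
  change (fold_right Nat.add 0) with list_sum. unfold msize.
  rewrite (map_ext (fun x => nsize (nt_rhs (snd x))) (fun qr => rsize (snd qr))) by (intros; apply nsize_rhs). lia.
Qed.

Lemma prepare_ok (M : mtt) (s t : tree) (S : st) :
  wf_mtt M -> wf_tree (outp M) t -> InputOk M s t S ->
  exists mx, mx <= max_state_rank M /\ mx <= tsize t + tsize s + msize M /\
  tri prepare S (100 * (1 + tsize t + tsize s + length (rules_code M) + msize M + (mx + 1) * (1 + tsize t) + tsize t ^ (mx + 1) + tsize t * tsize t))
    (fun S' => Static M s t S' /\ V S' vMX = mx /\ (forall x, A S' aF x = 0) /\ (forall x, A S' aEN x = 0)).
Proof.
  intros HM Ht HI.
  destruct (parse_ok M s t S HM HI) as [HP0 _].
  (* The largest rank found occurs in the cost bound and so has to be named in advance; it is read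
     off the state after parsing, and no later pass changes it. *)
  exists (V (exec parse S) vMX).
  split; [apply (Nat.le_trans _ _ _ (proj1 (ps_arity _ _ _ _ HP0))); lia|].
  split; [rewrite <- length_nodes; apply (Nat.le_trans _ _ _ (proj1 (ps_arity _ _ _ _ HP0))); lia|].
  set (mx := V (exec parse S) vMX). set (n := tsize t). set (N := length (nodes M s t)).
  assert (HN : N = n + tsize s + msize M) by apply length_nodes.
  assert (HZ := in_zero _ _ _ _ HI).
  set (k6 := 2 + 40 * (n * n)). set (k5 := 4 + 6 * N). set (k4 := 6 + 9 * N). set (k3 := 4 + 8 * n ^ (mx + 1)).
  set (k2 := 4 + (mx + 1) * (6 + 2 * n)). set (k1 := 2 + 12 * N).
  eapply tri_seq with (k2 := k1 + (k2 + (k3 + (k4 + (k5 + k6))))) (Q1 := fun S1 => Parsed M s t S1 /\ V S1 vMX = mx).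
  { destruct (parse_ok M s t S HM HI) as [_ Hc]. split; [split; auto; reflexivity|exact Hc]. }
  2:{ unfold k1, k2, k3, k4, k5, k6. rewrite HN. fold n. lia. }
  intros S1 F1 [P1 M1].
  eapply tri_seq; [eapply next_pass_ok; eauto| |apply Nat.le_refl]. intros S2 F2 X2.
  assert (P2 : Parsed M s t S2) by (eapply Parsed_frame; [exact F2|reflexivity|reflexivity|auto]).
  assert (M2 : V S2 vMX = mx) by (norm; auto).
  eapply tri_seq; [eapply tri_conseq with (k' := k2); [eapply power_pass_ok; apply (ps_n _ _ _ _ P2)|rewrite M2; apply Nat.le_refl|intros ? _ HQ0; exact HQ0]
    | |apply Nat.le_refl]. intros S3 F3 X3. rewrite M2 in X3. fold n in X3.
  assert (P3 : Parsed M s t S3) by (eapply Parsed_frame; [exact F3|reflexivity|reflexivity|auto]).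
  assert (M3 : V S3 vMX = mx) by (norm; auto).
  eapply tri_seq; [eapply tri_conseq with (k' := k3); [eapply divmod_pass_ok; [apply (ps_n _ _ _ _ P3)|apply tsize_pos|rewrite M3; apply X3; lia]|rewrite M3; apply Nat.le_refl|intros ? _ HQ0; exact HQ0]
    | |apply Nat.le_refl]. intros S4 F4 X4. rewrite M3 in X4. fold n in X4.
  assert (P4 : Parsed M s t S4) by (eapply Parsed_frame; [exact F4|reflexivity|reflexivity|auto]).
  assert (M4 : V S4 vMX = mx) by (norm; auto).
  eapply tri_seq; [eapply state_pass_ok with (X := n ^ (mx + 1)); eauto| |apply Nat.le_refl].
  { rewrite M4, (proj2 F4 14 eq_refl). apply X3. lia. }
  { intros q. norm. apply HZ. lia. }
  intros S5 F5 (X5a & X5b & X5c & X5d). rewrite M4 in *.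
  assert (P5 : Parsed M s t S5) by (eapply Parsed_frame; [exact F5|reflexivity|reflexivity|auto]).
  assert (M5 : V S5 vMX = mx) by (norm; auto).
  eapply tri_seq; [eapply row_pass_ok; [apply (ps_n _ _ _ _ P5)|apply (ps_N _ _ _ _ P5)]| |apply Nat.le_refl]. intros S6 F6 X6.
  assert (P6 : Parsed M s t S6) by (eapply Parsed_frame; [exact F6|reflexivity|reflexivity|auto]).
  eapply tri_conseq; [eapply canon_pass_ok; eauto| |].
  { intros i x Hx. rewrite (proj2 F6 5 eq_refl). vs. rewrite (proj2 F5 5 eq_refl). vs. rewrite (proj2 F4 5 eq_refl), (proj2 F3 5 eq_refl). auto. }
  { apply Nat.le_refl. }
  intros S7 F7 X7.
  assert (P7 : Parsed M s t S7) by (eapply Parsed_frame; [exact F7|reflexivity|reflexivity|auto]).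
  assert (E : forall a i, memb a [17; 21] = true -> A S7 a i = A S a i).
  { intros a i Ha. simpl in Ha. destruct (Nat.eqb_spec a 17) as [->|]; [norm; auto|]. destruct (Nat.eqb_spec a 21) as [->|]; [norm; auto|discriminate]. }
  assert (M7 : V S7 vMX = mx) by (norm; auto).
  split; [|split; [auto|split; intros x; rewrite E by reflexivity; apply HZ; lia]].
  assert (E5 : forall i, A S7 5 i = A S2 5 i) by (intros; rewrite (proj2 F7 5 eq_refl), (proj2 F6 5 eq_refl), (proj2 F5 5 eq_refl), (proj2 F4 5 eq_refl), (proj2 F3 5 eq_refl); auto).
  assert (E14 : forall i, A S7 14 i = A S3 14 i) by (intros; rewrite (proj2 F7 14 eq_refl), (proj2 F6 14 eq_refl), (proj2 F5 14 eq_refl), (proj2 F4 14 eq_refl); auto).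
  assert (E15 : forall i, A S7 15 i = A S4 15 i) by (intros; rewrite (proj2 F7 15 eq_refl), (proj2 F6 15 eq_refl), (proj2 F5 15 eq_refl); auto).
  assert (E16 : forall i, A S7 16 i = A S4 16 i) by (intros; rewrite (proj2 F7 16 eq_refl), (proj2 F6 16 eq_refl), (proj2 F5 16 eq_refl); auto).
  assert (E9 : forall i, A S7 9 i = A S5 9 i) by (intros; rewrite (proj2 F7 9 eq_refl), (proj2 F6 9 eq_refl); auto).
  assert (E12 : forall i, A S7 12 i = A S5 12 i) by (intros; rewrite (proj2 F7 12 eq_refl), (proj2 F6 12 eq_refl); auto).
  assert (E7 : V S7 7 = V S5 7) by (rewrite (proj1 F7 7 eq_refl), (proj1 F6 7 eq_refl); auto).
  assert (E10 : forall i, A S7 10 i = A S6 10 i) by (intros; rewrite (proj2 F7 10 eq_refl); auto).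
  assert (E11 : forall i, A S7 11 i = A S6 11 i) by (intros; rewrite (proj2 F7 11 eq_refl); auto).
  (* The uniform block size is large enough for every rank, so separation of the uniform blocks
     implies separation of the exact ones. *)
  assert (Hpow : forall m, m <= mx -> m + 1 + n ^ (m + 1) <= mx + 1 + n ^ (mx + 1)).
  { intros m Hm. assert (n ^ (m + 1) <= n ^ (mx + 1)) by (apply Nat.pow_le_mono_r; [unfold n; pose proof (tsize_pos t)|]; lia). lia. }
  constructor; rewrite ?M7, ?E7.
  - apply (ps_q0 _ _ _ _ P7).
  - apply (ps_n _ _ _ _ P7).
  - apply (ps_ns _ _ _ _ P7).
  - apply (ps_NR _ _ _ _ P7).
  - rewrite <- M7. apply (Nat.le_trans _ _ _ (proj1 (ps_arity _ _ _ _ P7))). lia.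
  - intros i Hk. rewrite <- M7. apply (proj2 (ps_arity _ _ _ _ P7)); auto.
    destruct (lt_dec i (length (nodes M s t))); auto. rewrite nth_overflow in Hk by lia. discriminate.
  - intros i Hi. apply (ps_nodes _ _ _ _ P7). lia.
  - apply (ps_rules _ _ _ _ P7).
  - intros i x Hx. rewrite E5. auto.
  - intros j Hj. rewrite E14. auto.
  - intros c Hc. rewrite E15, E16. auto.
  - exact X7.
  - intros g Hg. rewrite E10, E11. fold n. apply X6. auto.
  - intros q. rewrite E9, E12. intros Hq. destruct (X5a q Hq) as (m & G1 & G2 & G3 & G4). exists m. split; auto. split; auto. split; auto.
    fold n. specialize (Hpow m G3). lia.
  - intros q q' m m'. rewrite !E9, !E12. intros H1 H2 Hne.
    destruct (X5a q) as (m1 & G1 & _ & G3 & _); [congruence|]. destruct (X5a q') as (m2 & G4 & _ & G5 & _); [congruence|].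
    assert (m1 = m) by congruence. assert (m2 = m') by congruence. subst m1 m2.
    pose proof (Hpow m G3). pose proof (Hpow m' G5). fold n.
    destruct (X5b q q') as [H'|H']; [congruence|congruence|auto|left|right]; lia.
  - rewrite E9. auto.
  - intros i Hk. rewrite E9. auto.
Qed.

(** * The time bound and the conclusion *)

Lemma rsize_pos (r : rhs) : 1 <= rsize r.
Proof. destruct r; simpl; lia. Qed.

Lemma length_enc_rhs : forall r : rhs, length (enc_rhs r) <= 4 * rsize r.
Proof.
  fix IH 1. intros r.
  assert (HL : forall us : list rhs, length (flat_map enc_rhs us) <= 4 * list_sum (map rsize us)).
  { fix IHL 1. intros [|u us]; simpl; [lia|]. rewrite length_app. specialize (IH u). specialize (IHL us). unfold list_sum in *. lia. }
  destruct r as [d us|q i us|j]; simpl; try (specialize (HL us); unfold list_sum in *); lia.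
Qed.

Lemma rules_le_msize (M : mtt) : length (rules M) <= msize M.
Proof.
  unfold msize. induction (rules M) as [|x l IH]; simpl; auto. pose proof (rsize_pos (snd x)). unfold list_sum in *. lia.
Qed.

Lemma length_rules_code (M : mtt) : length (rules_code M) <= 6 * msize M.
Proof.
  unfold rules_code, msize. induction (rules M) as [|[[q sg] r] l IH]; simpl; auto.
  pose proof (rsize_pos r). pose proof (length_enc_rhs r). rewrite length_app. unfold list_sum in *. lia.
Qed.

(** All terms are compared with D = a * W * m. The square of n^(mx + 1) is at most W, and since n, a
    and m are positive, every lower-order product is at most D. The constant 3000 is generous. *)
Lemma time_bound (n a m mx max : nat) :
  1 <= n -> 1 <= a -> 1 <= m -> mx <= max -> mx <= n + a + m ->
  100 * (1 + n + a + 6 * m + m + (mx + 1) * (1 + n) + n ^ (mx + 1) + n * n) +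
    (2 + a * (20 + 8 * m + 250 * (n ^ (mx + 1) * (n ^ (mx + 1) * m)))) + 1 + 10 * (6 + 6 * m + 2 * a + 2 * n)
  <= 3000 * (a * n ^ (2 * max + 2) * m).
Proof.
  intros Hn Ha Hm Hx1 Hx2. set (W := n ^ (2 * max + 2)). set (X := n ^ (mx + 1)).
  assert (HX : 1 <= X) by (apply Nat.neq_0_lt_0, Nat.pow_nonzero; lia).
  assert (HXX : X * X <= W) by (unfold X, W; rewrite <- Nat.pow_add_r; apply Nat.pow_le_mono_r; lia).
  assert (Hnn : n * n <= W) by (unfold W; rewrite <- (Nat.pow_2_r n); apply Nat.pow_le_mono_r; lia).
  set (D := a * W * m).
  assert (HXW : X <= W) by nia.
  assert (HnW : n <= W) by nia.
  assert (HaW : a * W <= D) by (unfold D; nia).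
  assert (HWm : W * m <= D) by (unfold D; nia).
  assert (H1 : W <= D) by nia.
  assert (H2 : a * n <= D) by nia.
  assert (H3 : n * m <= D) by nia.
  assert (H4 : a * m <= D) by (unfold D; nia).
  (* The table of powers: here [mx] is bounded by the number of nodes and not through a power of
     [n], which may be 1. *)
  assert (H5 : (mx + 1) * (1 + n) <= 2 * ((n + a + m + 1) * n)) by nia.
  assert (H6 : a * (X * (X * m)) <= D).
  { replace (a * (X * (X * m))) with (a * (X * X) * m) by lia.
    apply Nat.mul_le_mono_r, Nat.mul_le_mono_l, HXX. }
  assert (H7 : a <= D) by nia. assert (H8 : m <= D) by nia.
  assert (E1 : (n + a + m + 1) * n = n * n + a * n + n * m + n) by lia.
  assert (E2 : a * (20 + 8 * m + 250 * (X * (X * m))) = 20 * a + 8 * (a * m) + 250 * (a * (X * (X * m)))) by lia.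
  rewrite E2. lia.
Qed.

Lemma no_rule_no_output (M : mtt) (s t : tree) :
  wf_mtt M -> wf_tree (inp M) s -> wf_tree (outp M) t -> rules M = [] -> ~ tau_IO M s t.
Proof.
  intros HM Hs Ht HR (_ & _ & H). inversion H. rewrite HR in *. contradiction.
Qed.

Lemma decide_ok (M : mtt) (s t : tree) (S : st) :
  wf_mtt M -> wf_tree (inp M) s -> wf_tree (outp M) t -> rules M <> [] ->
  (forall a i, A S a i = input_upto (enc_input M s t) (ptr_alph M s t) a i) ->
  cost decide S + 10 * ptr_alph M s t <= 3000 * (tsize s * tsize t ^ (2 * max_state_rank M + 2) * msize M) /\
  (V (exec decide S) 0 <> 0 <-> tau_IO M s t).
Proof.
  intros HM Hs Ht HR Hin.
  pose proof (rules_le_msize M) as Hrm. pose proof (length_rules_code M) as Hrc.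
  assert (HR1 : 1 <= length (rules M)) by (destruct (rules M); [contradiction|simpl; lia]).
  destruct (prepare_ok M s t S HM Ht (input_ok _ _ _ _ Hin)) as (mx & Hmx1 & Hmx2 & HP).
  pose proof (time_bound (tsize t) (tsize s) (msize M) mx (max_state_rank M) (tsize_pos t) (tsize_pos s) ltac:(lia) Hmx1 Hmx2) as HB.
  assert (HD : tri decide S (100 * (1 + tsize t + tsize s + length (rules_code M) + msize M + (mx + 1) * (1 + tsize t) +
      tsize t ^ (mx + 1) + tsize t * tsize t) +
      (2 + tsize s * (20 + 8 * length (rules M) + 250 * (tsize t ^ (mx + 1) * (tsize t ^ (mx + 1) * msize M))) + 1))
    (fun S' => V S' 0 <> 0 <-> tau_IO M s t)).
  { eapply tri_seq; [exact HP| |apply Nat.le_refl]. intros S1 F1 (HS & Hm & HF & HE). rewrite <- Hm.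
    eapply tri_seq; [apply main_pass_ok; eauto| |apply Nat.le_refl]. intros S2 F2 HB2.
    assert (HS2 : Static M s t S2) by (eapply static_frame; [exact F2|reflexivity|reflexivity|auto]).
    apply tri_asn; auto. vs.
    assert (Hq0 : In (q0 M, 0) (states M)) by apply HM.
    apply (block_callee M t s (q0 M) 0) in HB2; auto. destruct HB2 as [_ HB2].
    specialize (HB2 0). rewrite tau_IO_fact by auto.
    rewrite (st_n _ _ _ _ HS2), (st_q0 _ _ _ _ HS2).
    destruct (st_row _ _ _ _ HS2 (tsize t)) as [_ ->]; [rewrite length_nodes; pose proof (tsize_pos s); lia|].
    rewrite (proj1 F2 vW eq_refl), (proj2 F2 aQB eq_refl).
    (* The address is brought into the shape of [callee_ok] with rank 0 and code 0; that code names
       the root of [t]. *)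
    replace (tsize t * V S1 vW + (A S1 aQB (q0 M) + 1)) with (tsize t * V S1 vW + A S1 aQB (q0 M) + 0 + (1 + 0)) by lia.
    rewrite HB2 by (apply Nat.neq_0_lt_0, Nat.pow_nonzero; pose proof (tsize_pos t); lia).
    replace (sub_at t (dig (tsize t) 0 0)) with t; [reflexivity|].
    unfold dig. rewrite Nat.Div0.div_0_l, Nat.Div0.mod_0_l. destruct t; reflexivity. }
  destruct HD as [HD1 HD2]. split; auto. clear HD1 HP.
  unfold ptr_alph. rewrite !length_enc_tree.
  assert (H8 : tsize s * (20 + 8 * length (rules M) + 250 * (tsize t ^ (mx + 1) * (tsize t ^ (mx + 1) * msize M))) <=
    tsize s * (20 + 8 * msize M + 250 * (tsize t ^ (mx + 1) * (tsize t ^ (mx + 1) * msize M)))) by (apply Nat.mul_le_mono_l; lia).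
  lia.
Qed.

Theorem theorem4 :
  exists (P : list instr) (c : nat),
    forall (M : mtt) (s t : tree),
      wf_mtt M -> wf_tree (inp M) s -> wf_tree (outp M) t ->
      exists n : nat,
        n <= c * (tsize s * tsize t ^ (2 * max_state_rank M + 2) * msize M) + c /\
        decides_within P (enc_input M s t) n (tau_IO M s t).
Proof.
  (* 3000 times the slowdown pays for the program, another 3000 for copying the input, and 63 for
     the fixed part of the machine. *)
  exists (machine decide), (csize decide * 3000 + 3063). intros M s t HM Hs Ht.
  (* The slowdown factor becomes a variable, so that the arithmetic tactics do not evaluate it. *)
  generalize (csize decide) (decide_wf) (machine_ok decide M s t (tau_IO M s t)). intros k Hwf Hok.
  set (D := tsize s * tsize t ^ (2 * max_state_rank M + 2) * msize M).
  destruct (rules M) as [|x l] eqn:E.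
  - exists 2. split; [lia|]. apply machine_no_rules; auto. now apply no_rule_no_output.
  - rewrite <- E in Hok. assert (HR' : rules M <> []) by (rewrite E; discriminate).
    destruct (Hok (3000 * D) Hwf HR') as (n & Hn & Hd).
    + intros s0 H0. destruct (decide_ok M s t s0 HM Hs Ht HR' H0) as [Hc Hb]. split; auto. unfold D. lia.
    + exists n. split; auto.
      assert (Hp : 10 * ptr_alph M s t <= 3000 * D).
      (* The bound on [ptr_alph] is part of [decide_ok], which asks for a start state; any state
         with the right arrays serves. *)
      { destruct (decide_ok M s t (St (fun _ => 0) (input_upto (enc_input M s t) (ptr_alph M s t))) HM Hs Ht HR') as [Hc _]; auto.
        unfold D. lia. }
      nia.
Qed.
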